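(* Assume $n\ge 2k$, $\mathfrak g=\mathfrak{gl}_n(\mathbb{C})$ with universal enveloping algebra $U(\mathfrak g)$, $M=V^{\otimes k}\otimes(V^* )^{\otimes k}$, and $e=(\mathrm{id}-p_1)\cdots(\mathrm{id}-p_k)$ (so $eM\cong\mathfrak{sl}_n^{\otimes k}$ as $\mathfrak g$-modules). (1) Let $0\le r\le k$, $\underline s=(s_1<\cdots<s_{k-r})$ a subset of $\{1,\dots,k\}$, $\underline t=(t_1,\dots,t_{k-r})$ a sequence of distinct elements of $\{1,\dots,k\}$ with $s_i\ne t_i$ for every $i$, $\lambda,\mu$ partitions of $r$, $T$ a standard tableau of shape $\lambda$ with entries in $\{1,\dots,k\}\setminus\underline s$, $T^*$ a standard tableau of shape $\mu$ with entries in $\{1,\dots,k\}\setminus\underline t$; let $y=y_Ty_{T^*}c_{\underline s,\underline t}$ and $x'=x'_{T,T^*,\underline s,\underline t}=u'_1\otimes\cdots\otimes u'_k\otimes(w_1^* )'\otimes\cdots\otimes(w_k^* )'$ where $u'_p=v_{r+i}$ if $p=s_i$, $u'_p=v_j$ if $p\notin\underline s$ lies in row $j$ of $T$, $(w_p^* )'=v_{r+i}^*$ if $p=t_i$, and $(w_p^* )'=v_{n-j+1}^*$ if $p\notin\underline t$ lies in row $j$ of $T^*$. Then $eyeU(\mathfrak g)x'=U(\mathfrak g)eyx'=eU(\mathfrak g)yx'$ is an irreducible $\mathfrak g$-submodule of $eM$ of highest weight $(\lambda,\mu)$, i.e. isomorphic to $L(\lambda,\mu)$. (2) $\mathfrak{sl}_n^{\otimes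 k}\cong eM=\bigoplus U(\mathfrak g)eyx'$ (a direct sum), where the sum runs over all data $(r,\underline s,\underline t,\lambda,\mu,T,T^* )$ as in (1), i.e. $r=0,1,\dots,k$, $\underline s,\underline t$ as in (1) with $s_i\ne t_i$ for all $i$, $\lambda,\mu$ all partitions of $r$, and $T$, $T^*$ all standard tableaux of shapes $\lambda$, $\mu$ with entries in $\{1,\dots,k\}\setminus\underline s$, $\{1,\dots,k\}\setminus\underline t$ respectively.
   Context: $V=\mathbb{C}^n$ (column vectors, standard basis $v_1,\dots,v_n$), $V^*$ row vectors with dual basis $v_1^*,\dots,v_n^*$; $\mathfrak g$ acts on $V$ by left multiplication, on $V^*$ by $w^*\mapsto -w^*x$, and on $M$ by the tensor product action; $\mathfrak g$ acts on $\mathfrak{sl}_n$ by the adjoint action, and $eM\cong\mathfrak{sl}_n^{\otimes k}$ via $V\otimes V^*\cong\mathfrak{gl}_n$, $u\otimes w^*\mapsto uw^*$. For $1\le i,j\le k$ the contraction $c_{i,j}:M\to M$ is $c_{i,j}(u_1\otimes\cdots\otimes u_k\otimes w_1^*\otimes\cdots\otimes w_k^* )=(w_j^*u_i)\sum_{\ell=1}^n(\text{same tensor with }u_i\text{ replaced by }v_\ell\text{ and }w_j^*\text{ by }v_\ell^* )$; $p_i=\frac1n c_{i,i}$; $c_{\underline s,\underline t}=c_{s_1,t_1}\cdots c_{s_{k-r},t_{k-r}}$. For a standard tableau $T$ (rows and columns increasing) with entries in a subset of $\{1,\dots,k\}$, $R_T$ (resp. $C_T$) denotes the permutations of $\{1,\dots,k\}$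 fixing all non-entries and preserving each row (resp. column) of $T$ setwise, and $y_T=(\sum_{\rho\in R_T}\rho)(\sum_{\gamma\in C_T}\mathrm{sgn}(\gamma)\gamma)$; $y_T$ acts by place permutations on the factors of $V^{\otimes k}$, $y_{T^*}$ on the factors of $(V^* )^{\otimes k}$. For partitions $\lambda=(\lambda_1\ge\dots\ge\lambda_a>0)$, $\mu=(\mu_1\ge\dots\ge\mu_b>0)$ with $a+b\le n$, $L(\lambda,\mu)$ is the irreducible $\mathfrak{gl}_n$-module with highest weight $\sum_{i=1}^a\lambda_i\epsilon_i-\sum_{i=1}^b\mu_i\epsilon_{n+1-i}$, where $\epsilon_i$ picks out the $(i,i)$ entry of a diagonal matrix; ''highest weight $(\lambda,\mu)$'' means this weight. *)

(* Defs.v *)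
From HB Require Import structures.
From mathcomp Require Import all_boot all_order all_algebra all_fingroup.
From mathcomp Require Import complex.
From mathcomp Require Import Rstruct.
From mathcomp Require Import classical_sets boolp.
Set Implicit Arguments.
Unset Strict Implicit.
Unset Printing Implicit Defensive.
Import GRing.Theory.
Local Open Scope ring_scope.

Definition CC : numClosedFieldType := (Rdefinitions.R)[i].

Section TensorSpace.
Variables n k : nat.

(* A basis index (a, b) stands for
   v_{a 1} (x) ... (x) v_{a k} (x) v*_{b 1} (x) ... (x) v*_{b k}
   (positions 1..k and basis indices 1..n are 0-based here). *)
Definition idx := ({ffun 'I_k -> 'I_n} * {ffun 'I_k -> 'I_n})%type.

(* M = V^{(x)k} (x) (V-dual)^{(x)k}, as coordinate functions on the basis. *)
Definition M : vectType CC := {ffun idx -> CC^o}.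

Definition upd (f : {ffun 'I_k -> 'I_n}) (i : 'I_k) (l : 'I_n) :
  {ffun 'I_k -> 'I_n} := [ffun p => if p == i then l else f p].

(* action of x in gl_n on M (tensor product action; on the dual: w |-> - w x) *)
Definition act (x : 'M[CC]_n) (m : M) : M :=
  [ffun ab : idx =>
     (\sum_(i < k) \sum_(l < n) x (ab.1 i) l * m (upd ab.1 i l, ab.2))
   - (\sum_(j < k) \sum_(l < n) m (ab.1, upd ab.2 j l) * x l (ab.2 j))].

Definition submodule (W : {vspace M}) : Prop :=
  forall (x : 'M[CC]_n) (m : M), m \in W -> act x m \in W.

Definition is_Ugen (v : M) (W : {vspace M}) : Prop :=
  [/\ submodule W, v \in W &
      forall W' : {vspace M}, submodule W' -> v \in W' -> (W <= W')%VS].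
Definition Ugen (v : M) : {vspace M} := xget 0%VS (is_Ugen v).

Definition irreducible_submodule (W : {vspace M}) : Prop :=
  [/\ submodule W, W != 0%VS &
      forall W' : {vspace M}, submodule W' -> (W' <= W)%VS ->
        W' = 0%VS \/ W' = W].

(* the weight  sum_i la_i eps_i - sum_i mu_i eps_{n+1-i}  (0-based index q) *)
Definition hw (la mu : seq nat) (q : 'I_n) : int :=
  (nth 0%N la q)%:Z - (nth 0%N mu (n.-1 - q))%:Z.

Definition highest_weight_vector (nu : 'I_n -> int) (w : M) : Prop :=
  [/\ w != 0,
      forall i j : 'I_n, (i < j)%N -> act (delta_mx i j) w = 0 &
      forall d : 'rV[CC]_n,
        act (diag_mx d) w = (\sum_(q < n) d 0 q * (nu q)%:~R) *: w].

Definition irreducible_of_highest_weight (la mu : seq nat) (W : {vspace M})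
  : Prop :=
  irreducible_submodule W /\
  exists2 w, w \in W & highest_weight_vector (hw la mu) w.

Definition contr (i j : 'I_k) (m : M) : M :=
  [ffun ab : idx =>
     if ab.1 i == ab.2 j then
       \sum_(l < n) m (upd ab.1 i l, upd ab.2 j l)
     else 0].

Definition pr (i : 'I_k) (m : M) : M := (n%:R)^-1 *: contr i i m.

Definition eproj (m : M) : M :=
  foldr (fun i acc => acc - pr i acc) m (enum 'I_k).

Definition contr_seq (s t : seq 'I_k) (m : M) : M :=
  foldr (fun ij acc => contr ij.1 ij.2 acc) m (zip s t).

(* place permutations on the V-factors and on the V^*-factors:
   sigma (u_1 (x) ... (x) u_k) = u_{sigma^-1 1} (x) ... (x) u_{sigma^-1 k} *)
Definition permV (g : {perm 'I_k}) (m : M) : M :=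
  [ffun ab : idx => m ([ffun p => ab.1 (g p)], ab.2)].
Definition permW (g : {perm 'I_k}) (m : M) : M :=
  [ffun ab : idx => m (ab.1, [ffun p => ab.2 (g p)])].

(* Tableaux: a tableau is the list of its rows (top to bottom). *)
Definition tableau := seq (seq 'I_k).

Definition rowidx (T : tableau) (p : 'I_k) : nat := find (fun row => p \in row) T.
Definition colidx (T : tableau) (p : 'I_k) : nat :=
  index p (nth [::] T (rowidx T p)).

Definition is_partition_of (r : nat) (la : seq nat) : bool :=
  [&& sorted geq la, all (fun x => 0 < x)%N la & sumn la == r].

Definition standard_tableau (la : seq nat) (S : {set 'I_k}) (T : tableau)
  : bool :=
  [&& map size T == la,
      uniq (flatten T),
      [set p in flatten T] == S,
      all (fun row => sorted (fun a b : 'I_k => (a < b)%N) row) T &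
      [forall i : 'I_k, forall j : 'I_k,
         ((i.+1 < size T)%N && (j < size (nth [::] T i.+1))%N) ==>
         (nth j (nth [::] T i) j < nth j (nth [::] T i.+1) j)%N]].

Definition row_group (T : tableau) : {set {perm 'I_k}} :=
  [set g : {perm 'I_k} | [forall p, if p \in flatten T
     then (g p \in flatten T) && (rowidx T (g p) == rowidx T p)
     else g p == p]].
Definition col_group (T : tableau) : {set {perm 'I_k}} :=
  [set g : {perm 'I_k} | [forall p, if p \in flatten T
     then (g p \in flatten T) && (colidx T (g p) == colidx T p)
     else g p == p]].

Definition yV (T : tableau) (m : M) : M :=
  \sum_(rho in row_group T)
    permV rho (\sum_(gam in col_group T) (-1) ^+ odd_perm gam *: permV gam m).
Definition yW (T : tableau) (m : M) : M :=
  \sum_(rho in row_group T)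
    permW rho (\sum_(gam in col_group T) (-1) ^+ odd_perm gam *: permW gam m).

Definition yop (s t : seq 'I_k) (T Ts : tableau) (m : M) : M :=
  yV T (yW Ts (contr_seq s t m)).

Definition basis_vec (A B : 'I_k -> nat) : M :=
  [ffun ab : idx => ([forall p, (val (ab.1 p) == A p) && (val (ab.2 p) == B p)])%:R].

Definition xprime (r : nat) (s t : seq 'I_k) (T Ts : tableau) : M :=
  basis_vec
    (fun p => if p \in s then (r + index p s)%N else rowidx T p)
    (fun p => if p \in t then (r + index p t)%N else (n.-1 - rowidx Ts p)%N).

Definition admissible (r : nat) (s t : seq 'I_k) (la mu : seq nat)
  (T Ts : tableau) : bool :=
  [&& (r <= k)%N,
      sorted (fun a b : 'I_k => (a < b)%N) s, size s == (k - r)%N,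
      uniq t, size t == (k - r)%N,
      all2 (fun a b => a != b) s t,
      is_partition_of r la, is_partition_of r mu,
      standard_tableau la [set p | p \notin s] T &
      standard_tableau mu [set p | p \notin t] Ts].

Definition datum := (nat * seq 'I_k * seq 'I_k * seq nat * seq nat
                     * tableau * tableau)%type.

Definition admissible_datum (d : datum) : bool :=
  let: (r, s, t, la, mu, T, Ts) := d in admissible r s t la mu T Ts.

Definition summand (d : datum) : {vspace M} :=
  let: (r, s, t, la, mu, T, Ts) := d in
  Ugen (eproj (yop s t T Ts (xprime r s t T Ts))).

End TensorSpace.

(* Main.v *)
(* Call a vector of M extremal if all E_pq with p < q kill it.  Extremal vectors
   are orthogonal, for the standard Hermitian form, to the images of the lowering
   operators, while U(g) w is contained in C w plus these images for an extremal
   weight vector w.  So w spans the extremal vectors of U(g) w; since every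
   nonzero submodule contains an extremal vector, U(g) w is irreducible, and a sum
   of modules U(g) w_d is direct as soon as the w_d are linearly independent.

   Let d range over all data, the condition s_i <> t_i being dropped.
   Independence of the vectors y_d x'_d: the pairings of y_d' x'_d' with the
   column antisymmetrization of x'_d form a triangular matrix for the
   lexicographic order on row words of tableaux.  When s_i <> t_i for all i, these
   pairings only involve coordinates (a, b) with a_i <> b_i for all i, which e does
   not change, so the e y_d x'_d are independent too.
   Spanning: an extremal vector phi is determined by its coordinates at the x'_d.
   If phi (a, b) <> 0, then, n >= 2k providing unused indices, the extremality
   equations trade every coincidence a_i = b_j for one at an index used nowhere
   else; when the number of coincidences is maximal the remaining letters of a and
   b satisfy the equations of highest weight vectors of V^{(x)r} and of its dual
   separately, so that phi is nonzero at a pair of lattice words, that is, at x'_d.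
   Hence the y_d x'_d form a basis of the extremal vectors of M.  As e kills those
   with some s_i = t_i, the orthogonal complement of the sum of the U(g) e y_d x'_d
   in eM contains no extremal vector, and is therefore zero. *)

Require Import Defs.
From HB Require Import structures.
From mathcomp Require Import all_boot all_order all_algebra all_fingroup.
From mathcomp Require Import complex Rstruct classical_sets boolp.
From mathcomp Require Import finset.
Import GRing.Theory.
Local Open Scope ring_scope.
Local Notation act := Defs.act.

Set Implicit Arguments.
Unset Strict Implicit.
Unset Printing Implicit Defensive.
Import Order.TTheory Num.Theory.

(** * The action and the Hermitian form *)

(** With letters counted from 0, the entries of T use letters below r, the pairs (s_i, t_i) those in
    [r, k), and the entries of [Ts] those in [n - r, n). The bound n >= 2k gives k <= n - r, so
    these ranges are disjoint: at a coordinate (a, b) of u, the column antisymmetrization of x'_d, a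
    coincidence a_i = b_j can only come from a pair of d. The two halves meet in a dimension count:
    independence bounds the number of data by the dimension of the extremal space of M, and
    evaluation at the x'_d bounds that dimension by the number of data. The count takes place in M,
    where coordinates are unconstrained, and e is applied afterwards to the resulting spanning set.
    The choice of u is dictated by the form: row symmetrizers are self-adjoint and can be moved onto
    u. What then arises is a row symmetrizer of d' against a column antisymmetrizer of d, which is
    zero as soon as one transposition lies in both groups. *)

Section Action.
Variables n k : nat.
Local Notation idx := (idx n k).
Local Notation M := (M n k).
Implicit Types (m w z : M) (ab : idx) (x y : 'M[CC]_n).

Lemma M_ext m w : (forall ab, m ab = w ab) -> m = w.
Proof. by move=> h; apply/ffunP. Qed.

Lemma M0E ab : (0 : M) ab = 0. Proof. exact: ffunE. Qed.
Lemma MDE m w ab : (m + w) ab = m ab + w ab. Proof. exact: ffunE. Qed.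
Lemma MNE m ab : (- m) ab = - m ab. Proof. exact: ffunE. Qed.
Lemma MZE (c : CC) m ab : (c *: m) ab = c * m ab. Proof. exact: ffunE. Qed.
Lemma MsumE (I : Type) (r : seq I) (P : pred I) (F : I -> M) ab :
  (\sum_(i <- r | P i) F i) ab = \sum_(i <- r | P i) F i ab.
Proof.
by elim/big_rec2: _ => [|i y1 y2 _ <-]; rewrite ?M0E ?MDE.
Qed.
Definition ME := (M0E, MDE, MNE, MZE, MsumE).

(* A site is one of the 2k tensor factors; on a dual factor x acts through
   the matrix -x^T, which makes both kinds of factors uniform. *)
Definition site := ('I_k + 'I_k)%type.
Implicit Types o : site.

Definition site_val o ab : 'I_n :=
  match o with inl i => ab.1 i | inr j => ab.2 j end.
Definition site_upd o (l : 'I_n) ab : idx :=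
  match o with inl i => (upd ab.1 i l, ab.2) | inr j => (ab.1, upd ab.2 j l) end.
Definition site_mx o x : 'M[CC]_n :=
  match o with inl _ => x | inr _ => - x^T end.
Definition site_act o x m : M :=
  [ffun ab => \sum_l site_mx o x (site_val o ab) l * m (site_upd o l ab)].

Lemma site_val_upd o l ab : site_val o (site_upd o l ab) = l.
Proof. by case: o => i /=; rewrite ffunE eqxx. Qed.

Lemma site_val_updN o o' l ab : o' != o ->
  site_val o' (site_upd o l ab) = site_val o' ab.
Proof.
by case: o o' => i [] j //= h; rewrite ffunE; case: (j =P i) h => [->|//]; rewrite eqxx.
Qed.

Lemma updK (f : {ffun 'I_k -> 'I_n}) i l l' : upd (upd f i l) i l' = upd f i l'.
Proof. by apply/ffunP=> p; rewrite !ffunE; case: eqP. Qed.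
Lemma upd_id (f : {ffun 'I_k -> 'I_n}) i : upd f i (f i) = f.
Proof. by apply/ffunP=> p; rewrite !ffunE; case: eqP => // ->. Qed.
Lemma updC (f : {ffun 'I_k -> 'I_n}) i j l l' : i != j ->
  upd (upd f i l) j l' = upd (upd f j l') i l.
Proof.
move=> h; apply/ffunP=> p; rewrite !ffunE; case: (p =P i) => [->|//].
by rewrite (negbTE h).
Qed.

Lemma site_updK o l l' ab : site_upd o l' (site_upd o l ab) = site_upd o l' ab.
Proof. by case: o => i /=; rewrite updK. Qed.

Lemma site_upd_id o ab : site_upd o (site_val o ab) ab = ab.
Proof. by case: o => i /=; rewrite upd_id; case: ab. Qed.

Lemma site_updC o o' l l' ab : o != o' ->
  site_upd o' l' (site_upd o l ab) = site_upd o l (site_upd o' l' ab).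
Proof.
by case: o o' => i [] j //= h; congr pair; rewrite updC //; apply: contra h => /eqP->.
Qed.

Lemma actE x m : act x m = \sum_o site_act o x m.
Proof.
apply: M_ext => ab; rewrite ffunE MsumE big_sumType /=; congr (_ + _).
  by apply: eq_bigr => i _; rewrite ffunE.
rewrite -sumrN; apply: eq_bigr => j _; rewrite ffunE -sumrN /=.
by apply: eq_bigr => l _; rewrite !mxE mulNr mulrC.
Qed.

Lemma site_act_is_linear o x : linear (site_act o x).
Proof.
move=> c m w; apply: M_ext => ab; rewrite !ME !ffunE mulr_sumr -big_split /=.
by apply: eq_bigr => l _; rewrite !ME mulrDr mulrCA.
Qed.

Lemma act_is_linear x : linear (act x : M -> M).
Proof.
move=> c m w; rewrite !actE scaler_sumr -big_split /=.
by apply: eq_bigr => o _; rewrite site_act_is_linear.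
Qed.
HB.instance Definition _ x := GRing.isLinear.Build _ _ _ _ _ (act_is_linear x).

Lemma actB x m w : act x (m - w) = act x m - act x w.
Proof. exact: (linearB (act x)). Qed.
Lemma actZ x (c : CC) m : act x (c *: m) = c *: act x m.
Proof. exact: (linearZ_LR (act x)). Qed.

Lemma act_linearl (c : CC) x y m : act (c *: x + y) m = c *: act x m + act y m.
Proof.
rewrite !actE scaler_sumr -big_split /=; apply: eq_bigr => o _.
apply: M_ext => ab; rewrite !ME !ffunE mulr_sumr -big_split /=.
apply: eq_bigr => l _; case: o => i /=; rewrite !mxE ?mulrDl ?mulrA //.
by rewrite opprD mulrDl !(mulNr, mulrN) ?mulrA.
Qed.

Lemma act0l m : act 0 m = 0.
Proof. by have := act_linearl (-1) 0 0 m; rewrite scaler0 addr0 scaleN1r addNr. Qed.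

Lemma act_sum (I : Type) (r : seq I) (P : pred I) (F : I -> 'M[CC]_n) m :
  act (\sum_(i <- r | P i) F i) m = \sum_(i <- r | P i) act (F i) m.
Proof.
elim/big_rec2: _ => [|i y1 y2 _ <-]; first exact: act0l.
by rewrite -[F i]scale1r act_linearl !scale1r.
Qed.

Lemma site_actC o o' x y m : o != o' ->
  site_act o x (site_act o' y m) = site_act o' y (site_act o x m).
Proof.
move=> h; apply: M_ext => ab; rewrite !ffunE.
under eq_bigr => l _ do rewrite ffunE mulr_sumr.
rewrite exchange_big /=; apply: eq_bigr => l _; rewrite ffunE mulr_sumr.
have h' : o' != o by rewrite eq_sym.
apply: eq_bigr => l' _; rewrite site_updC // (site_val_updN _ _ h).
by rewrite (site_val_updN _ _ h') mulrCA.
Qed.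

Lemma site_act_comp o x y m :
  site_act o x (site_act o y m) =
  [ffun ab => \sum_l (site_mx o x *m site_mx o y) (site_val o ab) l
                       * m (site_upd o l ab)].
Proof.
apply: M_ext => ab; rewrite !ffunE.
under eq_bigr => l _ do rewrite ffunE mulr_sumr.
rewrite exchange_big /=; apply: eq_bigr => l _; rewrite mxE mulr_suml.
by apply: eq_bigr => l' _; rewrite site_updK site_val_upd mulrA.
Qed.

(** On a dual factor the transpose reverses products, and the sign in -x^T restores the bracket. *)
Lemma site_act_bracket o x y m :
  site_act o x (site_act o y m) - site_act o y (site_act o x m) =
  site_act o (x *m y - y *m x) m.
Proof.
rewrite !site_act_comp; apply: M_ext => ab; rewrite !ME !ffunE -sumrB.
apply: eq_bigr => l _; rewrite -mulrBl; congr (_ * _); case: o => i /=.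
  by rewrite !mxE.
rewrite linearB /= !trmx_mul !mulNmx !mulmxN !opprK opprB.
by rewrite !mxE.
Qed.

(** Operators at distinct sites commute, so only the diagonal terms of the double sum over sites
    contribute to the commutator. *)
Lemma act_bracket x y m :
  act x (act y m) = act y (act x m) + act (x *m y - y *m x) m.
Proof.
apply/eqP; rewrite -subr_eq0 opprD addrA subr_eq0; apply/eqP.
have ex u v : act u (act v m) = \sum_o \sum_o' site_act o u (site_act o' v m).
  rewrite actE; apply: eq_bigr => o _; rewrite actE.
  pose f := GRing.isLinear.Build _ _ _ _ _ (site_act_is_linear o u).
  pose F : {linear M -> M} := HB.pack (site_act o u) f.
  exact: (raddf_sum F).
rewrite (ex x y) (ex y x) [X in _ - X]exchange_big /= -sumrB actE.
apply: eq_bigr => o _; rewrite -sumrB (bigD1 o) //= big1 ?addr0.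
  by rewrite site_act_bracket.
by move=> o' h; rewrite site_actC 1?eq_sym // subrr.
Qed.

(** On coordinates the substitution runs opposite to the one on basis vectors: the value at (a, b)
    collects the words with one letter p of a changed to q, or one letter q of b changed to p. *)
Lemma act_delta p q m (a b : {ffun 'I_k -> 'I_n}) :
  act (delta_mx p q) m (a, b) =
    \sum_(i | a i == p) m (upd a i q, b) - \sum_(j | b j == q) m (a, upd b j p).
Proof.
rewrite ffunE /=; congr (_ - _).
  rewrite [RHS]big_mkcond /=; apply: eq_bigr => i _.
  rewrite (bigD1 q) //= big1 ?addr0 => [|l hl]; rewrite mxE.
    by rewrite eqxx andbT; case: eqP; rewrite ?mul1r ?mul0r.
  by rewrite (negbTE hl) andbF mul0r.
rewrite [RHS]big_mkcond /=; apply: eq_bigr => i _.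
rewrite (bigD1 p) //= big1 ?addr0 => [|l hl]; rewrite mxE.
  by rewrite eqxx /=; case: eqP; rewrite ?mulr1 ?mulr0.
by rewrite (negbTE hl) mulr0.
Qed.

Lemma act_diag (d : 'rV[CC]_n) m ab :
  act (diag_mx d) m ab =
    (\sum_i d 0 (ab.1 i) - \sum_j d 0 (ab.2 j)) * m ab.
Proof.
case: ab => a b; rewrite ffunE /= mulrBl !mulr_suml; congr (_ - _).
  apply: eq_bigr => i _; rewrite (bigD1 (a i)) //= big1 ?addr0 => [|l hl].
    by rewrite mxE eqxx mulr1n upd_id.
  by rewrite mxE eq_sym (negbTE hl) mulr0n mul0r.
apply: eq_bigr => i _; rewrite (bigD1 (b i)) //= big1 ?addr0 => [|l hl].
  by rewrite mxE eqxx mulr1n upd_id mulrC.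
by rewrite mxE (negbTE hl) mulr0n mulr0.
Qed.

Definition dot m w : CC := \sum_ab m ab * (w ab)^*.

Definition dotr w m : CC^o := dot m w.
Lemma dotr_is_linear w : linear (dotr w).
Proof.
move=> c m m'; rewrite /dotr /dot scaler_sumr -big_split /=; apply: eq_bigr => ab _.
by rewrite !ME mulrDl -mulrA.
Qed.
HB.instance Definition _ w := GRing.isLinear.Build _ _ _ _ _ (dotr_is_linear w).

Lemma dotC m w : dot m w = (dot w m)^*.
Proof.
rewrite /dot rmorph_sum; apply: eq_bigr => ab _ /=.
by rewrite rmorphM /= conjCK mulrC.
Qed.

Lemma dotDl m m' w : dot (m + m') w = dot m w + dot m' w.
Proof. exact: (linearD (dotr w)). Qed.
Lemma dotZl c m w : dot (c *: m) w = c * dot m w.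
Proof. exact: (linearZ_LR (dotr w)). Qed.
Lemma dot0l w : dot 0 w = 0.
Proof. exact: (linear0 (dotr w)). Qed.
Lemma dot_suml (I : Type) (r : seq I) (P : pred I) (F : I -> M) w :
  dot (\sum_(i <- r | P i) F i) w = \sum_(i <- r | P i) dot (F i) w.
Proof. exact: (linear_sum (dotr w)). Qed.
Lemma dot0r m : dot m 0 = 0.
Proof. by rewrite dotC dot0l rmorph0. Qed.
Lemma dotZr c m w : dot m (c *: w) = c^* * dot m w.
Proof. by rewrite dotC dotZl rmorphM /= -!dotC. Qed.
Lemma dot_sumr (I : Type) (r : seq I) (P : pred I) (F : I -> M) w :
  dot w (\sum_(i <- r | P i) F i) = \sum_(i <- r | P i) dot w (F i).
Proof.
by rewrite dotC dot_suml rmorph_sum; apply: eq_bigr => i _; rewrite [RHS]dotC.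
Qed.

Lemma dot_eq0 m : dot m m = 0 -> m = 0.
Proof.
move=> h; apply: M_ext => ab; rewrite M0E.
have /(_ ab isT)/eqP := psumr_eq0P (fun ab _ => mul_conjC_ge0 (m ab)) h.
by rewrite mul_conjC_eq0 => /eqP.
Qed.

Lemma site_mx_adj o x : site_mx o (map_mx Num.conj x^T) = map_mx Num.conj (site_mx o x)^T.
Proof.
case: o => i //=; apply/matrixP=> p q; rewrite !mxE.
by rewrite rmorphN.
Qed.

Lemma dot_act x m w : dot (act x m) w = dot m (act (map_mx Num.conj x^T) w).
Proof.
rewrite !actE dot_suml dot_sumr; apply: eq_bigr => o _; rewrite /dot.
under eq_bigr => ab _ do rewrite ffunE mulr_suml.
under [RHS]eq_bigr => ab _ do rewrite ffunE rmorph_sum mulr_sumr.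
rewrite !pair_big /=.
(* This involution exchanges the letter at the site with the summation letter, which turns the sum
   for x into the sum for its adjoint. *)
pose f (u : idx * 'I_n) := (site_upd o u.2 u.1, site_val o u.1).
have fK : involutive f.
  by case=> ab l; rewrite /f /= site_updK site_val_upd site_upd_id.
rewrite [RHS](reindex_inj (inv_inj fK)); apply: eq_bigr => -[ab l] _ /=.
rewrite site_mx_adj !mxE rmorphM /= conjCK site_updK site_val_upd site_upd_id.
by rewrite mulrAC -mulrA mulrA mulrC mulrA.
Qed.

End Action.

(** * Highest weight vectors and the submodules they generate *)

Section HighestWeight.
Variables n k : nat.
Local Notation idx := (idx n k).
Local Notation M := (M n k).
Implicit Types (m w z v : M) (ab : idx) (x y : 'M[CC]_n) (W U : {vspace M}).

Definition stable (X : 'M[CC]_n -> Prop) W :=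
  forall x m, X x -> m \in W -> act x m \in W.

(** A candidate of least dimension works: its intersection with any competitor is again a candidate.
    X is taken to be all of gl_n for [Ugen], and the lowering operators in [Ugen_sub_low]. *)
Lemma smallest_stable X v : exists W,
  [/\ stable X W, v \in W &
      forall W', stable X W' -> v \in W' -> (W <= W')%VS].
Proof.
pose P d := `[< exists W, [/\ stable X W, v \in W & \dim W = d] >].
have exP : exists d, P d.
  exists (\dim {:M}); apply/asboolP; exists fullv; split=> //; last exact: memvf.
  by move=> x m _ _; exact: memvf.
case: (ex_minnP exP) => d /asboolP[W [stW vW dW]] minW.
exists W; split=> // W' stW' vW'.
have : (d <= \dim (W :&: W'))%N.
  apply: minW; apply/asboolP; exists (W :&: W')%VS; split=> //.
    by move=> x m Xx; rewrite !memv_cap => /andP[mW mW']; rewrite stW // stW'.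
  by rewrite memv_cap vW.
by rewrite -dW => h; apply/capv_idPl/eqP; rewrite eqEdim capvSl.
Qed.

Lemma UgenP v : is_Ugen v (Ugen v).
Proof.
apply: (@xgetPex _ 0%VS (is_Ugen v)).
have [W [st vW mW]] := smallest_stable (fun=> True) v.
exists W; split=> // [x m|W' sW' vW']; first exact: st.
by apply: mW => // x m _; exact: sW'.
Qed.

Lemma Ugen_submodule v : submodule (Ugen v). Proof. by case: (UgenP v). Qed.
Lemma mem_Ugen v : v \in Ugen v. Proof. by case: (UgenP v). Qed.
Lemma Ugen_min v W : submodule W -> v \in W -> (Ugen v <= W)%VS.
Proof. by case: (UgenP v) => _ _; exact. Qed.

Definition equivariant (f : 'End(M)) := forall x m, f (act x m) = act x (f m).

Lemma equivariant_comp f g :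
  equivariant f -> equivariant g -> equivariant (f \o g)%VF.
Proof. by move=> hf hg x m; rewrite !comp_lfunE hg hf. Qed.

Lemma limg_submodule f U : equivariant f -> submodule U -> submodule (f @: U).
Proof.
by move=> fE sU x m /memv_imgP[u uU ->]; rewrite -fE; apply/memv_img/sU.
Qed.

(** Both inclusions come from minimality, applied to the image and to the preimage. This identifies
    eyeU(g)x' and eU(g)yx' with submodules generated by one vector. *)
Lemma limg_Ugen f v : equivariant f -> (f @: Ugen v)%VS = Ugen (f v).
Proof.
move=> fE; apply/eqP; rewrite eqEsubv; apply/andP; split; last first.
  apply: Ugen_min; last exact/memv_img/mem_Ugen.
  exact/limg_submodule/Ugen_submodule.
apply/subvP=> _ /memv_imgP[u uU ->].
rewrite memv_preim; move: u uU; apply/subvP; apply: Ugen_min.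
  move=> x m; rewrite -!memv_preim fE; exact: Ugen_submodule.
by rewrite -memv_preim mem_Ugen.
Qed.

Lemma add_submodule U W : submodule U -> submodule W -> submodule (U + W)%VS.
Proof.
move=> sU sW x _ /memv_addP[u uU [w wW ->]].
by rewrite linearD memv_add ?sU ?sW.
Qed.

Lemma sum_submodule (I : Type) (r : seq I) (F : I -> {vspace M}) :
  (forall i, submodule (F i)) -> submodule (\sum_(i <- r) F i)%VS.
Proof.
move=> h; elim/big_ind: _ => //; last by move=> *; exact: add_submodule.
by move=> x m; rewrite !memv0 => /eqP->; rewrite linear0.
Qed.

Definition hwspace : {vspace M} :=
  (\bigcap_(pq : 'I_n * 'I_n | (pq.1 < pq.2)%N)
     lker (linfun (act (delta_mx pq.1 pq.2) : M -> M)))%VS.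

Lemma hwspaceP m : reflect
  (forall p q : 'I_n, (p < q)%N -> act (delta_mx p q) m = 0) (m \in hwspace).
Proof.
apply: (iffP idP) => [h p q pq|h].
  have := subv_trans h (bigcapv_inf (p, q) pq (subvv _)).
  by rewrite -memvE memv_ker lfunE => /eqP.
rewrite memvE; apply/subv_bigcapP => -[p q] pq.
by rewrite -memvE memv_ker lfunE /= h.
Qed.

Definition lowspace : {vspace M} :=
  (\sum_(pq : 'I_n * 'I_n | (pq.2 < pq.1)%N)
     limg (linfun (act (delta_mx pq.1 pq.2) : M -> M)))%VS.

Lemma lowspace_act (p q : 'I_n) m :
  (q < p)%N -> act (delta_mx p q) m \in lowspace.
Proof.
move=> qp; rewrite memvE.
apply: subv_trans (sumv_sup (p, q) qp (subvv _)).
have -> : act (delta_mx p q) m = linfun (act (delta_mx p q) : M -> M) m.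
  by rewrite lfunE.
by rewrite -memvE memv_img ?memvf.
Qed.

Lemma hwspace_dot_lowspace z m : z \in hwspace -> m \in lowspace -> dot m z = 0.
Proof.
move=> /hwspaceP zH /memv_sumP[u uP ->]; rewrite dot_suml big1 // => -[p q] qp.
have /memv_imgP[v _ ->] := uP _ qp.
rewrite lfunE dot_act /= trmx_delta map_delta_mx zH //; exact: dot0r.
Qed.

Lemma act_mem x m W :
  (forall p q, act (delta_mx p q) m \in W) -> act x m \in W.
Proof.
move=> h; rewrite [x]matrix_sum_delta act_sum memv_suml // => i _.
rewrite act_sum memv_suml // => j _.
by rewrite -[_ *: _]addr0 act_linearl act0l addr0 memvZ.
Qed.

Definition weight_vector w :=
  forall d : 'rV[CC]_n, exists c, act (diag_mx d) w = c *: w.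

(* The subspace N generated from w by lowering operators alone is already a
   submodule: the vectors u of N with gl_n u inside N form a subspace that is
   stable under lowering, because x E u = E x u + [x, E] u. *)
Lemma Ugen_sub_low w : w \in hwspace -> weight_vector w ->
  (Ugen w <= <[w]> + lowspace)%VS.
Proof.
move=> /hwspaceP wH ww.
pose X x := exists2 pq : 'I_n * 'I_n, (pq.2 < pq.1)%N & x = delta_mx pq.1 pq.2.
have [N [stN wN minN]] := smallest_stable X w.
have subN : (N <= <[w]> + lowspace)%VS.
  apply: minN; last exact: subvP (addvSl _ _) _ (memv_line _).
  move=> _ m [[p q] /= qp ->] _; apply: subvP (addvSr _ _) _ _.
  exact: lowspace_act.
apply: subv_trans subN; apply: Ugen_min => //.
pose Q := (N :&: \bigcap_(pq : 'I_n * 'I_n)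
             ((linfun (act (delta_mx pq.1 pq.2) : M -> M)) @^-1: N))%VS.
have QP m : m \in Q <-> m \in N /\ forall x, act x m \in N.
  rewrite memv_cap; split=> [/andP[mN mQ]|[mN mQ]]; last first.
    rewrite mN memvE; apply/subv_bigcapP => -[p q] _.
    by rewrite -memvE -memv_preim lfunE mQ.
  split=> // x; apply: act_mem => p q.
  have := subv_trans mQ (bigcapv_inf (p, q) isT (subvv _)).
  by rewrite -memvE -memv_preim lfunE.
have NQ : (N <= Q)%VS.
  apply: minN.
    move=> E m XE /QP[mN mg]; apply/QP; split=> [|x]; first exact: stN.
    by rewrite act_bracket memvD // stN.
  apply/QP; split=> // x; apply: act_mem => p q.
  have [pq|qp|/val_inj->] := ltngtP p q; first by rewrite wH ?mem0v.
    by apply: stN => //; exists (p, q).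
  have [c] := ww (delta_mx 0 q).
  have -> : diag_mx (delta_mx 0 q) = delta_mx q q :> 'M[CC]_n.
    apply/matrixP=> i j; rewrite !mxE eqxx /=.
    have [<-|ij] := eqVneq i j; first by rewrite mulr1n andbb.
    rewrite mulr0n; case: (i =P q) => //= iq; case: (j =P q) => // jq.
    by rewrite iq jq eqxx in ij.
  by move->; rewrite memvZ.
by move=> x m mN; have /QP[_] := subvP NQ _ mN; exact.
Qed.

(** Writing z = c w + m with m in [lowspace], the vector m is extremal as well, hence orthogonal to
    itself. *)
Lemma hwspace_Ugen w z : w \in hwspace -> weight_vector w ->
  z \in hwspace -> z \in Ugen w -> z \in <[w]>%VS.
Proof.
move=> wH ww zH /(subvP (Ugen_sub_low wH ww))/memv_addP[_ /vlineP[c ->] [m mL zE]].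
have mH : m \in hwspace by rewrite -[m](addKr (c *: w)) -zE memvD ?memvN ?memvZ.
have /dot_eq0 m0 := hwspace_dot_lowspace mH mL.
by rewrite zE m0 addr0 memvZ ?memv_line.
Qed.

(** For p < q, both substitutions in the coordinate formula of E_pq, p to q in a and q to p in b,
    strictly lower this number. *)
Definition height ab : nat := (\sum_i (n - ab.1 i) + \sum_j ab.2 j)%N.

Lemma sum_upd_lt (f : 'I_n -> nat) (a : {ffun 'I_k -> 'I_n}) i l :
  (f l < f (a i))%N -> (\sum_p f (upd a i l p) < \sum_p f (a p))%N.
Proof.
move=> h; rewrite (bigD1 i) //= [X in (_ < X)%N](bigD1 i) //= ffunE eqxx.
rewrite -addSn leq_add // leq_sum // => p pi.
by rewrite ffunE (negbTE pi).
Qed.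

Lemma act_raise_height (p q : 'I_n) (h : nat) m : (p < q)%N ->
  (forall ab, (height ab < h)%N -> m ab = 0) ->
  forall ab, (height ab < h.+1)%N -> act (delta_mx p q) m ab = 0.
Proof.
move=> pq mh [a b] hab; rewrite act_delta !big1 ?subrr // => i /eqP ai;
  apply: mh; rewrite -ltnS; apply: leq_trans hab; rewrite ltnS /height /=.
  rewrite ltn_add2l; apply: (@sum_upd_lt (fun l : 'I_n => l : nat)).
  by rewrite ai.
rewrite ltn_add2r; apply: (@sum_upd_lt (fun l : 'I_n => (n - l)%N)).
by rewrite ai ltn_sub2l.
Qed.

(** Take a nonzero vector of W whose coordinates vanish below the greatest possible height. A
    raising operator would push this bound one further, so it kills the vector. *)
Lemma submodule_hw W : submodule W -> W != 0%VS ->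
  exists z, [/\ z \in W, z != 0 & z \in hwspace].
Proof.
move=> sW /eqP W0.
pose P h := `[< exists z, [/\ z \in W, z != 0 &
                  forall ab, (height ab < h)%N -> z ab = 0] >].
have exP : exists h, P h.
  exists 0%N; apply/asboolP; exists (vpick W).
  by rewrite vpick0 memv_pick; split=> //; exact/eqP.
have ubP h : P h -> (h <= (\max_ab height ab))%N.
  move=> /asboolP[z [_ z0 zh]]; rewrite leqNgt; apply: contra z0 => hh.
  apply/eqP/M_ext => ab; rewrite M0E zh //.
  by apply: leq_ltn_trans hh; exact: leq_bigmax.
case: (ex_maxnP exP ubP) => h /asboolP[z [zW z0 zh]] maxh.
exists z; split=> //; apply/hwspaceP => p q pq; apply/eqP.
apply: contraT => ez; suff: (h < h)%N by rewrite ltnn.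
apply: maxh; apply/asboolP; exists (act (delta_mx p q) z); split=> //.
  exact: sW.
exact: act_raise_height.
Qed.

Lemma Ugen_irreducible w : w != 0 -> w \in hwspace -> weight_vector w ->
  irreducible_submodule (Ugen w).
Proof.
move=> w0 wH ww; split; first exact: Ugen_submodule.
  by apply: contra w0 => /eqP h; rewrite -memv0 -h mem_Ugen.
move=> W sW WU; have [->|W0] := eqVneq W 0%VS; [by left|right].
have [z [zW z0 zH]] := submodule_hw sW W0.
have /vlineP[c zE] := hwspace_Ugen wH ww zH (subvP WU _ zW).
have c0 : c != 0 by apply: contra z0 => /eqP c0; rewrite zE c0 scale0r.
apply/eqP; rewrite eqEsubv WU Ugen_min //.
by rewrite -[w](scalerK c0) -zE memvZ.
Qed.

(** The second conclusion carries the induction. If U(g) w_i met the sum of the others,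
    irreducibility would put w_i in that sum, hence in the span of the other w_j. For an extremal z
    = u + v, raising operators send u and -v to the same vector of a zero intersection, so u and v
    are extremal too. *)
Lemma Ugen_direct (I : eqType) (r : seq I) (w : I -> M) :
  (forall i, i \in r -> w i \in hwspace /\ weight_vector (w i)) ->
  free (map w r) ->
  \dim (\sum_(i <- r) Ugen (w i)) = (\sum_(i <- r) \dim (Ugen (w i)))%N /\
  forall z, z \in hwspace -> z \in (\sum_(i <- r) Ugen (w i))%VS ->
    z \in <<map w r>>%VS.
Proof.
elim: r => [|i r IH] wr fr.
  rewrite !big_nil dimv0; split=> // z _; rewrite memv0 => /eqP->.
  exact: mem0v.
move: fr; rewrite /= free_cons => /andP[wi fr].
have [iH iw] := wr i (mem_head _ _).
have [j rj|dr hr] := IH _ fr; first by apply: wr; rewrite inE rj orbT.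
have cap0 : (Ugen (w i) :&: \sum_(j <- r) Ugen (w j))%VS = 0%VS.
  have sS : submodule (\sum_(j <- r) Ugen (w j))%VS.
    by apply: sum_submodule => j; exact: Ugen_submodule.
  have w0 : w i != 0 by apply: contra wi => /eqP->; exact: mem0v.
  have [_ _ irr] := Ugen_irreducible w0 iH iw.
  have [x m||//|UE] := irr (Ugen (w i) :&: \sum_(j <- r) Ugen (w j))%VS.
  - rewrite !memv_cap => /andP[mU mS].
    by rewrite (Ugen_submodule _ mU) (sS _ _ mS).
  - exact: capvSl.
  case/negP: wi; apply: hr => //.
  by have := mem_Ugen (w i); rewrite -UE memv_cap => /andP[].
rewrite !big_cons dimv_disjoint_sum // dr; split=> // z /hwspaceP zH.
case/memv_addP => u uU [v vS zE].
have uvH (p q : 'I_n) : (p < q)%N ->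
    act (delta_mx p q) u = 0 /\ act (delta_mx p q) v = 0.
  move=> pq; have := zH p q pq; rewrite zE linearD /= => /eqP.
  rewrite addr_eq0 => /eqP e1.
  have : act (delta_mx p q) u \in (Ugen (w i) :&: \sum_(j <- r) Ugen (w j))%VS.
    rewrite memv_cap (Ugen_submodule _ uU) e1 memvN.
    by apply: sum_submodule vS => j; exact: Ugen_submodule.
  rewrite cap0 memv0 => /eqP u0; split=> //.
  by apply/eqP; rewrite -oppr_eq0 -e1 u0.
have uH : u \in hwspace by apply/hwspaceP => p q /uvH[].
have vH : v \in hwspace by apply/hwspaceP => p q /uvH[].
rewrite span_cons zE memv_add ?hr //; exact: hwspace_Ugen uU.
Qed.

End HighestWeight.

(** * Contractions and place permutations *)

Arguments site_val : simpl never.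
Arguments site_upd : simpl never.

Section Operators.
Variables n k : nat.
Local Notation idx := (idx n k).
Local Notation M := (M n k).
Implicit Types (m w z v : M) (ab : idx) (x y : 'M[CC]_n).
Implicit Types (c : bool) (g h : {perm 'I_k}) (T : tableau k) (s t : seq 'I_k).

Lemma contrE i j m ab : contr i j m ab =
  if ab.1 i == ab.2 j
  then \sum_l m (site_upd (inl i) l (site_upd (inr j) l ab)) else 0.
Proof. exact: ffunE. Qed.

Lemma contr_is_linear i j : linear (@contr n k i j).
Proof.
move=> a m w; apply: M_ext => ab; rewrite !ME !contrE.
case: ifP => _; last by rewrite mulr0 addr0.
by rewrite mulr_sumr -big_split; apply: eq_bigr => l _; rewrite !ME.
Qed.
HB.instance Definition _ i j :=
  GRing.isLinear.Build _ _ _ _ _ (contr_is_linear i j).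

Lemma contrB i j m w : contr i j (m - w) = contr i j m - contr i j w.
Proof. exact: (linearB (contr i j)). Qed.
Lemma contrZ i j (a : CC) m : contr i j (a *: m) = a *: contr i j m.
Proof. exact: (linearZ_LR (contr i j)). Qed.

Lemma contr_site_act i j o x m : o != inl i -> o != inr j ->
  contr i j (site_act o x m) = site_act o x (contr i j m).
Proof.
move=> oi oj; apply: M_ext => ab; rewrite contrE ffunE.
have io : inl i != o by rewrite eq_sym.
have jo : inr j != o by rewrite eq_sym.
under [RHS]eq_bigr => l _.
  have -> : contr i j m (site_upd o l ab) = if ab.1 i == ab.2 j then
      \sum_l' m (site_upd o l (site_upd (inl i) l' (site_upd (inr j) l' ab)))
      else 0.
    rewrite contrE.
    have e1 : (site_upd o l ab).1 i = ab.1 i := site_val_updN l ab io.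
    have e2 : (site_upd o l ab).2 j = ab.2 j := site_val_updN l ab jo.
    rewrite e1 e2.
    case: ifP => // _; apply: eq_bigr => l' _.
    by rewrite (site_updC l l' ab oj) (site_updC l l' _ oi).
  over.
case: ifP => _; last by rewrite big1 // => l _; rewrite mulr0.
under [RHS]eq_bigr => l _ do rewrite mulr_sumr.
rewrite exchange_big /=; apply: eq_bigr => l _; rewrite ffunE.
by apply: eq_bigr => l1 _; rewrite !site_val_updN.
Qed.

(* Both compositions vanish since sum_l v_l (x) v_l^* is invariant and the
   pairing is invariant. *)
Lemma contr_site_pair i j x m :
  contr i j (site_act (inl i) x m + site_act (inr j) x m) = 0 /\
  site_act (inl i) x (contr i j m) + site_act (inr j) x (contr i j m) = 0.
Proof.
have nij : inr j != inl i :> site k by [].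
have nji : inl i != inr j :> site k by [].
split; apply: M_ext => ab; rewrite !ME.
  rewrite contrE; case: ifP => // _.
  under eq_bigr => l _ do rewrite ME.
  rewrite big_split /= addrC; apply/eqP; rewrite addr_eq0; apply/eqP.
  rewrite -sumrN; under eq_bigr => l _ do rewrite ffunE.
  rewrite exchange_big /=; apply: eq_bigr => l _; rewrite ffunE -sumrN.
  apply: eq_bigr => l' _; rewrite !(site_val_upd, site_val_updN _ _ nij).
  rewrite !mxE mulNr; congr (- (_ * m _)).
  by rewrite /site_upd /= !updK.
rewrite !ffunE /=.
have cE l l' : contr i j m (upd ab.1 i l, upd ab.2 j l') =
    if l == l' then \sum_p m (upd ab.1 i p, upd ab.2 j p) else 0.
  rewrite contrE /site_upd /= !ffunE !eqxx; case: ifP => // _.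
  by apply: eq_bigr => p _; rewrite !updK.
rewrite (bigD1 (ab.2 j)) //= big1 ?addr0 => [|l hl]; last first.
  have := cE l (ab.2 j); rewrite upd_id => ->.
  by rewrite (negbTE hl) mulr0.
rewrite [X in _ + X](bigD1 (ab.1 i)) //= [X in _ + (_ + X)]big1 ?addr0 => [|l hl].
  have := cE (ab.2 j) (ab.2 j); rewrite upd_id => ->.
  have := cE (ab.1 i) (ab.1 i); rewrite upd_id => ->.
  by rewrite !eqxx !mxE mulNr subrr.
have := cE (ab.1 i) l; rewrite upd_id => ->.
by rewrite eq_sym (negbTE hl) mulr0.
Qed.

Lemma contr_act i j x m : contr i j (act x m) = act x (contr i j m).
Proof.
have [e1 e2] := contr_site_pair i j x m.
rewrite !actE (bigD1 (inl i)) //= [in LHS](bigD1 (inr j)) //= addrA.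
rewrite [RHS](bigD1 (inl i)) //= [in RHS](bigD1 (inr j)) //= addrA.
rewrite linearD /= e1 e2 !add0r linear_sum; apply: eq_bigr => o /andP[oi oj].
exact: contr_site_act.
Qed.

Lemma contrC i j i' j' m : i != i' -> j != j' ->
  contr i j (contr i' j' m) = contr i' j' (contr i j m).
Proof.
move=> ii jj; apply: M_ext => ab.
have cE p q p' q' : p != p' -> q != q' -> contr p q (contr p' q' m) ab =
    if (ab.1 p == ab.2 q) && (ab.1 p' == ab.2 q') then
      \sum_l \sum_l' m (upd (upd ab.1 p l) p' l', upd (upd ab.2 q l) q' l')
    else 0.
  move=> pp qq; rewrite contrE; case: ifP => //= _.
  under eq_bigr => l _.
    rewrite contrE /site_upd /= !ffunE ![_ == p]eq_sym ![_ == q]eq_sym.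
    rewrite (negbTE pp) (negbTE qq); over.
  by case: ifP => // _; rewrite big1.
rewrite !cE // 1?eq_sym // andbC; case: ifP => // _; rewrite exchange_big /=.
apply: eq_bigr => l _; apply: eq_bigr => l' _; congr (m (_, _)); exact: updC.
Qed.

(** For i = j this is the idempotency of p_i. *)
Lemma contr_contr i j m : contr i j (contr i j m) = n%:R *: contr i j m.
Proof.
apply: M_ext => ab; rewrite ME !contrE; case: ifP => _; last by rewrite mulr0.
under eq_bigr => l _.
  rewrite contrE /site_upd /= !ffunE !eqxx.
  under eq_bigr => l' _ do rewrite !updK.
  over.
by rewrite sumr_const card_ord mulr_natl.
Qed.

(** [eproj] along an arbitrary list of positions, to allow induction on the list. *)
Definition eproj_seq (l : seq 'I_k) m := foldr (fun i acc => acc - pr i acc) m l.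

Lemma eproj_seq_is_linear l : linear (eproj_seq l).
Proof.
elim: l => [|i l IH] a m w //=; rewrite IH /pr linearP.
by rewrite scalerBr scalerDr opprD addrACA !scalerA [n%:R^-1 * a]mulrC.
Qed.
HB.instance Definition _ :=
  GRing.isLinear.Build _ _ _ _ (@eproj n k) (eproj_seq_is_linear (enum 'I_k)).

Lemma eproj_act x m : eproj (act x m) = act x (eproj m).
Proof.
rewrite /eproj; elim: (enum _) => //= i l ->.
by rewrite actB /pr contr_act actZ.
Qed.

Lemma eproj_coord m ab : (forall i, ab.1 i != ab.2 i) -> eproj m ab = m ab.
Proof.
move=> h; rewrite /eproj; elim: (enum _) => //= i l IH.
by rewrite MDE MNE IH /pr MZE contrE (negbTE (h i)) mulr0 subr0.
Qed.

Lemma eproj_id m : (forall i, contr i i m = 0) -> eproj m = m.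
Proof.
move=> h; rewrite /eproj; elim: (enum _) => //= i l ->.
by rewrite /pr h scaler0 subr0.
Qed.

Lemma contr_eproj_seq i l m :
  contr i i (eproj_seq l m) = eproj_seq l (contr i i m).
Proof.
elim: l => //= j l IH; rewrite contrB IH /pr contrZ; congr (_ - _ *: _).
rewrite -IH.
by have [->//|ij] := eqVneq i j; rewrite contrC.
Qed.

(** c_{i,i} kills the factor id - p_i and commutes with the other factors. *)
Lemma contr_eproj i m : (0 < n)%N -> contr i i (eproj m) = 0.
Proof.
move=> n0; rewrite /eproj -/(eproj_seq _ _).
have : i \in enum 'I_k by rewrite mem_enum.
elim: (enum _) => //= j l IH; rewrite inE contrB /pr contrZ.
have [<- _|ij /= il] := eqVneq i j.
  by rewrite contr_contr scalerA mulVf ?scale1r ?subrr // pnatr_eq0 -lt0n.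
by rewrite contrC // IH // [contr j j 0](linear0 (contr j j)) scaler0 subr0.
Qed.

Lemma eproj_contr i m : (0 < n)%N -> eproj (contr i i m) = 0.
Proof.
by move=> n0; rewrite /eproj -/(eproj_seq _ _) -contr_eproj_seq contr_eproj.
Qed.

Lemma eproj_idem m : eproj (eproj m) = eproj m.
Proof.
apply: eproj_id => i; have [n0|] := posnP n; last exact: contr_eproj.
by apply: M_ext => ab; case: (ab.1 i) => l hl; exfalso; rewrite n0 in hl.
Qed.

Lemma contr_seq_is_linear s t : linear (@contr_seq n k s t).
Proof.
move=> a m w; rewrite /contr_seq.
by elim: (zip s t) => //= ij l ->; rewrite linearP.
Qed.
HB.instance Definition _ s t :=
  GRing.isLinear.Build _ _ _ _ _ (contr_seq_is_linear s t).

Lemma contr_seq_act s t x m : contr_seq s t (act x m) = act x (contr_seq s t m).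
Proof.
by rewrite /contr_seq; elim: (zip s t) => //= ij l ->; rewrite contr_act.
Qed.

Definition vanishes_off (S : pred idx) m := forall ab, ~~ S ab -> m ab = 0.

Lemma contr_vanishes_off (S : pred idx) i j m :
  (forall ab l, S (site_upd (inl i) l (site_upd (inr j) l ab)) -> S ab) ->
  vanishes_off S m -> vanishes_off S (contr i j m).
Proof.
move=> hS mS ab nS; rewrite contrE; case: ifP => // _; rewrite big1 // => l _.
by apply: mS; apply: contra nS; exact: hS.
Qed.

Lemma contr_seq_vanishes_off (S : pred idx) s t m :
  (forall ab i j l, i \in s -> j \in t ->
     S (site_upd (inl i) l (site_upd (inr j) l ab)) -> S ab) ->
  vanishes_off S m -> vanishes_off S (contr_seq s t m).
Proof.
rewrite /contr_seq; elim: s t => [|i s IH] [|j t] //= hS mS.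
apply: contr_vanishes_off => [ab l|]; first by apply: hS; rewrite mem_head.
apply: IH => // ab i' j' l i's j't.
by apply: hS; rewrite inE ?i's ?j't orbT.
Qed.

Lemma mem_zip s t i j : (i, j) \in zip s t -> (i \in s) && (j \in t).
Proof.
elim: s t => [|p s IH] [|q t] //=; rewrite !inE => /orP[/eqP[-> ->]|/IH].
  by rewrite !eqxx.
by case/andP=> -> ->; rewrite !orbT.
Qed.

(** The outermost contraction forces its own coincidence. The inner ones are evaluated at indices
    differing from ab only at its two positions, which they do not involve. *)
Lemma contr_seq_match s t m ab : uniq s -> uniq t ->
  contr_seq s t m ab != 0 ->
  forall i j, (i, j) \in zip s t -> ab.1 i = ab.2 j.
Proof.
rewrite /contr_seq.
elim: s t ab => [|i s IH] [|j t] //= ab /andP[si us] /andP[tj ut].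
rewrite contrE; case: ifP; last by rewrite eqxx.
move=> /eqP e h i' j'; rewrite inE => /orP[/eqP[-> ->] //|zij].
have [l hl] : exists l, contr_seq s t m
    (site_upd (inl i) l (site_upd (inr j) l ab)) != 0.
  apply: contrapT => /forallNP h0; case/eqP: h; apply: big1 => l _.
  by apply/eqP/negPn; exact/negP/h0.
have := IH _ _ us ut hl _ _ zij; have /andP[i's j't] := mem_zip zij.
have i'i : i' != i by apply: contraNneq si => <-.
have j'j : j' != j by apply: contraNneq tj => <-.
by rewrite /site_upd /= !ffunE (negbTE i'i) (negbTE j'j).
Qed.

(** The contractions at other positions preserve the support condition a_i <> b_j, while c_{i,j}
    only sums values at coincidences a_i = b_j. *)
Lemma contr_seq_kill s t m i j : uniq s -> uniq t -> (i, j) \in zip s t ->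
  (forall ab, m ab != 0 -> ab.1 i != ab.2 j) -> contr_seq s t m = 0.
Proof.
rewrite /contr_seq.
elim: s t => [|i' s IH] [|j' t] //= /andP[si us] /andP[tj ut].
rewrite inE => /orP[/eqP[ei ej]|zij] h; last first.
  by rewrite IH // (linear0 (contr _ _)).
subst i' j'; apply: M_ext => ab; rewrite contrE M0E; case: ifP => // _.
apply: big1 => l _.
have off : vanishes_off (fun ab => ab.1 i != ab.2 j) (contr_seq s t m).
  apply: contr_seq_vanishes_off => [ab' p q l' ps qt|ab'].
    have ip : i != p by apply: contraNneq si => ->.
    have jq : j != q by apply: contraNneq tj => ->.
    by rewrite /site_upd /= !ffunE (negbTE ip) (negbTE jq).
  by apply: contraNeq; exact: h.
by apply: off; rewrite /site_upd /= !ffunE !eqxx.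
Qed.

(** The support condition at i survives the inner contractions, which do not involve i, so each sum
    over l keeps only the term where l is the letter of ab at i. *)
Lemma contr_seq_diag s t m ab : uniq s -> uniq t ->
  (forall i j, (i, j) \in zip s t -> ab.1 i = ab.2 j) ->
  vanishes_off (fun ab' => all (fun i => ab'.1 i == ab.1 i) s) m ->
  contr_seq s t m ab = m ab.
Proof.
rewrite /contr_seq.
elim: s t m => [|i s IH] [|j t] //= m /andP[si us] /andP[tj ut] e off.
have eij : ab.1 i = ab.2 j by apply: e; rewrite mem_head.
rewrite contrE eij eqxx.
have off1 : vanishes_off (fun ab' => ab'.1 i == ab.1 i) (contr_seq s t m).
  apply: contr_seq_vanishes_off => [ab' p q l' ps qt|ab' h].
    have ip : i != p by apply: contraNneq si => ->.
    by rewrite /site_upd /= !ffunE (negbTE ip).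
  by apply: off; rewrite (negbTE h).
rewrite (bigD1 (ab.1 i)) //= big1 ?addr0 => [|l hl]; last first.
  by apply: off1; rewrite /site_upd /= !ffunE eqxx.
rewrite {2}eij /site_upd /= !upd_id -surjective_pairing IH //.
  by move=> p q h; apply: e; rewrite inE h orbT.
by move=> ab' h; apply: off; rewrite (negbTE h) andbF.
Qed.

(** The boolean c selects the side, true for the factors of V and false for the dual ones, so that
    both families of symmetrizers are treated at once. *)
Definition idx_perm c g ab : idx :=
  if c then ([ffun p => ab.1 (g p)], ab.2) else (ab.1, [ffun p => ab.2 (g p)]).
Definition perm_op c g m : M := if c then permV g m else permW g m.

Arguments perm_op : simpl never.

Lemma perm_opE c g m ab : perm_op c g m ab = m (idx_perm c g ab).
Proof. by case: c; rewrite ffunE. Qed.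

Lemma idx_permM c g h ab : idx_perm c g (idx_perm c h ab) = idx_perm c (g * h)%g ab.
Proof.
by case: c; congr pair; apply/ffunP=> p; rewrite !ffunE permM.
Qed.

Lemma idx_perm1 c ab : idx_perm c 1 ab = ab.
Proof.
case: ab => a b; case: c; congr pair; apply/ffunP=> p; by rewrite ffunE perm1.
Qed.

(** The product of permutations applies its left factor first, hence the order h * g. *)
Lemma perm_opM c g h m : perm_op c g (perm_op c h m) = perm_op c (h * g)%g m.
Proof. by apply: M_ext => ab; rewrite !perm_opE idx_permM. Qed.

Lemma perm_opC c g h m :
  perm_op c g (perm_op (~~ c) h m) = perm_op (~~ c) h (perm_op c g m).
Proof. by apply: M_ext => ab; rewrite !perm_opE; case: c. Qed.

Lemma perm_op_is_linear c g : linear (perm_op c g).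
Proof. by move=> a m w; apply: M_ext => ab; rewrite !(ME, perm_opE). Qed.
HB.instance Definition _ c g :=
  GRing.isLinear.Build _ _ _ _ _ (perm_op_is_linear c g).

Definition site_perm c g (o : site k) : site k :=
  match o with inl i => inl (if c then g i else i)
             | inr j => inr (if c then j else g j) end.

Lemma site_perm_inj c g : injective (site_perm c g).
Proof. by case=> i [] j //= [] e; congr (_ _); case: c e => // /perm_inj. Qed.

Lemma site_upd_perm c g o l ab :
  idx_perm c g (site_upd (site_perm c g o) l ab) = site_upd o l (idx_perm c g ab).
Proof.
by case: c o => [] [] i; rewrite /site_upd /=; congr pair; apply/ffunP=> p;
  rewrite !ffunE ?(inj_eq perm_inj).
Qed.

Lemma perm_op_act c g x m : perm_op c g (act x m) = act x (perm_op c g m).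
Proof.
apply: M_ext => ab; rewrite perm_opE !actE !MsumE.
rewrite [RHS](reindex_inj (@site_perm_inj c g)); apply: eq_bigr => o _.
rewrite !ffunE; apply: eq_bigr => l _; rewrite perm_opE site_upd_perm.
by case: c o => [] [] i; rewrite /site_val /= ?ffunE.
Qed.

Lemma perm_op_contr c g i j m : (if c then g i == i else g j == j) ->
  perm_op c g (contr i j m) = contr i j (perm_op c g m).
Proof.
move=> gf; apply: M_ext => ab; rewrite perm_opE !contrE.
have -> : ((idx_perm c g ab).1 i == (idx_perm c g ab).2 j) = (ab.1 i == ab.2 j).
  by case: c gf => /= /eqP gf; rewrite ffunE gf.
case: ifP => // _; apply: eq_bigr => l _; rewrite perm_opE -!site_upd_perm.
by case: c gf => /= /eqP gf; rewrite ?gf.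
Qed.

Lemma perm_op_contr_seq c g s t m : {in (if c then s else t), forall p, g p = p} ->
  perm_op c g (contr_seq s t m) = contr_seq s t (perm_op c g m).
Proof.
rewrite /contr_seq; case: c; elim: s t => [|i s IH] [|j t] //= gf;
  rewrite perm_op_contr ?IH ?gf ?mem_head // => p pt;
  by apply: gf; rewrite inE pt orbT.
Qed.

Lemma dot_perm_op c g m w : dot (perm_op c g m) w = dot m (perm_op c g^-1 w).
Proof.
have idxK : cancel (idx_perm c g^-1) (idx_perm c g).
  by move=> ab; rewrite idx_permM mulgV idx_perm1.
rewrite /dot (reindex_inj (can_inj idxK)); apply: eq_bigr => ab _.
by rewrite !perm_opE idxK.
Qed.

End Operators.
Arguments perm_op : simpl never.

(** * Standard tableaux and lattice words *)

Section Tableaux.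
Variable k : nat.
Implicit Types (T : tableau k) (S : {set 'I_k}) (p x : 'I_k) (i j : nat).
Local Notation ltk := (fun a b : 'I_k => (a < b)%N).

Lemma ltk_trans : transitive ltk.
Proof. by move=> b a c; exact: ltn_trans. Qed.

Lemma mem_row_size T p i : p \in nth [::] T i -> (i < size T)%N.
Proof. by rewrite ltnNge; apply: contraTN => h; rewrite nth_default. Qed.

Lemma rowidx_nth T p i : uniq (flatten T) -> p \in nth [::] T i ->
  rowidx T p = i.
Proof.
rewrite /rowidx; elim: T i => [|l T IH] i /=; first by rewrite nth_nil.
rewrite cat_uniq => /and3P[_ /hasPn nl uT]; case: i => [|i] /= pi.
  by rewrite pi.
have pT : p \in flatten T.
  apply/flattenP; exists (nth [::] T i) => //; apply: mem_nth.
  exact: mem_row_size pi.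
by have /negbTE-> := nl _ pT; rewrite (IH i).
Qed.

Lemma mem_rowidx T p : p \in flatten T -> p \in nth [::] T (rowidx T p).
Proof.
case/flattenP=> l lT pl; rewrite /rowidx.
have h : has (fun row => p \in row) T by apply/hasP; exists l.
exact: (nth_find [::] h).
Qed.

Lemma rowidx_size T p : p \in flatten T -> (rowidx T p < size T)%N.
Proof.
by case/flattenP=> l lT pl; rewrite -has_find; apply/hasP; exists l.
Qed.

Lemma nth_colidx T p d : p \in flatten T ->
  nth d (nth [::] T (rowidx T p)) (colidx T p) = p.
Proof. by move=> /mem_rowidx; exact: nth_index. Qed.

Lemma box_inj T p q : p \in flatten T -> q \in flatten T ->
  rowidx T p = rowidx T q -> colidx T p = colidx T q -> p = q.
Proof.
move=> pT qT er ec; have := nth_colidx p pT.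
by rewrite er ec nth_colidx.
Qed.

Section Standard.
Variables (r : nat) (la : seq nat) (S : {set 'I_k}) (T : tableau k).
Hypotheses (Hla : is_partition_of r la) (HT : standard_tableau la S T).

Lemma std_mem p : (p \in flatten T) = (p \in S).
Proof. by case/and5P: HT => _ _ /eqP<- _ _; rewrite inE. Qed.

Lemma std_uniq : uniq (flatten T). Proof. by case/and5P: HT. Qed.
Lemma std_shape : map size T = la. Proof. by case/and5P: HT => /eqP. Qed.

Lemma std_card : #|S| = r.
Proof.
case/and3P: Hla => _ _ /eqP<-; rewrite -std_shape -/(shape T) -size_flatten.
by rewrite -(card_uniqP std_uniq); apply: eq_card => p; rewrite std_mem.
Qed.

Lemma std_size_gt0 i : (i < size T)%N -> (0 < size (nth [::] T i))%N.
Proof.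
move=> iT; case/and3P: Hla => _ /allP h _; apply: h.
by rewrite -std_shape map_f // mem_nth.
Qed.

Lemma std_size_mono i : (size (nth [::] T i.+1) <= size (nth [::] T i))%N.
Proof.
have [iT|iT] := ltnP i.+1 (size T); last first.
  by rewrite [nth _ T i.+1]nth_default.
case/and3P: Hla => /(sortedP 0%N) /(_ i) + _ _; rewrite -std_shape size_map.
by move/(_ iT); rewrite !(nth_map [::]) // ltnW.
Qed.

Lemma std_size : (size T <= r)%N.
Proof.
case/and3P: Hla => _ pos /eqP<-; rewrite -std_shape in pos *.
rewrite -(size_map size T); elim: (map size T) pos => //= a l IH /andP[a0 /IH].
by rewrite -add1n => h; exact: leq_add.
Qed.

Lemma std_rowidx_lt p : p \in S -> (rowidx T p < r)%N.
Proof. by rewrite -std_mem => /rowidx_size/leq_trans; apply; exact: std_size. Qed.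

(** Standardness is stated for row and column numbers in ['I_k]. This covers every row, since T has
    at most r = #|S| rows. *)
Lemma std_column i (j d : 'I_k) : (j < size (nth [::] T i.+1))%N ->
  (nth d (nth [::] T i) j < nth d (nth [::] T i.+1) j)%N.
Proof.
move=> jT.
have iT : (i.+1 < size T)%N.
  by rewrite ltnNge; apply: contraTN jT => h; rewrite nth_default.
have ik : (i < k)%N.
  have := leq_trans (ltnW iT) std_size; rewrite -std_card => h.
  by apply: leq_trans h _; rewrite -[X in (_ <= X)%N]card_ord max_card.
case/and5P: HT => _ _ _ _ /forallP/(_ (Ordinal ik))/forallP/(_ j)/=.
rewrite iT jT /=.
have j2 := leq_trans jT (std_size_mono i).
by rewrite (set_nth_default d j j2) (set_nth_default d j jT).
Qed.

Lemma std_row i : sorted ltk (nth [::] T i).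
Proof.
have [iT|iT] := ltnP i (size T); last by rewrite nth_default.
by case/and5P: HT => _ _ _ /all_nthP h _; exact: h.
Qed.

Lemma std_column_lt i (d : nat) (j x : 'I_k) : (j < size (nth [::] T (i + d.+1)))%N ->
  (j < size (nth [::] T i))%N /\
  (nth x (nth [::] T i) j < nth x (nth [::] T (i + d.+1)) j)%N.
Proof.
elim: d => [|d IH] h.
  rewrite addn1 in h *; split; last exact: std_column.
  exact: leq_trans h (std_size_mono i).
rewrite addnS in h *.
have [h1 h2] := IH (leq_trans h (std_size_mono _)); split=> //.
by apply: ltn_trans h2 _; exact: std_column.
Qed.

Lemma std_above p i : p \in S -> (i < rowidx T p)%N ->
  exists x, [/\ x \in S, rowidx T x = i, colidx T x = colidx T p & (x < p)%N].
Proof.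
rewrite -std_mem => pT ip.
have cp : (colidx T p < size (nth [::] T (rowidx T p)))%N.
  by rewrite index_mem mem_rowidx.
have ck : (colidx T p < k)%N.
  apply: leq_trans cp _.
  have ur : uniq (nth [::] T (rowidx T p)).
    apply: sorted_uniq (std_row _) => [a b c|a]; [exact: ltn_trans|exact: ltnn].
  by rewrite -(card_uniqP ur) -[X in (_ <= X)%N]card_ord max_card.
have [d dE] : exists d, rowidx T p = (i + d.+1)%N.
  by exists (rowidx T p - i.+1)%N; rewrite addnS -addSn subnKC.
have [xc xp] : (colidx T p < size (nth [::] T i))%N /\
    (nth p (nth [::] T i) (colidx T p) < p)%N.
  rewrite dE in cp; have [h1 h2] := @std_column_lt i d (Ordinal ck) p cp.
  by split=> //; move: h2; rewrite /= -dE nth_colidx.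
set x := nth p (nth [::] T i) (colidx T p) in xp *.
have xi : x \in nth [::] T i by exact: mem_nth.
have iT : (i < size T)%N by apply: ltn_trans ip (rowidx_size pT).
have rx := rowidx_nth std_uniq xi; exists x; split=> //.
  by rewrite -std_mem; apply/flattenP; exists (nth [::] T i) => //; exact: mem_nth.
rewrite {1}/colidx rx index_uniq //.
apply: sorted_uniq (std_row i) => [a b c|a]; [exact: ltn_trans|exact: ltnn].
Qed.

(* At the first entry m whose row differs, the entry of T lying above m in the
   row that m occupies in T' is smaller than m, hence sits in that row of T'. *)
Lemma std_pair T' m : m \in S -> (rowidx T' m < rowidx T m)%N ->
  {in S, forall x, (x < m)%N -> rowidx T' x = rowidx T x} ->
  exists x, [/\ x \in S, x != m, rowidx T' x = rowidx T' m &
                colidx T x = colidx T m].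
Proof.
move=> mS lt_m agree; have [x [xS rx cx xm]] := std_above mS lt_m.
by exists x; split=> //; [rewrite neq_ltn xm|rewrite agree].
Qed.

(** Rows are increasing, so the row function alone recovers the tableau. *)
Lemma std_rowE i : nth [::] T i =
  [seq p <- enum 'I_k | (p \in S) && (rowidx T p == i)].
Proof.
apply: (@irr_sorted_eq _ ltk) => [a b c|a|||p]; rewrite ?ltnn //.
- exact: ltn_trans.
- exact: std_row.
- apply: sorted_filter => [a b c|]; first exact: ltn_trans.
  rewrite -(@sorted_map _ _ val ltn) val_enum_ord.
  exact: iota_ltn_sorted.
rewrite mem_filter mem_enum andbT -std_mem; apply/idP/andP=> [pi|[pT /eqP<-]].
  rewrite (rowidx_nth std_uniq pi); split=> //.
  apply/flattenP; exists (nth [::] T i) => //; apply: mem_nth.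
  exact: mem_row_size pi.
exact: mem_rowidx.
Qed.

Lemma std_size_le (T' : tableau k) :
  {in S, rowidx T =1 rowidx T'} -> {subset S <= flatten T'} ->
  (size T <= size T')%N.
Proof.
move=> e sT'; rewrite leqNgt; apply/negP => h.
have [d dl] : exists d, d \in nth [::] T (size T').
  have := std_size_gt0 h; case: (nth _ _ _) => // d l _.
  by exists d; rewrite mem_head.
have dS : d \in S.
  by rewrite -std_mem; apply/flattenP; exists (nth [::] T (size T')) => //;
     exact: mem_nth.
have := rowidx_size (sT' d dS).
by rewrite -e // (rowidx_nth std_uniq dl) ltnn.
Qed.

End Standard.

Lemma std_eq r r' la la' S T T' :
  is_partition_of r la -> standard_tableau la S T ->
  is_partition_of r' la' -> standard_tableau la' S T' ->
  {in S, rowidx T =1 rowidx T'} -> T = T'.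
Proof.
move=> Hla HT Hla' HT' e.
have e' : {in S, rowidx T' =1 rowidx T} by move=> p pS; rewrite e.
apply: (@eq_from_nth _ [::]) => [|i _].
  apply/eqP; rewrite eqn_leq; apply/andP; split.
    by apply: (std_size_le Hla HT e) => p; rewrite (std_mem HT').
  by apply: (std_size_le Hla' HT' e') => p; rewrite (std_mem HT).
rewrite (std_rowE HT) (std_rowE HT'); apply: eq_filter => p.
by case pS: (p \in S); rewrite //= e.
Qed.

(** Together with the next lemma this translates a column inequality between two rows into a
    comparison of counts. *)
Lemma sorted_nth_le (l : seq 'I_k) (x d : 'I_k) (j : nat) : sorted ltk l ->
  (j < count (fun y : 'I_k => (y <= x)%N) l)%N -> (nth d l j <= x)%N.
Proof.
elim: l j => //= y l IH j py; have sl := path_sorted py.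
have [yx|yx] := leqP y x; first by case: j => //= j; rewrite add1n ltnS; exact: IH.
suff -> : count (fun z : 'I_k => (z <= x)%N) l = 0%N by [].
apply/eqP; rewrite eqn0Ngt -has_count; apply/hasPn => z zl.
have /allP/(_ z zl) yz := order_path_min ltk_trans py.
by rewrite -ltnNge (ltn_trans yx).
Qed.

Lemma sorted_count_nth (l : seq 'I_k) (d : 'I_k) (j : nat) : sorted ltk l ->
  (j < size l)%N -> (j < count (fun y : 'I_k => (y <= nth d l j)%N) l)%N.
Proof.
elim: l j => //= y l IH [|j] py; first by rewrite /= leqnn.
rewrite /= ltnS => jl; have /allP yl := order_path_min ltk_trans py.
rewrite (ltnW (yl _ (mem_nth d jl))) add1n ltnS.
exact: IH (path_sorted py) jl.
Qed.

(** The lattice word (Yamanouchi) condition on the word f read along S. *)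
Definition lattice S (f : 'I_k -> nat) := forall (i : 'I_k) (j : nat),
  (#|[set p in S | (p <= i)%N && (f p == j.+1)]| <=
   #|[set p in S | (p <= i)%N && (f p == j)]|)%N.

Lemma lattice_tableau S f : lattice S f -> exists la T,
  [/\ is_partition_of #|S| la, standard_tableau la S T &
      {in S, forall p, rowidx T p = f p}].
Proof.
move=> Lf.
pose R j := [seq p <- enum 'I_k | (p \in S) && (f p == j)].
pose N := \max_(p in S) (f p).+1.
pose T := mkseq R N.
have RP p j : (p \in R j) = (p \in S) && (f p == j).
  by rewrite mem_filter mem_enum andbT.
have sR j : sorted ltk (R j).
  apply: sorted_filter => [a b c|]; first exact: ltn_trans.
  by rewrite -(@sorted_map _ _ val ltn) val_enum_ord; exact: iota_ltn_sorted.
have uR j : uniq (R j) by rewrite filter_uniq ?enum_uniq.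
have cR i j : count (fun y : 'I_k => (y <= i)%N) (R j) =
    #|[set p in S | (p <= i)%N && (f p == j)]|.
  rewrite -size_filter -(card_uniqP (filter_uniq _ (uR j))).
  apply: eq_card => p; rewrite mem_filter RP !inE.
  by case: (p <= i)%N => //=; rewrite andbF.
have fN p : p \in S -> (f p < N)%N.
  by move=> pS; exact: (@leq_bigmax_cond _ (mem S) (fun p => (f p).+1)).
have mono j : (size (R j.+1) <= size (R j))%N.
  case: (posnP (size (R j.+1))) => [->//|].
  case E : (R j.+1) => [//|d l] _; rewrite -E.
  have k0 : (k.-1 < k)%N by rewrite ltn_predL (leq_ltn_trans _ (ltn_ord d)).
  have cS i : count (fun y : 'I_k => (y <= Ordinal k0)%N) (R i) = size (R i).
    apply/eqP; rewrite -all_count; apply/allP => p _ /=.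
    by rewrite -ltnS prednK // (leq_ltn_trans _ k0).
  by have := Lf (Ordinal k0) j; rewrite -!cR !cS.
have mono_le i j : (i <= j)%N -> (size (R j) <= size (R i))%N.
  elim: j => [|j IH]; first by rewrite leqn0 => /eqP->.
  rewrite leq_eqVlt => /orP[/eqP->//|]; rewrite ltnS => /IH.
  exact: leq_trans (mono j).
have R_gt0 j : (j < N)%N -> (0 < size (R j))%N.
  move=> jN; have [p pS pN] : exists2 p, p \in S & (j <= f p)%N.
    apply: contrapT => h; suff : (N <= j)%N by rewrite leqNgt jN.
    apply/bigmax_leqP => p pS; rewrite ltnNge; apply/negP => jp.
    by apply: h; exists p.
  apply: leq_trans (mono_le _ _ pN).
  by rewrite -has_predT; apply/hasP; exists p; rewrite // RP pS eqxx.
have flE m p : (p \in flatten (mkseq R m)) = (p \in S) && (f p < m)%N.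
  apply/flatten_mapP/andP=> [[j]|[pS pm]].
    by rewrite mem_iota RP => jm /andP[-> /eqP->].
  by exists (f p); rewrite ?mem_iota ?RP ?pS ?eqxx.
have uT m : uniq (flatten (mkseq R m)).
  elim: m => // m IH; rewrite mkseqS flatten_rcons cat_uniq IH uR andbT /=.
  by apply/hasPn => p; rewrite RP flE => /andP[_ /eqP->]; rewrite ltnn andbF.
have nthT j : (j < N)%N -> nth [::] T j = R j by move=> jN; rewrite nth_mkseq.
exists (map size T), T; split.
- apply/and3P; split.
  + apply/(sortedP 0%N) => j; rewrite size_map size_mkseq => jN.
    have nE i : (i < N)%N -> nth 0%N (map size T) i = size (R i).
      by move=> iN; rewrite (nth_map [::]) ?size_mkseq // nthT.
    by rewrite !nE ?(ltnW jN) //; exact: mono.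
  + apply/allP => a /mapP[l lT ->]; have [j] := nthP [::] lT.
    by rewrite size_mkseq => jN <-; rewrite nthT // R_gt0.
  + rewrite -/(shape T) -size_flatten -(card_uniqP (uT N)); apply/eqP/eq_card=> p.
    by rewrite flE; case pS: (p \in S); rewrite //= fN.
- apply/and5P; split=> //.
  + exact: uT.
  + apply/eqP/setP=> p; rewrite inE flE.
    by case pS: (p \in S); rewrite //= fN.
  + apply/(all_nthP [::]) => j; rewrite size_mkseq => jN; rewrite nthT //.
  + apply/forallP=> i; apply/forallP=> j; apply/implyP; rewrite size_mkseq.
    case/andP=> iN; rewrite (nthT _ iN) (nthT _ (ltnW iN)) => jR.
    have j_lt : (j < size (R i))%N by apply: leq_trans jR (mono i).
    have h : (nth j (R i) j <= nth j (R i.+1) j)%N.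
      apply: sorted_nth_le => //.
      apply: leq_trans (sorted_count_nth j (sR _) jR) _.
      by rewrite !cR; exact: Lf.
    rewrite ltn_neqAle h andbT; apply/eqP => /val_inj e.
    have := mem_nth j jR; have := mem_nth j j_lt; rewrite e !RP.
    by case/andP=> _ /eqP-> /andP[_ /eqP/esym/eqP]; rewrite eqn_leq ltnn.
move=> p pS; apply: rowidx_nth; first exact: uT.
by rewrite nthT ?fN // RP pS eqxx.
Qed.

End Tableaux.

(** * Row and column symmetrizers *)

Section SymAlt.
Variables n k : nat.
Local Notation idx := (idx n k).
Local Notation M := (M n k).
Implicit Types (m w z v : M) (ab : idx) (x y : 'M[CC]_n).
Implicit Types (c : bool) (g h : {perm 'I_k}) (T : tableau k) (s t : seq 'I_k).
Implicit Types (G : {set {perm 'I_k}}).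

Definition psym G c m : M := \sum_(g in G) perm_op c g m.
Definition palt G c m : M := \sum_(g in G) (-1) ^+ odd_perm g *: perm_op c g m.

Lemma psym_is_linear G c : linear (psym G c).
Proof.
move=> a m w; rewrite /psym scaler_sumr -big_split; apply: eq_bigr => g _.
exact: (linearP (perm_op c g)).
Qed.
HB.instance Definition _ G c :=
  GRing.isLinear.Build _ _ _ _ _ (psym_is_linear G c).

Lemma palt_is_linear G c : linear (palt G c).
Proof.
move=> a m w; rewrite /palt scaler_sumr -big_split; apply: eq_bigr => g _ /=.
by rewrite perm_op_is_linear scalerDr !scalerA [a * _]mulrC.
Qed.
HB.instance Definition _ G c :=
  GRing.isLinear.Build _ _ _ _ _ (palt_is_linear G c).

Lemma yopE s t T Ts m : yop s t T Ts m =
  psym (row_group T) true (palt (col_group T) true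
    (psym (row_group Ts) false (palt (col_group Ts) false (contr_seq s t m)))).
Proof. by []. Qed.

Lemma linear_sumE (f : M -> M) (I : Type) (l : seq I) (P : pred I) (F : I -> M) :
  linear f -> f (\sum_(i <- l | P i) F i) = \sum_(i <- l | P i) f (F i).
Proof.
move=> lf; elim/big_rec2: _ => [|i w1 w2 _ <-].
  by have := lf (-1) 0 0; rewrite scaler0 addr0 scaleN1r addNr.
by rewrite -[F i]scale1r lf !scale1r.
Qed.

Lemma linear_scale (f : M -> M) a m : linear f -> f (a *: m) = a *: f m.
Proof.
move=> lf; rewrite -[a *: m]addr0 lf.
have -> : f 0 = 0; last by rewrite addr0.
by have := lf (-1) 0 0; rewrite scaler0 addr0 scaleN1r addNr.
Qed.

Lemma psym_comm (f : M -> M) G c m : linear f ->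
  {in G, forall g m, f (perm_op c g m) = perm_op c g (f m)} ->
  f (psym G c m) = psym G c (f m).
Proof.
by move=> lf fG; rewrite linear_sumE //; apply: eq_bigr => g /fG.
Qed.

Lemma palt_comm (f : M -> M) G c m : linear f ->
  {in G, forall g m, f (perm_op c g m) = perm_op c g (f m)} ->
  f (palt G c m) = palt G c (f m).
Proof.
move=> lf fG; rewrite linear_sumE //; apply: eq_bigr => g /fG e.
by rewrite linear_scale // e.
Qed.

Lemma perm_op_psymC c g G m :
  perm_op (~~ c) g (psym G c m) = psym G c (perm_op (~~ c) g m).
Proof.
apply: psym_comm; first exact: perm_op_is_linear.
by move=> h _ m'; rewrite perm_opC.
Qed.

Lemma perm_op_paltC c g G m :
  perm_op (~~ c) g (palt G c m) = palt G c (perm_op (~~ c) g m).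
Proof.
apply: palt_comm; first exact: perm_op_is_linear.
by move=> h _ m'; rewrite perm_opC.
Qed.

Lemma psym_psymC c G G' m :
  psym G (~~ c) (psym G' c m) = psym G' c (psym G (~~ c) m).
Proof.
apply: psym_comm; first exact: psym_is_linear.
by move=> h _ m'; have := perm_op_psymC (~~ c) h G m'; rewrite negbK => ->.
Qed.

Lemma psym_paltC c G G' m :
  psym G (~~ c) (palt G' c m) = palt G' c (psym G (~~ c) m).
Proof.
apply: palt_comm; first exact: psym_is_linear.
by move=> h _ m'; have := perm_op_psymC (~~ c) h G m'; rewrite negbK => ->.
Qed.

Lemma perm_op_psym c g G m : group_set G -> g \in G ->
  perm_op c g (psym G c m) = psym G c m /\ psym G c (perm_op c g m) = psym G c m.
Proof.
move=> gG; pose H := Group gG => gH; have {}gH : g \in H by [].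
split; rewrite /psym ?(linear_sumE _ _ _ (perm_op_is_linear c g)).
  rewrite [RHS](reindex_inj (mulIg g)); apply: eq_big => h.
    by rewrite (groupMr _ gH).
  by rewrite perm_opM.
rewrite [RHS](reindex_inj (mulgI g)); apply: eq_big => h.
  by rewrite (groupMl _ gH).
by rewrite perm_opM.
Qed.

Lemma perm_op_palt c g G m : group_set G -> g \in G ->
  perm_op c g (palt G c m) = (-1) ^+ odd_perm g *: palt G c m /\
  palt G c (perm_op c g m) = (-1) ^+ odd_perm g *: palt G c m.
Proof.
move=> gG; pose H := Group gG => gH; have {}gH : g \in H by [].
have sgnM h h' : (-1) ^+ odd_perm h * (-1) ^+ odd_perm (h' * h)%g
    = (-1) ^+ odd_perm h' :> CC.
  by rewrite odd_permM signr_addb mulrC -mulrA -signr_addb addbb mulr1.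
split; rewrite /palt ?(linear_sumE _ _ _ (perm_op_is_linear c g)) scaler_sumr.
  rewrite [RHS](reindex_inj (mulIg g)); apply: eq_big => h.
    by rewrite (groupMr _ gH).
  rewrite linear_scale ?perm_opM ?scalerA ?sgnM //; exact: perm_op_is_linear.
rewrite [RHS](reindex_inj (mulgI g)); apply: eq_big => h.
  by rewrite (groupMl _ gH).
move=> _; rewrite perm_opM scalerA; congr (_ *: _).
by rewrite odd_permM signr_addb mulrA -signr_addb addbb mul1r.
Qed.

Lemma palt_kill c g G m : group_set G -> g \in G -> odd_perm g ->
  perm_op c g m = m -> palt G c m = 0.
Proof.
move=> gG gin og e; have [_] := perm_op_palt c m gG gin.
rewrite e og expr1 scaleN1r => /eqP; rewrite -addr_eq0 -mulr2n.
by rewrite -scaler_nat scaler_eq0 pnatr_eq0 => /eqP.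
Qed.

(** Inserted between the two operators, g is absorbed by the symmetrizer with sign 1 and by the
    antisymmetrizer with sign -1. *)
Lemma psym_palt_kill c g G G' m : group_set G -> group_set G' ->
  g \in G -> g \in G' -> odd_perm g -> psym G c (palt G' c m) = 0.
Proof.
move=> gG gG' gin gin' og; have [_] := perm_op_psym c (palt G' c m) gG gin.
have [-> _] := perm_op_palt c m gG' gin'.
rewrite og expr1 linear_scale; last exact: psym_is_linear.
rewrite scaleN1r => /esym/eqP; rewrite -addr_eq0 -mulr2n.
by rewrite -scaler_nat scaler_eq0 pnatr_eq0 => /eqP.
Qed.

Lemma dot_psym c G m w : group_set G ->
  dot (psym G c m) w = dot m (psym G c w).
Proof.
move=> gG; pose H := Group gG; rewrite /psym dot_suml dot_sumr.
rewrite [RHS](reindex_inj invg_inj); apply: eq_big => g.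
  by rewrite -[G]/(H : {set _}) groupV.
by rewrite dot_perm_op.
Qed.

Lemma psym_psym c G m : group_set G ->
  psym G c (psym G c m) = #|G|%:R *: psym G c m.
Proof.
move=> gG; rewrite {1}/psym.
under eq_bigr => g gin do rewrite (perm_op_psym c m gG gin).1.
by rewrite sumr_const scaler_nat.
Qed.

Lemma psym_vanishes_off (S : pred idx) c G m :
  {in G, forall g ab, S (idx_perm c g ab) -> S ab} ->
  vanishes_off S m -> vanishes_off S (psym G c m).
Proof.
move=> GS mS ab nS; rewrite MsumE big1 // => g gin; rewrite perm_opE mS //.
by apply: contra nS; exact: GS.
Qed.

Lemma palt_vanishes_off (S : pred idx) c G m :
  {in G, forall g ab, S (idx_perm c g ab) -> S ab} ->
  vanishes_off S m -> vanishes_off S (palt G c m).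
Proof.
move=> GS mS ab nS; rewrite MsumE big1 // => g gin; rewrite MZE perm_opE mS ?mulr0 //.
by apply: contra nS; exact: GS.
Qed.

Lemma dot_disjoint (S S' : pred idx) m w :
  vanishes_off S m -> vanishes_off S' w ->
  dot m w != 0 -> exists2 ab, S ab & S' ab.
Proof.
move=> mS wS' d0; apply: contrapT => h; case/eqP: d0.
apply: big1 => ab _; case Sab: (S ab); last by rewrite mS ?Sab ?mul0r.
case Sab': (S' ab); last by rewrite wS' ?Sab' // rmorph0 mulr0.
by case: h; exists ab.
Qed.

Lemma psym_act G c x m : psym G c (act x m) = act x (psym G c m).
Proof.
symmetry; apply: psym_comm => [|g _ m']; first exact: act_is_linear.
by rewrite perm_op_act.
Qed.

Lemma palt_act G c x m : palt G c (act x m) = act x (palt G c m).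
Proof.
symmetry; apply: palt_comm => [|g _ m']; first exact: act_is_linear.
by rewrite perm_op_act.
Qed.

Lemma yop_act s t T Ts x m : yop s t T Ts (act x m) = act x (yop s t T Ts m).
Proof. by rewrite !yopE contr_seq_act palt_act psym_act palt_act psym_act. Qed.

Lemma yop_is_linear s t T Ts : linear (@yop n k s t T Ts).
Proof.
move=> a m w; rewrite !yopE contr_seq_is_linear palt_is_linear psym_is_linear.
by rewrite palt_is_linear psym_is_linear.
Qed.
HB.instance Definition _ s t T Ts :=
  GRing.isLinear.Build _ _ _ _ (@yop n k s t T Ts) (yop_is_linear s t T Ts).

(** Row and column groups are both of this form by computation, with f the row or the column
    index. *)
Definition fibre_group (F : seq 'I_k) (f : 'I_k -> nat) : {set {perm 'I_k}} :=
  [set g : {perm 'I_k} | [forall p, if p \in F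
     then (g p \in F) && (f (g p) == f p) else g p == p]].

Lemma fibre_groupP F f g : reflect
  ((forall p, p \in F -> g p \in F /\ f (g p) = f p) /\
   (forall p, p \notin F -> g p = p)) (g \in fibre_group F f).
Proof.
rewrite inE; apply: (iffP forallP) => [h|[h1 h2] p].
  split=> p pF; have := h p; first by rewrite pF => /andP[-> /eqP].
  by rewrite (negbTE pF) => /eqP.
case: ifPn => [/h1[-> ->]|/h2->]; by rewrite ?eqxx.
Qed.

Lemma fibre_group_set F f : group_set (fibre_group F f).
Proof.
apply/group_setP; split=> [|g h /fibre_groupP[g1 g2] /fibre_groupP[h1 h2]].
  by apply/fibre_groupP; split=> p; rewrite perm1.
apply/fibre_groupP; split=> p pF; rewrite permM.
  by have [gF <-] := g1 p pF; exact: h1.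
by rewrite g2 // h2.
Qed.

Lemma tperm_fibre F f p q : p \in F -> q \in F -> f p = f q ->
  tperm p q \in fibre_group F f.
Proof.
move=> pF qF e; apply/fibre_groupP; split=> x xF.
  by case: tpermP => [->|->|].
rewrite tpermD //; by apply: contraNneq xF => <-.
Qed.

Lemma row_groupE T : row_group T = fibre_group (flatten T) (rowidx T).
Proof. by []. Qed.
Lemma col_groupE T : col_group T = fibre_group (flatten T) (colidx T).
Proof. by []. Qed.

Definition dvec (ab0 : idx) : M := [ffun ab => (ab == ab0)%:R].

Lemma dvecE ab0 ab : dvec ab0 ab = (ab == ab0)%:R. Proof. exact: ffunE. Qed.

Lemma dot_dvec m ab : dot m (dvec ab) = m ab.
Proof.
rewrite /dot (bigD1 ab) //= big1 ?addr0 => [|ab' h].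
  by rewrite dvecE eqxx rmorph1 mulr1.
by rewrite dvecE (negbTE h) rmorph0 mulr0.
Qed.

Lemma perm_op_dvec c g ab : perm_op c g (dvec ab) = dvec (idx_perm c g^-1 ab).
Proof.
apply: M_ext => ab'; rewrite perm_opE !dvecE; congr (nat_of_bool _)%:R; apply/eqP/eqP=> [<-|->].
  by rewrite idx_permM mulVg idx_perm1.
by rewrite idx_permM mulgV idx_perm1.
Qed.

Lemma site_act_delta_dvec o (p q : 'I_n) ab : site_act o (delta_mx p q) (dvec ab) =
  match o with
  | inl _ => (site_val o ab == q)%:R *: dvec (site_upd o p ab)
  | inr _ => - ((site_val o ab == p)%:R *: dvec (site_upd o q ab))
  end.
Proof.
have updE o' l l' ab' : (site_val o' ab' == l) && (site_upd o' l' ab' == ab) =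
    (site_val o' ab == l') && (ab' == site_upd o' l ab).
  apply/andP/andP => [] [/eqP e /eqP e'].
    by rewrite -e' site_val_upd site_updK -e site_upd_id !eqxx.
  by rewrite e' site_val_upd site_updK -e site_upd_id !eqxx.
have tmxE (x : 'M[CC]_n) o' : site_mx o' x = match o' with inl _ => x | inr _ => - x^T end.
  by [].
apply: M_ext => ab'; rewrite ffunE; case: o => i; rewrite tmxE.
  rewrite (bigD1 q) //= big1 ?addr0 => [|l lq]; last first.
    by rewrite mxE (negbTE lq) andbF mul0r.
  by rewrite mxE eqxx andbT MZE !dvecE -!natrM !mulnb updE.
rewrite (bigD1 p) //= big1 ?addr0 => [|l lq]; last first.
  by rewrite !mxE (negbTE lq) /= oppr0 mul0r.
by rewrite !mxE eqxx /= MNE MZE mulNr !dvecE -!natrM !mulnb updE.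
Qed.

End SymAlt.

(** * The vectors y x' of the data *)

Section Datum.
Variables n k : nat.
Hypothesis hnk : (2 * k <= n)%N.
Local Notation idx := (idx n k).
Local Notation M := (M n k).
Implicit Types (m w z v : M) (ab : idx) (x y : 'M[CC]_n).

(* Admissibility without the condition s_i <> t_i; such data index the highest
   weight vectors of all of M. *)
Definition preadmissible (d : datum k) : bool :=
  let: (r, s, t, la, mu, T, Ts) := d in
  [&& (r <= k)%N, sorted (fun a b : 'I_k => (a < b)%N) s, size s == (k - r)%N,
      uniq t, size t == (k - r)%N, is_partition_of r la, is_partition_of r mu,
      standard_tableau la [set p | p \notin s] T &
      standard_tableau mu [set p | p \notin t] Ts].

Lemma upd_eq (f : {ffun 'I_k -> 'I_n}) i l : upd f i l i = l.
Proof. by rewrite ffunE eqxx. Qed.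
Lemma upd_neq (f : {ffun 'I_k -> 'I_n}) i j l : j != i -> upd f i l j = f j.
Proof. by move=> h; rewrite ffunE (negbTE h). Qed.

Lemma leq_kn : (k <= n)%N.
Proof. by apply: leq_trans hnk; rewrite mul2n -addnn leq_addr. Qed.

Definition vlabel (r : nat) (s : seq 'I_k) (T : tableau k) (p : 'I_k) : nat :=
  if p \in s then (r + index p s)%N else rowidx T p.
Definition wlabel (r : nat) (t : seq 'I_k) (Ts : tableau k) (p : 'I_k) : nat :=
  if p \in t then (r + index p t)%N else (n.-1 - rowidx Ts p)%N.

(** The basis index of x'. For preadmissible data the default of [insubd] is never reached, as
    [xidx_val1] and [xidx_val2] show. *)
Definition xidx r s t T Ts : idx :=
  ([ffun p => insubd (widen_ord leq_kn p) (vlabel r s T p)],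
   [ffun p => insubd (widen_ord leq_kn p) (wlabel r t Ts p)]).

Section OneDatum.
Variables (r : nat) (s t : seq 'I_k) (la mu : seq nat) (T Ts : tableau k).
Hypothesis Hd : preadmissible (r, s, t, la, mu, T, Ts).

Lemma pre_rk : (r <= k)%N. Proof. by case/and5P: Hd. Qed.
Lemma pre_s_sorted : sorted (fun a b : 'I_k => (a < b)%N) s.
Proof. by case/and5P: Hd. Qed.
Lemma pre_s_uniq : uniq s.
Proof.
by apply: sorted_uniq pre_s_sorted => [|a]; [exact: ltk_trans|exact: ltnn].
Qed.
Lemma pre_s_size : size s = (k - r)%N. Proof. by case/and5P: Hd => _ _ /eqP. Qed.
Lemma pre_t_uniq : uniq t. Proof. by case/and5P: Hd. Qed.
Lemma pre_t_size : size t = (k - r)%N.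
Proof. by case/and5P: Hd => _ _ _ _ /and5P[/eqP]. Qed.
Lemma pre_la : is_partition_of r la.
Proof. by case/and5P: Hd => _ _ _ _ /and5P[]. Qed.
Lemma pre_mu : is_partition_of r mu.
Proof. by case/and5P: Hd => _ _ _ _ /and5P[]. Qed.
Lemma pre_T : standard_tableau la [set p | p \notin s] T.
Proof. by case/and5P: Hd => _ _ _ _ /and5P[]. Qed.
Lemma pre_Ts : standard_tableau mu [set p | p \notin t] Ts.
Proof. by case/and5P: Hd => _ _ _ _ /and5P[]. Qed.

Lemma mem_T p : (p \in flatten T) = (p \notin s).
Proof. by rewrite (std_mem pre_T) inE. Qed.
Lemma mem_Ts p : (p \in flatten Ts) = (p \notin t).
Proof. by rewrite (std_mem pre_Ts) inE. Qed.

Lemma row_T_lt p : p \notin s -> (rowidx T p < r)%N.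
Proof. by move=> ps; apply: (std_rowidx_lt pre_la pre_T); rewrite inE. Qed.
Lemma row_Ts_lt p : p \notin t -> (rowidx Ts p < r)%N.
Proof. by move=> ps; apply: (std_rowidx_lt pre_mu pre_Ts); rewrite inE. Qed.

Lemma label_lt (u : seq 'I_k) p : size u = (k - r)%N -> p \in u ->
  (r + index p u < k)%N.
Proof. by move=> us pu; rewrite -ltn_subRL -us index_mem. Qed.

Lemma vlabel_lt p : (vlabel r s T p < k)%N.
Proof.
rewrite /vlabel; case: ifPn => [|/row_T_lt/leq_trans]; last by apply; exact: pre_rk.
exact: label_lt pre_s_size.
Qed.

Lemma xidx_val1 p : (xidx r s t T Ts).1 p = vlabel r s T p :> nat.
Proof.
rewrite ffunE /= val_insubd; case: ifP => // /negP[].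
exact: leq_trans (vlabel_lt p) leq_kn.
Qed.

Lemma n_gt0 (p : 'I_k) : (0 < n)%N.
Proof. exact: leq_trans (leq_ltn_trans (leq0n p) (ltn_ord p)) leq_kn. Qed.

Lemma xidx_val2 p : (xidx r s t T Ts).2 p = wlabel r t Ts p :> nat.
Proof.
rewrite ffunE /= val_insubd; case: ifP => // /negP[]; rewrite /wlabel.
case: ifPn => pt; first exact: leq_trans (label_lt pre_t_size pt) leq_kn.
by rewrite -[X in (_ < X)%N](prednK (n_gt0 p)) ltnS leq_subr.
Qed.

Local Notation x0 := (xidx r s t T Ts).

Lemma xprimeE : xprime n r s t T Ts = dvec x0.
Proof.
apply: M_ext => ab; rewrite dvecE ffunE; congr (nat_of_bool _)%:R.
apply/forallP/eqP => [h|-> p].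
  rewrite [ab]surjective_pairing [RHS]surjective_pairing; congr pair;
    apply/ffunP => p; apply: val_inj; have /andP[/eqP e1 /eqP e2] := h p.
    by rewrite e1; exact/esym/xidx_val1.
  by rewrite e2; exact/esym/xidx_val2.
by rewrite /= xidx_val1 xidx_val2 !eqxx.
Qed.

Lemma x0_T p : p \notin s -> x0.1 p = rowidx T p :> nat.
Proof. by move=> ps; rewrite xidx_val1 /vlabel (negbTE ps). Qed.
Lemma x0_Ts p : p \notin t -> x0.2 p = (n.-1 - rowidx Ts p)%N :> nat.
Proof. by move=> ps; rewrite xidx_val2 /wlabel (negbTE ps). Qed.

Lemma zip_index i j : (i, j) \in zip s t ->
  [/\ i \in s, j \in t & index i s = index j t].
Proof.
move=> ij; have /andP[is_ jt] := mem_zip ij; split=> //.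
have st : size s = size t by rewrite pre_s_size pre_t_size.
have := nth_index (i, j) ij; set l := index _ _.
have ll : (l < size s)%N.
  by rewrite -[size s](minnn _) {2}st -size_zip index_mem.
rewrite nth_zip // => -[<- <-]; rewrite !index_uniq -?st //.
  exact: pre_t_uniq.
exact: pre_s_uniq.
Qed.

Lemma index_zip i : i \in s -> (i, nth i t (index i s)) \in zip s t.
Proof.
move=> si; have st : size s = size t by rewrite pre_s_size pre_t_size.
have -> : (i, nth i t (index i s)) = nth (i, i) (zip s t) (index i s).
  by rewrite nth_zip // nth_index.
by apply: mem_nth; rewrite size_zip -st minnn index_mem.
Qed.

Lemma index_zip_r j : j \in t -> (nth j s (index j t), j) \in zip s t.
Proof.
move=> tj; have st : size s = size t by rewrite pre_s_size pre_t_size.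
have -> : (nth j s (index j t), j) = nth (j, j) (zip s t) (index j t).
  by rewrite nth_zip // nth_index.
by apply: mem_nth; rewrite size_zip st minnn index_mem.
Qed.

Lemma x0_zip i j : (i, j) \in zip s t -> x0.1 i = x0.2 j.
Proof.
move=> /zip_index[si tj e]; apply: val_inj => /=.
by rewrite xidx_val1 xidx_val2 /vlabel /wlabel si tj e.
Qed.

Lemma row_group_fix g : g \in row_group T ->
  {in s, forall p, g p = p} /\ forall p, p \notin s -> g p \notin s.
Proof.
rewrite row_groupE => /fibre_groupP[h1 h2]; split=> p ps.
  by apply: h2; rewrite mem_T ps.
by move: ps; rewrite -!mem_T => /h1[].
Qed.
Lemma col_group_fix g : g \in col_group T ->
  {in s, forall p, g p = p} /\ forall p, p \notin s -> g p \notin s.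
Proof.
rewrite col_groupE => /fibre_groupP[h1 h2]; split=> p ps.
  by apply: h2; rewrite mem_T ps.
by move: ps; rewrite -!mem_T => /h1[].
Qed.
Lemma row_groups_fix g : g \in row_group Ts ->
  {in t, forall p, g p = p} /\ forall p, p \notin t -> g p \notin t.
Proof.
rewrite row_groupE => /fibre_groupP[h1 h2]; split=> p ps.
  by apply: h2; rewrite mem_Ts ps.
by move: ps; rewrite -!mem_Ts => /h1[].
Qed.
Lemma col_groups_fix g : g \in col_group Ts ->
  {in t, forall p, g p = p} /\ forall p, p \notin t -> g p \notin t.
Proof.
rewrite col_groupE => /fibre_groupP[h1 h2]; split=> p ps.
  by apply: h2; rewrite mem_Ts ps.
by move: ps; rewrite -!mem_Ts => /h1[].
Qed.

Lemma yop_kill_pair i j ab : (i, j) \in zip s t -> ab.1 i != ab.2 j ->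
  yop s t T Ts (dvec ab) = 0.
Proof.
move=> ij ne; rewrite yopE.
rewrite (contr_seq_kill pre_s_uniq pre_t_uniq ij).
  by rewrite !(linear0, (linear0 (palt _ _)), (linear0 (psym _ _))).
by move=> ab'; rewrite dvecE; case: (ab' =P ab) => [->|_] //; rewrite eqxx.
Qed.

(** The transposition of p and q is an odd column permutation fixing the tensor. It passes through
    the contractions, since it fixes s, and through the operators on the dual side. *)
Lemma yop_kill_col p q ab : p \notin s -> q \notin s -> p != q ->
  colidx T p = colidx T q -> ab.1 p = ab.1 q -> yop s t T Ts (dvec ab) = 0.
Proof.
move=> ps qs pq e e'; rewrite yopE.
have tc : tperm p q \in col_group T by apply: tperm_fibre; rewrite ?mem_T.
rewrite (@palt_kill _ _ _ (tperm p q)) ?(linear0 (psym _ _)) //.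
- exact: fibre_group_set.
- by rewrite odd_tperm.
rewrite (perm_op_psymC false) (perm_op_paltC false) /=.
rewrite perm_op_contr_seq; last by case: (col_group_fix tc).
congr (psym _ _ (palt _ _ (contr_seq _ _ _))); rewrite perm_op_dvec tpermV.
congr dvec; case: ab e' => a b /= e'; congr pair; apply/ffunP => u.
by rewrite ffunE; case: tpermP => [->|->|].
Qed.

Lemma yop_kill_cols p q ab : p \notin t -> q \notin t -> p != q ->
  colidx Ts p = colidx Ts q -> ab.2 p = ab.2 q -> yop s t T Ts (dvec ab) = 0.
Proof.
move=> ps qs pq e e'; rewrite yopE.
have tc : tperm p q \in col_group Ts by apply: tperm_fibre; rewrite ?mem_Ts.
rewrite [palt _ false _](@palt_kill _ _ _ (tperm p q)) ?(linear0 (psym _ _)) //.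
- by rewrite (linear0 (palt _ _)) (linear0 (psym _ _)).
- exact: fibre_group_set.
- by rewrite odd_tperm.
rewrite perm_op_contr_seq; last by case: (col_groups_fix tc).
congr (contr_seq _ _ _); rewrite perm_op_dvec tpermV.
congr dvec; case: ab e' => a b /= e'; congr pair; apply/ffunP => u.
by rewrite ffunE; case: tpermP => [->|->|].
Qed.

(** A raising operator changes one letter of x' at a time. At a contracted position the pair then
    carries different letters, and the contraction gives 0. At an entry of a tableau the new letter
    is that of a higher row, so it repeats the letter of an entry above in the same column, and the
    column antisymmetrizer gives 0. *)
Lemma yx_hwspace : yop s t T Ts (dvec x0) \in @hwspace n k.
Proof.
apply/hwspaceP => p q pq; rewrite -yop_act actE.
rewrite (linear_sumE _ _ _ (yop_is_linear s t T Ts)) big1 // => o _.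
have yZ a m : yop s t T Ts (a *: m) = a *: yop s t T Ts m.
  exact/linear_scale/yop_is_linear.
rewrite site_act_delta_dvec; case: o => i.
  rewrite yZ /site_val; have [e|] := eqVneq; last by rewrite scale0r.
  apply/eqP; rewrite scale1r; apply/eqP; case is_ : (i \in s).
    apply: (yop_kill_pair (index_zip is_)); rewrite /site_upd /= upd_eq.
    by rewrite -(x0_zip (index_zip is_)) e neq_ltn pq.
  have iS : i \in [set p | p \notin s] by rewrite inE is_.
  have pi : (p < rowidx T i)%N by rewrite -x0_T ?is_ // e.
  have [j [jS rj cj ji]] := std_above pre_la pre_T iS pi.
  rewrite inE in jS; apply: (yop_kill_col (p := i) (q := j)) => //.
  - by rewrite is_.
  - by rewrite neq_ltn ji orbT.
  rewrite /site_upd /= upd_eq upd_neq; last by rewrite neq_ltn ji.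
  apply/val_inj/esym; exact: (etrans (x0_T jS) rj).
rewrite -scaleNr yZ /site_val; have [e|] := eqVneq; last first.
  by rewrite oppr0 scale0r.
case it : (i \in t).
  rewrite (yop_kill_pair (index_zip_r it)) ?scaler0 // /site_upd /= upd_eq.
  by rewrite (x0_zip (index_zip_r it)) e neq_ltn pq.
have iS : i \in [set p | p \notin t] by rewrite inE it.
have n0 := n_gt0 i.
have ei : (p = n.-1 - rowidx Ts i :> nat)%N by rewrite -x0_Ts ?it // e.
have qn : (q <= n.-1)%N by rewrite -ltnS prednK.
(* Dual letters count down from n - 1: the new letter q belongs to row n - 1 - q, which lies above
   the row of i. *)
have qi : (n.-1 - q < rowidx Ts i)%N.
  have ri : (rowidx Ts i <= n.-1)%N.
    rewrite -ltnS prednK // (leq_trans (row_Ts_lt (negbT it))) //.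
    exact: leq_trans pre_rk leq_kn.
  by rewrite ltn_subLR // addnC -ltn_subLR // -ei.
have [j [jS rj cj ji]] := std_above pre_mu pre_Ts iS qi.
rewrite inE in jS; rewrite (yop_kill_cols (p := i) (q := j)) ?scaler0 //.
- by rewrite it.
- by rewrite neq_ltn ji orbT.
rewrite /site_upd /= upd_eq upd_neq; last by rewrite neq_ltn ji.
apply/val_inj/esym; apply: etrans (x0_Ts jS) _.
by rewrite rj subKn.
Qed.

End OneDatum.
End Datum.

(** * Letter ranges, the weight of x', and supports *)

Section DatumPairing.
Variables n k : nat.
Hypothesis hnk : (2 * k <= n)%N.
Local Notation idx := (idx n k).
Local Notation M := (M n k).
Implicit Types (m w z v : M) (ab : idx) (x y : 'M[CC]_n).

Section OneDatum.
Variables (r : nat) (s t : seq 'I_k) (la mu : seq nat) (T Ts : tableau k).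
Hypothesis Hd : preadmissible (r, s, t, la, mu, T, Ts).
Local Notation x0 := (xidx hnk r s t T Ts).

(** Here n >= 2k enters: the labels of pairs, all below k, never reach the dual letters, which start
    at n - r. *)
Lemma leq_k_subnr : (k <= n - r)%N.
Proof.
rewrite leq_subRL; last exact: leq_trans (pre_rk Hd) (leq_kn hnk).
by apply: leq_trans hnk; rewrite mul2n -addnn leq_add2r (pre_rk Hd).
Qed.

Lemma wlabel_ge p : p \notin t -> (n - r <= x0.2 p)%N.
Proof.
move=> pt; rewrite (x0_Ts hnk Hd pt).
by rewrite -subn1 -subnDA add1n leq_sub2l // (row_Ts_lt Hd).
Qed.

Lemma sum_zip (f : 'I_n -> CC) :
  \sum_(p in s) f (x0.1 p) = \sum_(p in t) f (x0.2 p).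
Proof.
rewrite -!big_uniq ?(pre_s_uniq Hd) ?(pre_t_uniq Hd) //=.
have st : size s = size t by rewrite (pre_s_size Hd) (pre_t_size Hd).
rewrite -{1}[s](unzip1_zip (eq_leq st)) -{2}[t](unzip2_zip (eq_leq (esym st))).
rewrite !big_map; apply: eq_big_seq => -[i j] ij /=.
by rewrite (x0_zip hnk Hd ij).
Qed.

Lemma card_row (S : {set 'I_k}) r' nu T' (q : nat) :
  is_partition_of r' nu -> standard_tableau nu S T' ->
  #|[pred p | (p \in S) && (rowidx T' p == q)]| = nth 0%N nu q.
Proof.
move=> Hnu HT; have -> : nth 0%N nu q = size (nth [::] T' q).
  rewrite -(std_shape HT); have [qT|qT] := ltnP q (size T').
    by rewrite (nth_map [::]).
  by rewrite !nth_default ?size_map.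
rewrite (std_rowE HT) -(card_uniqP (filter_uniq _ (enum_uniq _))).
by apply: eq_card => p; rewrite mem_filter mem_enum andbT.
Qed.

Lemma sum_rows (u : seq 'I_k) r' nu T' (A : 'I_k -> 'I_n) (rv : nat -> nat)
    (f : 'I_n -> CC) :
  is_partition_of r' nu -> standard_tableau nu [set p | p \notin u] T' ->
  (forall p q, p \notin u -> (A p == q) = (rowidx T' p == rv q)) ->
  \sum_(p | p \notin u) f (A p) = \sum_q f q * (nth 0%N nu (rv q))%:R.
Proof.
move=> Hnu HT AE; rewrite (partition_big A predT) //; apply: eq_bigr => q _.
rewrite (eq_bigr (fun=> f q)) => [|p /andP[_ /eqP->]//].
rewrite sumr_const mulr_natr -(card_row _ Hnu HT); congr (_ *+ _).
apply: eq_card => p; rewrite !inE unfold_in /=.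
by case pu: (p \notin u) => //=; rewrite AE.
Qed.

(** The letters of a pair contribute opposite weights and cancel; the remaining ones count the row
    lengths of the two tableaux. *)
Lemma x0_weight (f : 'I_n -> CC) :
  \sum_p f (x0.1 p) - \sum_p f (x0.2 p) = \sum_q f q * (hw la mu q)%:~R.
Proof.
rewrite (bigID (mem s)) [X in _ - X](bigID (mem t)) sum_zip opprD addrACA.
rewrite subrr add0r.
rewrite (sum_rows (rv := id) f (pre_la Hd) (pre_T Hd)); last first.
  by move=> p q ps; rewrite -(x0_T hnk Hd ps).
rewrite (sum_rows (rv := fun q => n.-1 - q)%N f (pre_mu Hd) (pre_Ts Hd)); last first.
  move=> p q ps.
  have n0 := n_gt0 hnk p; have qn : (q <= n.-1)%N by rewrite -ltnS prednK.
  have ri : (rowidx Ts p <= n.-1)%N.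
    rewrite -ltnS prednK // (leq_trans (row_Ts_lt Hd ps)) //.
    exact: leq_trans (pre_rk Hd) (leq_kn hnk).
  rewrite -val_eqE -[val _]/(nat_of_ord _) (x0_Ts hnk Hd ps).
  by apply/eqP/eqP => [<-|->]; rewrite subKn.
rewrite -sumrB; apply: eq_bigr => q _; rewrite -mulrBr /hw rmorphB /=.
by rewrite -!pmulrn.
Qed.

Lemma xvec_weight (d : 'rV[CC]_n) : act (diag_mx d) (dvec x0) =
  (\sum_(q < n) d 0 q * (hw la mu q)%:~R) *: dvec x0.
Proof.
apply: M_ext => ab; rewrite act_diag MZE dvecE.
have [->|_] := eqVneq ab x0; last by rewrite !mulr0.
by rewrite -(x0_weight (fun q => d 0 q)).
Qed.

Definition pairing_vec : M :=
  palt (col_group T) true (palt (col_group Ts) false (dvec x0)).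

(** Row and column permutations of T fix s, and those of [Ts] fix t, so this invariance covers all
    four symmetrizers. *)
Definition stable_pred (S : pred idx) := forall c (g : {perm 'I_k}) ab,
  {in (if c then s else t), forall p, g p = p} -> S (idx_perm c g ab) -> S ab.

Lemma young_vanishes_off (S : pred idx) m : stable_pred S -> vanishes_off S m ->
  [/\ vanishes_off S (psym (row_group T) true m),
      vanishes_off S (palt (col_group T) true m),
      vanishes_off S (psym (row_group Ts) false m) &
      vanishes_off S (palt (col_group Ts) false m)].
Proof.
move=> stS mS; split.
- apply: psym_vanishes_off => // g /(row_group_fix Hd)[gf _] ab; exact: stS.
- apply: palt_vanishes_off => // g /(col_group_fix Hd)[gf _] ab; exact: stS.
- apply: psym_vanishes_off => // g /(row_groups_fix Hd)[gf _] ab; exact: stS.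
- apply: palt_vanishes_off => // g /(col_groups_fix Hd)[gf _] ab; exact: stS.
Qed.

(** An outer bound for the support of [pairing_vec]. *)
Definition labelled ab := [forall p, if p \in s then ab.1 p == x0.1 p
                                      else (ab.1 p < r)%N] &&
                          [forall p, if p \in t then ab.2 p == x0.2 p
                                      else (n - r <= ab.2 p)%N].

Lemma fix_inv (u : seq 'I_k) (g : {perm 'I_k}) p :
  {in u, forall p, g p = p} -> p \notin u -> (g^-1)%g p \notin u.
Proof. by move=> gu; apply: contra => pu; have := gu _ pu; rewrite permKV => ->. Qed.

Lemma labelled_stable : stable_pred labelled.
Proof.
move=> c g ab gf /andP[/forallP h1 /forallP h2].
case: c gf h1 h2 => /= gf h1 h2; apply/andP; split; apply/forallP => p //.
- have := h1 ((g^-1)%g p); rewrite ffunE permKV; case: (boolP (p \in s)) => ps.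
    have -> : (g^-1)%g p = p by rewrite -{1}(gf p ps) permK.
    by rewrite ps.
  by rewrite (negbTE (fix_inv gf ps)).
- have := h2 ((g^-1)%g p); rewrite ffunE permKV; case: (boolP (p \in t)) => ps.
    have -> : (g^-1)%g p = p by rewrite -{1}(gf p ps) permK.
    by rewrite ps.
  by rewrite (negbTE (fix_inv gf ps)).
Qed.

Lemma labelled_x0 : labelled x0.
Proof.
apply/andP; split; apply/forallP => p.
  by case: ifPn => [_|ps]; rewrite ?eqxx // (x0_T hnk Hd ps) (row_T_lt Hd).
by case: ifPn => [_|pt]; rewrite ?eqxx // wlabel_ge.
Qed.

Lemma pairing_vec_off : vanishes_off labelled pairing_vec.
Proof.
have off : vanishes_off labelled (dvec x0).
  by move=> ab; rewrite dvecE; case: eqP => // ->; rewrite labelled_x0.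
have [_ _ _ off1] := young_vanishes_off labelled_stable off.
have [_ off2 _ _] := young_vanishes_off labelled_stable off1.
exact: off2.
Qed.

(** An outer bound for the support of y x': contraction forgets the labels of the pairs but keeps
    the coincidences. *)
Definition matched ab := [&& all (fun ij => ab.1 ij.1 == ab.2 ij.2) (zip s t),
  [forall p, (p \notin s) ==> (ab.1 p < r)%N] &
  [forall p, (p \notin t) ==> (n - r <= ab.2 p)%N]].

Lemma matched_stable : stable_pred matched.
Proof.
move=> c g ab gf /and3P[/allP h1 /forallP h2 /forallP h3].
case: c gf h1 h2 h3 => /= gf h1 h2 h3; apply/and3P; split; rewrite //.
- apply/allP => -[i j] ij; have := h1 _ ij.
  by have /andP[si _] := mem_zip ij; rewrite /= ffunE gf.
- apply/forallP=> p; apply/implyP => ps.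
  have := h2 ((g^-1)%g p); rewrite (fix_inv gf ps) /=.
  by rewrite ffunE permKV.
- exact/forallP.
- apply/allP => -[i j] ij; have := h1 _ ij.
  by have /andP[_ si] := mem_zip ij; rewrite /= ffunE gf.
- exact/forallP.
- apply/forallP=> p; apply/implyP => ps.
  have := h3 ((g^-1)%g p); rewrite (fix_inv gf ps) /=.
  by rewrite ffunE permKV.
Qed.

Lemma contr_x_off : vanishes_off matched (contr_seq s t (dvec x0)).
Proof.
pose S := [pred ab : idx | [forall p, (p \notin s) ==> (ab.1 p < r)%N] &&
  [forall p, (p \notin t) ==> (n - r <= ab.2 p)%N]].
have off : vanishes_off S (contr_seq s t (dvec x0)).
  apply: contr_seq_vanishes_off => [ab i j l si tj|ab].
    move=> /andP[/forallP h1 /forallP h2]; apply/andP.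
    split; apply/forallP => p; apply/implyP => ps.
      have := h1 p; rewrite ps /site_upd /= ffunE.
      by case: (p =P i) => // pi; rewrite pi si in ps.
    have := h2 p; rewrite ps /site_upd /= ffunE.
    by case: (p =P j) => // pj; rewrite pj tj in ps.
  rewrite dvecE; case: (ab =P x0) => // -> /negP[]; have /andP[] := labelled_x0.
  move=> /forallP h1 /forallP h2; apply/andP.
  split; apply/forallP => p; apply/implyP => ps.
    by have := h1 p; rewrite (negbTE ps).
  by have := h2 p; rewrite (negbTE ps).
move=> ab; apply: contraNeq => nz.
have Sab : S ab by apply: contraNT nz => /off->.
rewrite /matched -/(S ab); apply/andP; split; last exact: Sab.
apply/allP => -[i j] ij; apply/eqP.
exact: (contr_seq_match (pre_s_uniq Hd) (pre_t_uniq Hd) nz ij).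
Qed.

Lemma yx_off : vanishes_off matched (yop s t T Ts (dvec x0)).
Proof.
have [_ _ _ o1] := young_vanishes_off matched_stable contr_x_off.
have [_ _ o2 _] := young_vanishes_off matched_stable o1.
have [_ o3 _ _] := young_vanishes_off matched_stable o2.
have [o4 _ _ _] := young_vanishes_off matched_stable o3.
exact: o4.
Qed.

End OneDatum.
End DatumPairing.

Arguments idx_perm : simpl never.

(** * Effect of e on a datum, and the row and column groups at x' *)

Section Triangular.
Variables n k : nat.
Hypothesis hnk : (2 * k <= n)%N.
Local Notation idx := (idx n k).
Local Notation M := (M n k).
Implicit Types (m w z v : M) (ab : idx) (x y : 'M[CC]_n).

Section OneDatum.
Variables (r : nat) (s t : seq 'I_k) (la mu : seq nat) (T Ts : tableau k).
Hypothesis Hd : preadmissible (r, s, t, la, mu, T, Ts).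
Local Notation x0 := (xidx hnk r s t T Ts).
Local Notation u := (pairing_vec hnk r s t T Ts).

(** Letters from different ranges differ, so equality at p needs p in both s and t with the same
    label; then (p, p) would be a pair. *)
Lemma labelled_distinct ab p : all2 (fun a b : 'I_k => a != b) s t ->
  labelled hnk r s t T Ts ab -> ab.1 p != ab.2 p.
Proof.
move=> st /andP[/forallP/(_ p) h1 /forallP/(_ p) h2].
have kr := leq_k_subnr hnk Hd.
have rn : (r <= n - r)%N := leq_trans (pre_rk Hd) kr.
have lt_neq (i j : 'I_n) : (i < j)%N -> i != j by move=> h; rewrite neq_ltn h.
case: ifPn h1 => ps h1; case: ifPn h2 => pt h2.
- rewrite (eqP h1) (eqP h2) -val_eqE -[val _]/(nat_of_ord _).
  rewrite -[val (x0.2 p)]/(nat_of_ord _) (xidx_val1 hnk Hd) (xidx_val2 hnk Hd).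
  rewrite /vlabel /wlabel ps pt eqn_add2l; apply/eqP => e.
  have := index_zip Hd ps; rewrite e nth_index // => ppz.
  have : all (fun ij : 'I_k * 'I_k => ij.1 != ij.2) (zip s t).
    move: st; clear; elim: s t => [|a s' IH] [|b t'] //= /andP[-> /IH]; exact.
  by move/allP/(_ _ ppz); rewrite eqxx.
- apply: lt_neq; rewrite (eqP h1) (xidx_val1 hnk Hd).
  by rewrite (leq_trans (vlabel_lt Hd p) (leq_trans kr h2)).
- apply: lt_neq; rewrite (eqP h2) (xidx_val2 hnk Hd) /wlabel pt.
  by rewrite (leq_trans h1) // leq_addr.
by apply: lt_neq; rewrite (leq_trans h1 (leq_trans rn h2)).
Qed.

Lemma dot_eproj_pairing m : all2 (fun a b : 'I_k => a != b) s t ->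
  dot (eproj m) u = dot m u.
Proof.
move=> st; apply: eq_bigr => ab _.
case L : (labelled hnk r s t T Ts ab).
  by rewrite eproj_coord // => p; exact: labelled_distinct.
by rewrite (pairing_vec_off Hd) ?L // rmorph0 !mulr0.
Qed.

(** No c_{i,i} sees x', whose two letters at a position always differ. This absorbs the right-hand e
    of eyeU(g)x'. *)
Lemma eproj_x : all2 (fun a b : 'I_k => a != b) s t ->
  eproj (dvec x0) = dvec x0.
Proof.
move=> st; apply: eproj_id => i; apply: M_ext => ab; rewrite contrE M0E.
case: ifP => // _; apply: big1 => l _; rewrite dvecE; case: eqP => // e.
have := labelled_distinct i st (labelled_x0 hnk Hd).
by rewrite -e /site_upd /= !ffunE !eqxx.
Qed.

(** Some pair is (p, p). The symmetrizers fix p and commute with c_{p,p}, so c_{p,p} multiplies y x'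
    by n; thus y x' lies in the image of c_{p,p}, which e kills. *)
Lemma eproj_yx_bad : ~~ all2 (fun a b : 'I_k => a != b) s t ->
  eproj (yop s t T Ts (dvec x0)) = 0.
Proof.
move=> st.
have [p ppz] : exists p, (p, p) \in zip s t.
  have sz : size s = size t by rewrite (pre_s_size Hd) (pre_t_size Hd).
  move: st sz; clear; elim: s t => [|a s' IH] [|b t'] //=.
  rewrite negb_and negbK => /orP[/eqP<- _|h [e]].
    by exists a; rewrite mem_head.
  by have [p pz] := IH _ h e; exists p; rewrite inE pz orbT.
have /andP[ps pt] := mem_zip ppz.
have n0 := n_gt0 hnk p.
have cc m : contr p p (contr_seq s t m) = n%:R *: contr_seq s t m.
  have := ppz; have := pre_s_uniq Hd; have := pre_t_uniq Hd; rewrite /contr_seq.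
  clear; elim: s t => [|a s' IH] [|b t'] //= /andP[bt ut] /andP[as_ us].
  rewrite inE => /orP[/eqP[<- <-]|pz]; first exact: contr_contr.
  have /andP[ps pt] := mem_zip pz.
  rewrite contrC; first by rewrite IH // contrZ.
    by apply: contraNneq as_ => <-.
  by apply: contraNneq bt => <-.
have cy m : contr p p (yop s t T Ts m) = n%:R *: yop s t T Ts m.
  have cl : linear (contr p p : M -> M) by exact: contr_is_linear.
  rewrite !yopE (psym_comm _ cl) => [|g gR m']; last first.
    by rewrite perm_op_contr //= (row_group_fix Hd gR).1.
  rewrite (palt_comm _ cl) => [|g gR m']; last first.
    by rewrite perm_op_contr //= (col_group_fix Hd gR).1.
  rewrite (psym_comm _ cl) => [|g gR m']; last first.
    by rewrite perm_op_contr //= (row_groups_fix Hd gR).1.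
  rewrite (palt_comm _ cl) => [|g gR m']; last first.
    by rewrite perm_op_contr //= (col_groups_fix Hd gR).1.
  rewrite cc linear_scale; last exact: palt_is_linear.
  rewrite linear_scale; last exact: psym_is_linear.
  rewrite linear_scale; last exact: palt_is_linear.
  rewrite linear_scale //; exact: psym_is_linear.
have nz : n%:R != 0 :> CC by rewrite pnatr_eq0 -lt0n.
rewrite -[yop _ _ _ _ _](scalerK nz) -cy linear_scale; last exact: eproj_seq_is_linear.
by rewrite eproj_contr // scaler0.
Qed.

Lemma paltE (G : {set {perm 'I_k}}) c m ab : palt G c m ab =
  \sum_(g in G) (-1) ^+ odd_perm g * m (idx_perm c g ab).
Proof. by rewrite MsumE; apply: eq_bigr => g _; rewrite MZE perm_opE. Qed.

(** A column permutation fixing x' preserves rows too, and a box is determined by its row and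
    column, so only the identity contributes. *)
Lemma pairing_vec_x0 : u x0 = 1.
Proof.
have e1 : dvec x0 x0 = 1 by rewrite dvecE eqxx.
rewrite /pairing_vec paltE (bigD1 1%g) /=; last first.
  by case/group_setP: (fibre_group_set (flatten T) (colidx T)).
rewrite [X in _ + X]big1 ?addr0 => [|g /andP[gC g1]].
  rewrite odd_perm1 expr0 mul1r idx_perm1 paltE (bigD1 1%g) /=; last first.
    by case/group_setP: (fibre_group_set (flatten Ts) (colidx Ts)).
  rewrite odd_perm1 expr0 mul1r idx_perm1 e1.
  rewrite big1 ?addr0 // => g /andP[gC g1].
  rewrite dvecE; case: eqP => [e|]; last by rewrite mulr0.
  case/negP: g1; apply/eqP/permP => p; rewrite perm1.
  have [gt gnt] := col_groups_fix Hd gC.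
  case: (boolP (p \in t)) => pt; first exact: gt.
  move: gC; rewrite col_groupE => /fibre_groupP[/(_ p) + _].
  rewrite !(mem_Ts Hd) => /(_ pt)[gp cp].
  apply: (@box_inj _ Ts); rewrite ?(mem_Ts Hd) //.
  have : x0.2 (g p) = x0.2 p.
    by have /(congr1 snd)/ffunP/(_ p) := e; rewrite /idx_perm /= ffunE.
  move/(congr1 (fun i : 'I_n => nat_of_ord i)).
  rewrite (x0_Ts hnk Hd gp) (x0_Ts hnk Hd pt).
  have le q : q \notin t -> (rowidx Ts q <= n.-1)%N.
    move=> qt; rewrite -ltnS prednK ?(n_gt0 hnk q) // (leq_trans (row_Ts_lt Hd qt)) //.
    exact: leq_trans (pre_rk Hd) (leq_kn hnk).
  by move=> e'; rewrite -(subKn (le _ gp)) e' subKn // le.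
rewrite paltE big1 ?mulr0 // => h hC.
rewrite dvecE; case: eqP => [e|]; last by rewrite mulr0.
case/negP: g1; apply/eqP/permP => p; rewrite perm1.
have [gt gnt] := col_group_fix Hd gC.
case: (boolP (p \in s)) => ps; first exact: gt.
move: gC; rewrite col_groupE => /fibre_groupP[/(_ p) + _].
rewrite !(mem_T Hd) => /(_ ps)[gp cp].
apply: (@box_inj _ T); rewrite ?(mem_T Hd) //.
have : x0.1 (g p) = x0.1 p.
  by have /(congr1 fst)/ffunP/(_ p) := e; rewrite /idx_perm /= ffunE.
move/(congr1 (fun i : 'I_n => nat_of_ord i)).
by rewrite (x0_T hnk Hd gp) (x0_T hnk Hd ps).
Qed.

Lemma psym_x0 : psym (row_group T) true (dvec x0) = #|row_group T|%:R *: dvec x0 /\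
  psym (row_group Ts) false (dvec x0) = #|row_group Ts|%:R *: dvec x0.
Proof.
have rT g : g \in row_group T -> idx_perm true g x0 = x0.
  move=> gR; rewrite [RHS]surjective_pairing; congr pair.
  apply/ffunP=> p; apply: val_inj.
  have [gs gns] := row_group_fix Hd gR; rewrite ffunE.
  case: (boolP (p \in s)) => ps; first by rewrite gs.
  rewrite -![val _]/(nat_of_ord _) (x0_T hnk Hd ps) (x0_T hnk Hd (gns _ ps)).
  move: gR; rewrite row_groupE => /fibre_groupP[/(_ p) + _].
  by rewrite (mem_T Hd) => /(_ ps)[].
have rTs g : g \in row_group Ts -> idx_perm false g x0 = x0.
  move=> gR; rewrite [RHS]surjective_pairing; congr pair.
  apply/ffunP=> p; apply: val_inj.
  have [gs gns] := row_groups_fix Hd gR; rewrite ffunE.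
  case: (boolP (p \in t)) => ps; first by rewrite gs.
  rewrite -![val _]/(nat_of_ord _) (x0_Ts hnk Hd ps) (x0_Ts hnk Hd (gns _ ps)).
  move: gR; rewrite row_groupE => /fibre_groupP[/(_ p) + _].
  by rewrite (mem_Ts Hd) => /(_ ps)[_ ->].
split; rewrite scaler_nat -sumr_const /psym.
  apply: eq_bigr => g gR; rewrite perm_op_dvec; congr dvec.
  by rewrite -{1}(rT g gR) idx_permM mulVg idx_perm1.
apply: eq_bigr => g gR; rewrite perm_op_dvec; congr dvec.
by rewrite -{1}(rTs g gR) idx_permM mulVg idx_perm1.
Qed.
End OneDatum.
End Triangular.

Arguments xidx : simpl never.

(** * Triangularity of the pairing *)

Section Independence.
Variables n k : nat.
Hypothesis hnk : (2 * k <= n)%N.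
Local Notation idx := (idx n k).
Local Notation M := (M n k).
Implicit Types (m w z v : M) (ab : idx) (x y : 'M[CC]_n).

(** Once outermost, the two row symmetrizers can be moved across the form. *)
Lemma yop_psym_first (s t : seq 'I_k) (T Ts : tableau k) m : yop s t T Ts m =
  psym (row_group T) true (psym (row_group Ts) false (palt (col_group T) true
    (palt (col_group Ts) false (contr_seq s t m)))).
Proof. by rewrite yopE -(psym_paltC true). Qed.

Section OneDatum.
Variables (r : nat) (s t : seq 'I_k) (la mu : seq nat) (T Ts : tableau k).
Hypothesis Hd : preadmissible (r, s, t, la, mu, T, Ts).
Local Notation x0 := (xidx hnk r s t T Ts).
Local Notation u := (pairing_vec hnk r s t T Ts).

(* Only the term of c_{s,t} x' with the labels of x' pairs with u, so
   c_{s,t} x' may be replaced by x'; then <P u, u> = |P u|^2 up to a positive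
   factor, where P is the product of the two row symmetrizers. *)
Lemma dot_yx_pairing : dot (yop s t T Ts (dvec x0)) u != 0.
Proof.
pose Y m := psym (row_group T) true (psym (row_group Ts) false
  (palt (col_group T) true (palt (col_group Ts) false m))).
have YD m w : Y (m + w) = Y m + Y w.
  by rewrite /Y !(linearD (palt _ _)) !(linearD (psym _ _)).
rewrite yop_psym_first -[contr_seq _ _ _](subrK (dvec x0)).
move: (erefl (contr_seq s t (dvec x0) - dvec x0)).
move: {1 3}(contr_seq s t (dvec x0) - dvec x0) => z zE.
rewrite -/(Y _) YD dotDl /Y {Y YD}.
pose S := [pred ab : idx | ~~ ([forall p, (p \in s) ==> (ab.1 p == x0.1 p)] &&
    [forall p, (p \in t) ==> (ab.2 p == x0.2 p)])].
have Sst : stable_pred s t S.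
  move=> c g ab gf; apply: contra => /andP[/forallP h1 /forallP h2].
  case: c gf => gf; apply/andP; split; apply/forallP => p; apply/implyP => ps.
  - by rewrite /idx_perm /= ffunE gf //; have := h1 p; rewrite ps.
  - by have := h2 p; rewrite ps.
  - by have := h1 p; rewrite ps.
  - by rewrite /idx_perm /= ffunE gf //; have := h2 p; rewrite ps.
have off : vanishes_off S z.
  rewrite zE => ab; rewrite negbK => /andP[/forallP h1 /forallP h2].
  have e1 i : i \in s -> ab.1 i = x0.1 i.
    by move=> si; apply/eqP; have := h1 i; rewrite si.
  have e2 i : i \in t -> ab.2 i = x0.2 i.
    by move=> ti; apply/eqP; have := h2 i; rewrite ti.
  rewrite MDE MNE contr_seq_diag ?subrr ?(pre_s_uniq Hd) ?(pre_t_uniq Hd) //.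
    move=> i j ij; have /andP[si tj] := mem_zip ij.
    by rewrite e1 // e2 //; exact: (x0_zip hnk Hd ij).
  move=> ab' /negP h; rewrite dvecE; case: eqP => // e; case: h.
  by apply/allP => i si; rewrite e1 // e.
have [_ _ _ o1] := young_vanishes_off Hd Sst off.
have [_ o2 _ _] := young_vanishes_off Hd Sst o1.
have [_ _ o3 _] := young_vanishes_off Hd Sst o2.
have [o4 _ _ _] := young_vanishes_off Hd Sst o3.
rewrite [X in X + _](_ : _ = 0); last first.
  apply/eqP/negPn/negP => nz.
  have [ab /negP Sab /andP[/forallP h1 /forallP h2]] :=
    dot_disjoint o4 (pairing_vec_off Hd) nz.
  case: Sab; apply/andP; split; apply/forallP=> p; apply/implyP => ps.
    by have := h1 p; rewrite ps.
  by have := h2 p; rewrite ps.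
rewrite add0r -/u; clear o1 o2 o3 o4 off Sst S.
have gT : group_set (row_group T) by exact: fibre_group_set.
have gTs : group_set (row_group Ts) by exact: fibre_group_set.
have card0 (G : {set {perm 'I_k}}) : group_set G -> #|G|%:R != 0 :> CC.
  by case/group_setP=> G1 _; rewrite pnatr_eq0 -lt0n; apply/card_gt0P; exists 1%g.
pose P m := psym (row_group T) true (psym (row_group Ts) false m).
have Padj m w : dot (P m) w = dot m (P w).
  rewrite /P dot_psym // dot_psym //; congr (dot _ _).
  exact: (psym_psymC true).
have PP m : P (P m) = (#|row_group T|%:R * #|row_group Ts|%:R) *: P m.
  rewrite /P (psym_psymC true) psym_psym // psym_psym //.
  by rewrite linear_scale ?scalerA //; exact: psym_is_linear.
apply/eqP => h; have /dot_eq0 Pu0 : dot (P u) (P u) = 0.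
  by rewrite -Padj PP dotZl h mulr0.
(* This is absurd: the pairing equals <u, P x'>, where P x' is a positive multiple of x' and u has
   coordinate 1 at x'. *)
have : dot (P u) (dvec x0) = 0 by rewrite Pu0 dot0l.
rewrite Padj /P; have [e1 e2] := psym_x0 hnk Hd.
rewrite e2 linear_scale ?e1; last exact: psym_is_linear.
rewrite !dotZr dot_dvec (pairing_vec_x0 hnk Hd) mulr1 -rmorphM /= => /eqP.
by rewrite conjC_eq0 mulf_eq0 (negbTE (card0 _ gT)) (negbTE (card0 _ gTs)).
Qed.

End OneDatum.

(** The row word of T, extended by 0 to all positions. A nonzero pairing forces s = s', so the
    filler then affects both words alike. *)
Definition rowfun (s : seq 'I_k) (T : tableau k) (p : 'I_k) : nat :=
  if p \in s then 0%N else rowidx T p.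

Definition lex_lt (f g : 'I_k -> nat) := exists m : 'I_k,
  (forall p : 'I_k, (p < m)%N -> f p = g p) /\ (f m < g m)%N.

Lemma lex_total f g : [\/ f =1 g, lex_lt f g | lex_lt g f].
Proof.
have [/forallP h|] := boolP [forall p, f p == g p].
  by apply: Or31 => p; exact/eqP.
rewrite negb_forall => /existsP[p0 np0].
case: (@arg_minnP _ p0 (fun p => f p != g p) (fun p : 'I_k => p : nat) np0).
move=> m nm minm.
have agree (p : 'I_k) : (p < m)%N -> f p = g p.
  by move=> pm; apply/eqP; apply: contraLR pm => /minm; rewrite -leqNgt.
have [h|h|h] := ltngtP (f m) (g m); last by rewrite h eqxx in nm.
  by apply: Or32; exists m.
by apply: Or33; exists m; split=> // p /agree.
Qed.

Lemma lex_irr f : ~ lex_lt f f.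
Proof. by case=> m [_]; rewrite ltnn. Qed.

Lemma lex_trans f g h : lex_lt f g -> lex_lt g h -> lex_lt f h.
Proof.
move=> [m [a1 l1]] [m' [a2 l2]]; have [mm|mm|/val_inj mm] := ltngtP m m'.
- exists m; split=> [p pm|]; last by rewrite -a2.
  by rewrite a1 // a2 // (ltn_trans pm).
- exists m'; split=> [p pm|]; last by rewrite a1.
  by rewrite a1 ?a2 // (ltn_trans pm).
- subst m'; exists m; split=> [p pm|]; last exact: ltn_trans l1 l2.
  by rewrite a1 // a2.
Qed.

Lemma lex_eqr f g h : lex_lt f g -> g =1 h -> lex_lt f h.
Proof. by move=> [m [a l]] e; exists m; split=> [p /a->|]; rewrite -e. Qed.
Lemma lex_eql f g h : f =1 g -> lex_lt g h -> lex_lt f h.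
Proof. by move=> e [m [a l]]; exists m; split=> [p /a<-|]; rewrite e. Qed.

Section TwoData.
Variables (r : nat) (s t : seq 'I_k) (la mu : seq nat) (T Ts : tableau k).
Hypothesis Hd : preadmissible (r, s, t, la, mu, T, Ts).
Variables (r' : nat) (s' t' : seq 'I_k) (la' mu' : seq nat) (T' Ts' : tableau k).
Hypothesis Hd' : preadmissible (r', s', t', la', mu', T', Ts').
Hypothesis nz : dot (yop s' t' T' Ts' (dvec (xidx hnk r' s' t' T' Ts')))
  (pairing_vec hnk r s t T Ts) != 0.

(** Take (a, b) in both supports. Its letters coincide along the pairs of d', and by the letter
    ranges of [labelled] only pairs of d can coincide. Conversely, j in t has b_j < k <= n - r',
    which places j in t'. Equality of the lists follows as s and s' are increasing. *)
Lemma pairing_same_pairs : [/\ r' = r, s' = s & t' = t].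
Proof.
have [ab /and3P[/allP m1 /forallP m2 /forallP m3]] :=
  dot_disjoint (yx_off hnk Hd') (pairing_vec_off Hd) nz.
case/andP=> /forallP l1 /forallP l2.
have kr := leq_k_subnr hnk Hd; have kr' := leq_k_subnr hnk Hd'.
have rk := pre_rk Hd.
have a1 i : i \in s -> ab.1 i = (r + index i s)%N :> nat.
  move=> si; have := l1 i; rewrite si => /eqP->.
  by rewrite (xidx_val1 hnk Hd) /vlabel si.
have a2 j : j \in t -> ab.2 j = (r + index j t)%N :> nat.
  move=> tj; have := l2 j; rewrite tj => /eqP->.
  by rewrite (xidx_val2 hnk Hd) /wlabel tj.
have b1 i : i \notin s -> (ab.1 i < r)%N.
  by move=> si; have := l1 i; rewrite (negbTE si).
have b2 j : j \notin t -> (n - r <= ab.2 j)%N.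
  by move=> tj; have := l2 j; rewrite (negbTE tj).
have sub1 i j : (i, j) \in zip s' t' -> (i, j) \in zip s t.
  move=> /m1 /= /eqP e.
  have si : i \in s.
    apply: contraT => /b1; rewrite e ltnNge => /negP[].
    case: (boolP (j \in t)) => [/a2->|/b2]; first exact: leq_addr.
    exact/leq_trans/(leq_trans rk).
  have tj : j \in t.
    apply: contraT => /b2; rewrite -e a1 // leqNgt => /negP[].
    apply: leq_trans kr; exact: (label_lt (pre_s_size Hd)).
  have ei : index i s = index j t.
    by apply/eqP; rewrite -(eqn_add2l r) -a1 // -a2 // e.
  by have := index_zip Hd si; rewrite ei nth_index.
have sub2 i j : (i, j) \in zip s t -> (i, j) \in zip s' t'.
  move=> ij; have [si tj e] := zip_index Hd ij.
  have tj' : j \in t'.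
    apply: contraT => ntj; have := m3 j; rewrite ntj /= a2 // leqNgt => /negP[].
    apply: leq_trans kr'; exact: (label_lt (pre_t_size Hd)).
  have ij' := index_zip_r Hd' tj'.
  have [si' _ e'] := zip_index Hd (sub1 _ _ ij').
  suff -> : i = nth j s' (index j t') by [].
  by rewrite -(nth_index j si) e -e' nth_index.
have ss : s' = s.
  apply: (@irr_sorted_eq _ (fun a b : 'I_k => (a < b)%N)).
  - exact: ltk_trans.
  - by move=> a; exact: ltnn.
  - exact: pre_s_sorted Hd'.
  - exact: pre_s_sorted Hd.
  move=> i; apply/idP/idP => si.
    by have /andP[] := mem_zip (sub1 _ _ (index_zip Hd' si)).
  by have /andP[] := mem_zip (sub2 _ _ (index_zip Hd si)).
have rr : r' = r.
  have := pre_s_size Hd'; rewrite ss (pre_s_size Hd) => e.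
  by rewrite -(subKn (pre_rk Hd')) -e subKn.
split=> //; have st : size t' = size t.
  by rewrite (pre_t_size Hd) (pre_t_size Hd') rr.
case E : t' => [|d l].
  by apply/esym/nilP; rewrite /nilp -st E.
rewrite -E; apply: (@eq_from_nth _ d) => // x xt.
have tx : nth d t' x \in t' by exact: mem_nth.
have [_ tj e] := zip_index Hd (sub1 _ _ (index_zip_r Hd' tx)).
have us' := pre_s_uniq Hd'; have ut' := pre_t_uniq Hd'.
rewrite index_uniq // in e.
have xs : (x < size s')%N by rewrite (pre_s_size Hd') -(pre_t_size Hd').
rewrite ss index_uniq // -?ss // in e.
by rewrite -[LHS](nth_index d tj) -e.
Qed.

(** Otherwise [std_pair] yields two entries in one column of T and one row of T', and their
    transposition makes the row symmetrizer of T' annihilate the column antisymmetrizer of T. *)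
Lemma pairing_rows : rowfun s T =1 rowfun s' T' \/ lex_lt (rowfun s T) (rowfun s' T').
Proof.
have [_ ss _] := pairing_same_pairs.
case: (lex_total (rowfun s T) (rowfun s' T')) => [||[m [agree lt_m]]];
  [by left|by right|case/negP: nz].
rewrite ss in agree lt_m; have ms : m \notin s.
  by apply: contraL lt_m => ms; rewrite /rowfun ms.
have mS : m \in [set p | p \notin s] by rewrite inE.
have [||x [xS xm rx cx]] := std_pair (pre_la Hd) (pre_T Hd) (T' := T') mS.
- by move: lt_m; rewrite /rowfun (negbTE ms).
- by move=> p; rewrite inE => ps /agree; rewrite /rowfun (negbTE ps).
rewrite inE in xS.
have kill w : psym (row_group T') true (palt (col_group T) true w) = 0.
  apply: (@psym_palt_kill _ _ _ (tperm x m)); rewrite ?odd_tperm //;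
    try exact: fibre_group_set.
    by apply: tperm_fibre => //; rewrite (mem_T Hd') ss.
  by apply: tperm_fibre; rewrite ?(mem_T Hd).
apply/eqP; rewrite yopE dot_psym; last exact: fibre_group_set.
by rewrite /pairing_vec kill dot0r.
Qed.

Lemma pairing_rows_dual :
  rowfun t Ts =1 rowfun t' Ts' \/ lex_lt (rowfun t Ts) (rowfun t' Ts').
Proof.
have [_ _ ss] := pairing_same_pairs.
case: (lex_total (rowfun t Ts) (rowfun t' Ts')) => [||[m [agree lt_m]]];
  [by left|by right|case/negP: nz].
rewrite ss in agree lt_m; have ms : m \notin t.
  by apply: contraL lt_m => ms; rewrite /rowfun ms.
have mS : m \in [set p | p \notin t] by rewrite inE.
have [||x [xS xm rx cx]] := std_pair (pre_mu Hd) (pre_Ts Hd) (T' := Ts') mS.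
- by move: lt_m; rewrite /rowfun (negbTE ms).
- by move=> p; rewrite inE => ps /agree; rewrite /rowfun (negbTE ps).
rewrite inE in xS.
have kill w : psym (row_group Ts') false (palt (col_group Ts) false w) = 0.
  apply: (@psym_palt_kill _ _ _ (tperm x m)); rewrite ?odd_tperm //;
    try exact: fibre_group_set.
    by apply: tperm_fibre => //; rewrite (mem_Ts Hd') ss.
  by apply: tperm_fibre; rewrite ?(mem_Ts Hd).
apply/eqP; rewrite yop_psym_first (psym_psymC false).
rewrite dot_psym; last exact: fibre_group_set.
by rewrite /pairing_vec (psym_paltC true) kill (linear0 (palt _ _)) dot0r.
Qed.

Lemma pairing_same : rowfun s T =1 rowfun s' T' -> rowfun t Ts =1 rowfun t' Ts' ->
  (r', s', t', la', mu', T', Ts') = (r, s, t, la, mu, T, Ts).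
Proof.
have [rr ss tt] := pairing_same_pairs; rewrite ss tt => e1 e2.
have HT' := pre_T Hd'; have HTs' := pre_Ts Hd'; rewrite ss in HT'; rewrite tt in HTs'.
have eT : T' = T.
  apply/esym/(std_eq (pre_la Hd) (pre_T Hd) (pre_la Hd') HT') => p.
  by rewrite inE => ps; have := e1 p; rewrite /rowfun (negbTE ps).
have eTs : Ts' = Ts.
  apply/esym/(std_eq (pre_mu Hd) (pre_Ts Hd) (pre_mu Hd') HTs') => p.
  by rewrite inE => ps; have := e2 p; rewrite /rowfun (negbTE ps).
rewrite rr eT eTs -(std_shape (pre_T Hd)) -(std_shape (pre_Ts Hd)).
by rewrite -(std_shape HT') -(std_shape HTs') eT eTs.
Qed.

End TwoData.

Definition datum_xvec (d : datum k) : M :=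
  let: (r, s, t, _, _, T, Ts) := d in dvec (xidx hnk r s t T Ts).
Definition datum_hwv (d : datum k) : M :=
  let: (r, s, t, _, _, T, Ts) := d in yop s t T Ts (dvec (xidx hnk r s t T Ts)).
Definition datum_pairing (d : datum k) : M :=
  let: (r, s, t, _, _, T, Ts) := d in pairing_vec hnk r s t T Ts.
Definition datum_lt (d d' : datum k) : Prop :=
  let: (r, s, t, _, _, T, Ts) := d in
  let: (r', s', t', _, _, T', Ts') := d' in
  lex_lt (rowfun s T) (rowfun s' T') \/
  (rowfun s T =1 rowfun s' T' /\ lex_lt (rowfun t Ts) (rowfun t' Ts')).

Lemma datum_lt_irr d : ~ datum_lt d d.
Proof.
by case: d => [[[[[[r s] t] la] mu] T] Ts] [/lex_irr|[_ /lex_irr]].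
Qed.

Lemma datum_lt_trans d1 d2 d3 : datum_lt d1 d2 -> datum_lt d2 d3 -> datum_lt d1 d3.
Proof.
case: d1 => [[[[[[r1 s1] t1] la1] mu1] T1] Ts1].
case: d2 => [[[[[[r2 s2] t2] la2] mu2] T2] Ts2].
case: d3 => [[[[[[r3 s3] t3] la3] mu3] T3] Ts3].
case=> [h1|[e1 h1]] [h2|[e2 h2]].
- by left; exact: lex_trans h1 h2.
- by left; exact: lex_eqr h1 e2.
- by left; exact: lex_eql e1 h2.
- by right; split; [move=> p; rewrite e1 e2|exact: lex_trans h1 h2].
Qed.

Lemma datum_triangular d d' : preadmissible d -> preadmissible d' ->
  dot (datum_hwv d') (datum_pairing d) != 0 -> d' = d \/ datum_lt d d'.
Proof.
case: d => [[[[[[r s] t] la] mu] T] Ts].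
case: d' => [[[[[[r' s'] t'] la'] mu'] T'] Ts'] Hd Hd' nz.
have [e1|h1] := pairing_rows Hd Hd' nz; last by right; left.
have [e2|h2] := pairing_rows_dual Hd Hd' nz; last by right; right.
by left; exact: (pairing_same Hd Hd' nz e1 e2).
Qed.

End Independence.

(** * Linear independence from triangularity *)

Lemma exists_maximal (I : eqType) (R : I -> I -> Prop) (l : seq I) :
  (forall a, ~ R a a) -> (forall a b c, R a b -> R b c -> R a c) -> l != [::] ->
  exists2 d, d \in l & forall d', d' \in l -> ~ R d d'.
Proof.
move=> irr tr; elim: l => // a l IH _; have [->|l0] := eqVneq l [::].
  by exists a; rewrite ?mem_head // => d'; rewrite inE => /eqP->; exact: irr.
have [d dl maxd] := IH l0; have [Rda|nRda] := pselect (R d a).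
  exists a; rewrite ?mem_head // => d'; rewrite inE => /orP[/eqP->|d'l]; first exact: irr.
  by move=> Rad'; apply: (maxd d' d'l); exact: tr Rad'.
exists d; first by rewrite inE dl orbT.
by move=> d'; rewrite inE => /orP[/eqP->|/maxd].
Qed.

(** In a vanishing combination choose an R-maximal d among the indices with nonzero coefficient:
    phi_d then sees only the term of d. *)
Lemma free_triangular (I : eqType) (V : vectType CC) (R : I -> I -> Prop)
    (l : seq I) (w : I -> V) (phi : I -> V -> CC) :
  (forall a, ~ R a a) -> (forall a b c, R a b -> R b c -> R a c) -> uniq l ->
  (forall i, linear (phi i : V -> CC^o)) ->
  {in l, forall i, phi i (w i) != 0} ->
  {in l &, forall i j, phi i (w j) != 0 -> j = i \/ R i j} ->
  free (map w l).
Proof.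
move=> irr tr ul lphi diag tri.
have coef0 (c : I -> CC) : \sum_(i <- l) c i *: w i = 0 -> {in l, forall i, c i = 0}.
  move=> c0 i il; apply/eqP; apply: contraT => ci.
  have ne : [seq i <- l | c i != 0] != [::].
    by rewrite -has_filter; apply/hasP; exists i.
  have [d] := exists_maximal irr tr ne; rewrite mem_filter => /andP[cd dl] maxd.
  have phiS (J : seq I) : phi d (\sum_(i <- J) c i *: w i) = \sum_(i <- J) c i * phi d (w i).
    elim: J => [|j J IH]; last by rewrite !big_cons lphi IH.
    by rewrite !big_nil; have := lphi d (-1) 0 0; rewrite scaler0 addr0 scaleN1r addNr.
  have := phiS l; rewrite c0.
  have -> : phi d 0 = 0.
    by have := lphi d (-1) 0 0; rewrite scaler0 addr0 scaleN1r addNr.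
  rewrite (bigD1_seq d) //= big_seq_cond big1 ?addr0 => [|j /andP[jl jd]].
    by move/esym/eqP; rewrite mulf_eq0 (negbTE cd) (negbTE (diag _ dl)).
  have [->|cj] := eqVneq (c j) 0; first by rewrite mul0r.
  have [->|pj] := eqVneq (phi d (w j)) 0; first by rewrite mulr0.
  have [e|Rdj] := tri d j dl jl pj; first by rewrite e eqxx in jd.
  by case: (maxd j) => //; rewrite mem_filter cj.
case: l ul coef0 {diag tri} => [|d l] ul coef0; first exact: nil_free.
set L := map w (d :: l); apply/(@freeP _ _ _ (in_tuple L)) => c c0 i.
pose c' j := c (insubd i (index j (d :: l))).
have sL : size L = size (d :: l) by rewrite size_map.
have il : (i < size (d :: l))%N by rewrite -sL.
have -> : c i = c' (nth d (d :: l) i).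
  by rewrite /c' index_uniq //; congr c; apply: val_inj; rewrite val_insubd ltn_ord.
apply: (coef0 c'); last exact: mem_nth.
rewrite (big_nth d) big_mkord -[RHS]c0 -sL; apply: eq_bigr => j _.
have jl : (j < size (d :: l))%N by rewrite -sL.
rewrite /c' index_uniq //= -(nth_map d 0 w) //; congr (c _ *: _).
by apply: val_inj; rewrite val_insubd ltn_ord.
Qed.

(** * Words of highest weight vectors *)

(* For fixed U of size u let S_j be the sum of h over the u-subsets meeting U in
   j points.  Summing the hypothesis over the (u-1)-sets meeting U in j points
   gives (j + 1) S_{j+1} + (u - j) S_j = 0, while S_0 = 0 for lack of room. *)
Lemma raising_injective (I : finType) (X : {set I}) (h : {set I} -> CC) :
  (forall W : {set I}, W \subset X -> \sum_(i in X :\: W) h (i |: W) = 0) ->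
  forall U : {set I}, U \subset X -> (#|X| < 2 * #|U|)%N -> h U = 0.
Proof.
move=> hW U UX XU; set u := #|U|.
pose S j := \sum_(V : {set I} | [&& V \subset X, #|V| == u & #|V :&: U| == j]) h V.
have u0 : (0 < u)%N by rewrite lt0n; apply: contraTneq XU => u0; rewrite -/u u0.
have S0 : S 0%N = 0.
  apply: big1 => V /and3P[VX /eqP Vu /eqP VU]; case/negP: (ltn_geF XU).
  suff <- : #|V :|: U| = (2 * #|U|)%N by rewrite subset_leq_card // subUset VX.
  by rewrite cardsU VU subn0 Vu mul2n addnn.
(* Removing i from V leaves j points in U in two cases: i lies in U and there were j + 1, or i lies
   outside U and there were already j. *)
have cnt (V : {set I}) j : #|V| = u -> #|[set i in V | #|(V :\ i) :&: U| == j]| =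
    ((#|V :&: U| == j.+1) * j.+1 + (#|V :&: U| == j) * (u - j))%N.
  move=> Vu; rewrite -(cardsID U).
  have -> : [set i in V | #|(V :\ i) :&: U| == j] :&: U =
      if #|V :&: U| == j.+1 then V :&: U else set0.
    apply/setP=> i; rewrite !inE.
    case: (boolP (i \in V)) => iV; case: (boolP (i \in U)) => iU;
      rewrite ?andbF //=; last by case: ifP; rewrite !inE ?(negbTE iV) ?(negbTE iU) ?andbF.
    + have : #|V :&: U| = #|(V :\ i) :&: U|.+1.
        by rewrite (cardsD1 i) !inE iV iU setIDAC.
      by move=> ->; rewrite eqSS; case: eqP; rewrite !inE ?iV ?iU.
    + by case: ifP; rewrite !inE ?(negbTE iU) ?andbF.
    by case: ifP; rewrite !inE ?(negbTE iV).
  have -> : [set i in V | #|(V :\ i) :&: U| == j] :\: U =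
      if #|V :&: U| == j then V :\: U else set0.
    apply/setP=> i; rewrite !inE.
    case: (boolP (i \in V)) => iV; case: (boolP (i \in U)) => iU;
      rewrite ?andbF //=.
    + by case: ifP; rewrite !inE ?iU.
    + have -> : (V :\ i) :&: U = V :&: U.
        apply/setP=> x; rewrite !inE; case: (x =P i) => //= ->.
        by rewrite (negbTE iU) andbF.
      by case: ifP; rewrite !inE ?iV ?iU.
    + by case: ifP; rewrite !inE ?iU.
    by case: ifP; rewrite !inE ?(negbTE iV) ?andbF.
  congr (_ + _)%N.
    by case: eqP => [->|]; rewrite ?cards0 ?mul1n.
  by case: eqP => [e|]; rewrite ?cards0 ?mul1n // cardsD Vu e.
have rec j : (j < u)%N -> j.+1%:R * S j.+1 + (u - j)%:R * S j = 0.
  move=> ju.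
  have : \sum_(W : {set I} | [&& W \subset X, #|W| == u.-1 & #|W :&: U| == j])
      \sum_(i in X :\: W) h (i |: W) = 0.
    by apply: big1 => W /and3P[WX _ _]; exact: hW.
  rewrite pair_big_dep /=.
  (* The terms are now indexed by V, the set W with i added, together with the point i to be
     removed. *)
  rewrite (reindex_onto (fun Vi : {set I} * I => (Vi.1 :\ Vi.2, Vi.2))
                        (fun Wi => (Wi.2 |: Wi.1, Wi.2))) /=; last first.
    by move=> [W i] /= /andP[_]; rewrite !inE => /andP[iW _]; rewrite setU1K.
  move=> <-; symmetry.
  rewrite (eq_bigl (fun Vi : {set I} * I => [&& Vi.1 \subset X & #|Vi.1| == u] &&
      (Vi.2 \in [set i in Vi.1 | #|(Vi.1 :\ i) :&: U| == j]))); last first.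
    move=> [V i] /=; rewrite !inE eqxx /=.
    case: (boolP (i \in V)) => iV; last first.
      rewrite andbF; apply/negbTE; rewrite negb_and; apply/orP; right.
      by apply: contra iV => /eqP[<-]; rewrite setU11.
    rewrite setD1K // eqxx andbT.
    have -> : (V \subset X) = (i \in X) && (V :\ i \subset X).
      by rewrite -{1}(setD1K iV) subUset sub1set.
    have -> : (#|V| == u) = (#|V :\ i| == u.-1).
      by rewrite (cardsD1 i V) iV -{1}(prednK u0).
    by case: (i \in X); case: (_ \subset X); case: (_ == u.-1); case: (_ == j).
  rewrite -(pair_big_dep (fun V : {set I} => (V \subset X) && (#|V| == u))
     (fun V i => i \in [set i in V | #|(V :\ i) :&: U| == j]) (fun V i => h (i |: V :\ i))) /=.
  rewrite (eq_bigr (fun V : {set I} =>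
      (if #|V :&: U| == j.+1 then j.+1%:R * h V else 0) +
      (if #|V :&: U| == j then (u - j)%:R * h V else 0))); last first.
    move=> V /andP[_ /eqP Vu]; rewrite (eq_bigr (fun=> h V)); last first.
      by move=> i; rewrite inE => /andP[iV _]; rewrite setD1K.
    rewrite sumr_const cnt // -[LHS]mulr_natl natrD mulrDl !natrM.
    by case: (_ == j.+1); case: (_ == j); rewrite ?mul1r ?mul0r.
  rewrite big_split /= -!big_mkcondr /= /S !mulr_sumr; congr (_ + _);
    by apply: eq_bigl => V; rewrite -andbA.
have Sj j : (j <= u)%N -> S j = 0.
  elim: j => // j IH ju; have := rec j ju; rewrite IH ?(ltnW ju) // mulr0 addr0.
  by move/eqP; rewrite mulf_eq0 pnatr_eq0 => /eqP.
(* For j = u the sum has the single term V = U. *)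
have := Sj u (leqnn _); rewrite /S (big_pred1 U) // => V /=.
apply/and3P/eqP=> [[VX /eqP Vu /eqP VU]|->]; last by rewrite UX setIid !eqxx.
have e : V :&: U = V by apply/eqP; rewrite eqEcard subsetIl VU Vu leqnn.
by apply/eqP; rewrite eqEcard -{1}e subsetIr Vu leqnn.
Qed.

Section Words.
Variables n k : nat.
Local Notation word := {ffun 'I_k -> 'I_n}.

(* Take a word where g does not vanish, maximal for the comparison at the last
   differing position.  Changing letters beyond a prefix only produces larger
   words, so the raising equations hold on each prefix separately and
   raising_injective yields the lattice condition. *)
Lemma lattice_word (P : {set 'I_k}) (r : nat) (g : word -> CC) (a0 : word) :
  let allowed (a : word) := [forall i, if i \in P then (a i < r)%N else a i == a0 i] in
  (forall (a : word) (p q : 'I_n), allowed a -> (p < q)%N -> (q < r)%N ->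
     \sum_(i in P | a i == p) g (upd a i q) = 0) ->
  allowed a0 -> g a0 != 0 ->
  exists a : word, [/\ allowed a, g a != 0 & lattice P (fun i => a i)].
Proof.
move=> allowed eqs al0 g0.
(* [rev_ord] turns the comparison at the first difference into one at the last. *)
pose R (a a' : word) := lex_lt (fun p => a (rev_ord p)) (fun p => a' (rev_ord p)).
have [|||a] := @exists_maximal _ R [seq a <- enum {: word} | allowed a && (g a != 0)].
- by move=> a; exact: lex_irr.
- by move=> a b c; exact: lex_trans.
- by rewrite -has_filter; apply/hasP; exists a0; rewrite ?mem_enum ?al0.
rewrite mem_filter => /andP[/andP[al ga] _] maxa.
have max0 a' : allowed a' -> R a a' -> g a' = 0.
  move=> al' Raa'; apply/eqP; apply: contraT => ga'.
  by case: (maxa a') => //; rewrite mem_filter al' ga' mem_enum.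
exists a; split=> // i0 j.
have [/set0Pn[x]|/negPn/eqP->] := boolP ([set p in P | (p <= i0)%N && (a p == j.+1 :> nat)] != set0);
  last by rewrite cards0.
rewrite inE => /and3P[xP xi /eqP ax]; pose q := a x.
have qr : (q < r)%N by have := forallP al x; rewrite xP.
have jn : (j < n)%N by apply: leq_trans (ltn_ord q); rewrite ltnS /q ax.
pose p := Ordinal jn; have pq : (p < q)%N by rewrite /q ax.
have pNq : p != q by rewrite neq_ltn pq.
have pr : (p < r)%N by exact: ltn_trans pq qr.
(* X holds the positions of the prefix carrying p or q; a subset U of X encodes the word with q on U
   and p on the rest of X. *)
pose X := [set y in P | (y <= i0)%N && ((a y == p) || (a y == q))].
pose w (U : {set 'I_k}) : word :=
  [ffun y => if y \in X then (if y \in U then q else p) else a y].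
have alw U : allowed (w U).
  apply/forallP=> y; rewrite ffunE; case: (boolP (y \in X)) => yX.
    by move: (yX); rewrite inE => /andP[-> _]; case: ifP.
  exact: (forallP al).
have hyp (W : {set 'I_k}) : W \subset X -> \sum_(i in X :\: W) g (w (i |: W)) = 0.
  move=> WX; have := eqs (w W) p q (alw W) pq qr.
  rewrite (bigID (mem X)) /= [X in _ + X]big1 ?addr0 => [e|i]; last first.
    move=> /andP[/andP[iP wi] iX]; apply: max0.
      apply/forallP=> y; rewrite ffunE; case: eqP => [->|_]; first by rewrite iP.
      exact: (forallP (alw W)).
    rewrite ffunE (negbTE iX) in wi.
    have i0i : (i0 < i)%N.
      by rewrite ltnNge; apply: contra iX => ii0; rewrite inE iP ii0 wi.
    exists (rev_ord i); split=> [y|]; last by rewrite rev_ordK upd_eq (eqP wi).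
    rewrite /= => yi; have iy : (i < rev_ord y)%N.
      by move: yi; rewrite /= !ltn_subRL addSnnS addnC.
    rewrite upd_neq; last by rewrite neq_ltn iy orbT.
    rewrite ffunE; case: ifP => //; rewrite inE => /and3P[_ yi0 _].
    by have := leq_trans (ltn_trans i0i iy) yi0; rewrite ltnn.
  rewrite -[RHS]e; apply: eq_big => [i|i]; rewrite in_setD.
    rewrite ffunE; case: (boolP (i \in X)) => iX; last by rewrite !andbF.
    move: (iX); rewrite inE => /andP[-> _]; rewrite !andbT /=.
    by case: (i \in W); rewrite ?eqxx // eq_sym (negbTE pNq).
  move=> /andP[iW iX]; congr g; apply/ffunP=> y; rewrite !ffunE in_setU1.
  by case: (y =P i) => [->|_] //; rewrite iX.
pose U := [set y in X | a y == q].
have UX : U \subset X by apply/fintype.subsetP=> y; rewrite inE => /andP[].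
have wU : w U = a.
  apply/ffunP=> y; rewrite ffunE; case: ifP => // yX.
  rewrite inE yX /=; case: eqP => [->//|/eqP nq].
  by move: yX; rewrite inE (negbTE nq) orbF => /and3P[_ _ /eqP].
(* As g a <> 0, at least half of X carries p: in the prefix q does not outnumber p. *)
have := @raising_injective _ X (fun U => g (w U)) hyp U UX.
rewrite wU => h; have {h} : ~~ (#|X| < 2 * #|U|)%N by apply: contra ga => /h->.
have -> : #|X| = (#|U| + #|[set y in X | a y == p]|)%N.
  rewrite -(cardsID U X) (setIidPr UX); congr (_ + #|pred_of_set _|)%N.
  apply/setP=> y; rewrite !inE.
  case: (y \in P) => //=; case: (y <= i0)%N => //=.
  by case: (a y =P p) => [->|_] /=; [rewrite (negbTE pNq)|case: (_ == _)].
rewrite -leqNgt mul2n -addnn leq_add2l.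
have pE y : (a y == p) = (a y == j :> nat) by [].
have qE y : (a y == q) = (a y == j.+1 :> nat) by rewrite -ax.
congr (_ <= _)%N; apply: eq_card => y; rewrite !inE pE qE;
  case: (y \in P); case: (y <= i0)%N => //=.
  by case: (_ == j.+1); rewrite ?andbF ?orbT.
by case: (_ == j); rewrite ?andbF.
Qed.

End Words.

(** * Highest weight vectors are determined by their coordinates at the x'_d *)

Lemma uniq_map_inj (I J : eqType) (f : I -> J) (l : seq I) :
  uniq (map f l) -> {in l &, injective f}.
Proof.
elim: l => //= x l IH /andP[nx ul] a b; rewrite !inE.
case/orP=> [/eqP->|al] /orP[/eqP->|bl] // e; last exact: IH.
  by case/negP: nx; rewrite e map_f.
by case/negP: nx; rewrite -e map_f.
Qed.

Section Evaluation.
Variables n k : nat.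
Hypothesis hnk : (2 * k <= n)%N.
Local Notation M := (M n k).
Local Notation word := {ffun 'I_k -> 'I_n}.
Local Notation pairs := (seq ('I_k * 'I_k)).
Implicit Types (a b : word) (z : pairs).

Variable phi : M.
Hypothesis phiH : phi \in @hwspace n k.

(** The equation E_pq phi = 0 as an exchange rule between changing letters p to q in a and letters q
    to p in b. *)
Lemma hw_eq (p q : 'I_n) a b : (p < q)%N ->
  \sum_(i | a i == p) phi (upd a i q, b) = \sum_(j | b j == q) phi (a, upd b j p).
Proof.
move=> pq; have /hwspaceP/(_ p q pq) e := phiH.
by apply/eqP; rewrite -subr_eq0 -act_delta e M0E.
Qed.

Lemma sum_neq0 (P : pred 'I_k) (F : 'I_k -> CC) :
  \sum_(i | P i) F i != 0 -> exists2 i, P i & F i != 0.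
Proof.
move=> nz; apply: contrapT => h; case/eqP: nz; apply: big1 => i Pi.
by apply/eqP; apply: contraT => Fi; case: h; exists i.
Qed.

Lemma sum_fresh (F : 'I_k -> CC) a i q : (forall x, a x != q) ->
  \sum_(x | upd a i q x == q) F x = F i.
Proof.
move=> qa; rewrite (big_pred1 i) // => x /=; rewrite ffunE.
by case: (x =P i) => _; rewrite ?eqxx // (negbTE (qa x)).
Qed.

(** A partial matching of V-positions with dual positions of the same letter, at a nonzero
    coordinate; the letter of a pair may still occur elsewhere. *)
Definition matching z a b := [/\ uniq (unzip1 z), uniq (unzip2 z),
  forall ij, ij \in z -> a ij.1 = b ij.2 & phi (a, b) != 0].

Definition simple_matching z a b := matching z a b /\ forall ij, ij \in z ->
  (forall i, a i = a ij.1 -> i = ij.1) /\ (forall j, b j = b ij.2 -> j = ij.2).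

Definition used a b : {set 'I_n} := [set a i | i : 'I_k] :|: [set b j | j : 'I_k].

Lemma usedPn a b q : q \notin used a b ->
  (forall x, a x != q) /\ (forall x, b x != q).
Proof.
rewrite inE negb_or => /andP[h1 h2]; split=> x.
  by apply: contraNneq h1 => <-; exact: imset_f.
by apply: contraNneq h2 => <-; exact: imset_f.
Qed.

Lemma used_l a b i : a i \in used a b. Proof. by rewrite inE imset_f. Qed.
Lemma used_r a b j : b j \in used a b. Proof. by rewrite inE imset_f ?orbT. Qed.

Lemma mem_used a b v : v \in used a b -> (exists i, a i = v) \/ (exists j, b j = v).
Proof.
by rewrite inE => /orP[] /imsetP[x _ ->]; [left|right]; exists x.
Qed.

(** A letter shared by a and b leaves at most 2k - 1 < n letters in use. *)
Lemma exists_fresh z a b ij : matching z a b -> ij \in z -> exists q, q \notin used a b.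
Proof.
move=> [_ _ m _] ijz; apply: contrapT => /forallNP h.
have : used a b = [set: 'I_n].
  by apply/setP=> q; rewrite in_setT; apply/negPn/negP/h.
move/(congr1 (fun s : {set 'I_n} => #|s|)); rewrite cardsT card_ord cardsU => e.
have c1 : (#|[set a i | i : 'I_k]| <= k)%N by rewrite -[X in (_ <= X)%N]card_ord leq_imset_card.
have c2 : (#|[set b i | i : 'I_k]| <= k)%N by rewrite -[X in (_ <= X)%N]card_ord leq_imset_card.
have c3 : (0 < #|[set a i | i : 'I_k] :&: [set b j | j : 'I_k]|)%N.
  by apply/card_gt0P; exists (a ij.1); rewrite inE imset_f //= (m _ ijz) imset_f.
have : (n < 2 * k)%N.
  rewrite -e mul2n -addnn; apply: leq_trans (leq_add c1 c2).
  rewrite ltn_subLR ?leq_addr // ?(leq_trans (subset_leq_card (subsetIl _ _))) ?leq_addr //.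
  by rewrite -[X in (X < _)%N]add0n ltn_add2r.
by rewrite ltnNge hnk.
Qed.

Lemma upd_tperm a i i0 q x : a i = a i0 -> x != i0 -> upd a i q (tperm i0 i x) = a x.
Proof.
move=> e xi0; rewrite ffunE; case: tpermP => [xE|xE|/eqP h1 /eqP h2].
- by rewrite xE eqxx in xi0.
- by rewrite xE eq_sym in xi0 *; rewrite (negbTE xi0) e.
- by rewrite (negbTE h2).
Qed.

(** An exchange may hit occurrences i, j of the letter other than the matched ones; the
    transpositions reroute the matching so that (i, j) becomes a pair. *)
Lemma tperm_matching z a b ij i j q v : matching z a b -> ij \in z ->
  a i = v -> b j = v -> a ij.1 = v -> phi (upd a i q, upd b j q) != 0 ->
  matching (map (fun xy => (tperm ij.1 i xy.1, tperm ij.2 j xy.2)) z)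
           (upd a i q) (upd b j q).
Proof.
move=> [u1 u2 m _] ijz ai bj av nz; have bv : b ij.2 = v by rewrite -m.
split=> //.
- by rewrite /unzip1 -map_comp (map_comp (tperm ij.1 i) fst) map_inj_uniq //; exact: perm_inj.
- by rewrite /unzip2 -map_comp (map_comp (tperm ij.2 j) snd) map_inj_uniq //; exact: perm_inj.
move=> _ /mapP[xy xyz ->] /=; have [->|ne] := eqVneq xy ij.
  by rewrite !tpermL !upd_eq.
rewrite !upd_tperm ?ai ?bj ?m //.
  by apply: contraNneq ne => e; rewrite (uniq_map_inj u2 xyz ijz e).
by apply: contraNneq ne => e; rewrite (uniq_map_inj u1 xyz ijz e).
Qed.

(* Raising (or lowering) one occurrence of the common value v of a matched pair
   to an unused value q on one side forces a compensating change on the other. *)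
Lemma matching_move z a b ij q : matching z a b -> ij \in z -> q \notin used a b ->
  exists i j z', [/\ a i = a ij.1, b j = b ij.2, size z' = size z &
    matching z' (upd a i q) (upd b j q)].
Proof.
move=> mz ijz /usedPn[qa qb]; have [_ _ m nz] := mz.
suff [i [j [ai bj nz']]] : exists i j,
    [/\ a i = a ij.1, b j = b ij.2 & phi (upd a i q, upd b j q) != 0].
  exists i, j, (map (fun xy => (tperm ij.1 i xy.1, tperm ij.2 j xy.2)) z).
  rewrite size_map; split=> //; apply: (tperm_matching (v := a ij.1)) => //.
  by rewrite bj m.
have [lt|lt|/val_inj e] := ltngtP (a ij.1) q; last by have := qa ij.1; rewrite e eqxx.
  have := @hw_eq _ _ a (upd b ij.2 q) lt.
  rewrite (sum_fresh _ _ qb) updK (m _ ijz) upd_id => e.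
  have [|i /eqP ai nz'] := @sum_neq0 (fun i => a i == b ij.2)
    (fun i => phi (upd a i q, upd b ij.2 q)); first by rewrite e.
  by exists i, ij.2; rewrite ai.
have := @hw_eq _ _ (upd a ij.1 q) b lt.
rewrite (sum_fresh _ _ qa) updK upd_id => e.
have [|j /eqP bj nz'] := @sum_neq0 (fun j => b j == a ij.1)
  (fun j => phi (upd a ij.1 q, upd b j q)); first by rewrite -e.
by exists ij.1, j; rewrite bj -m.
Qed.

(** In a simple matching the letter of a pair has no other occurrence, so an exchange can only hit
    the pair itself. *)
Lemma simple_move z a b ij q : simple_matching z a b -> ij \in z ->
  q \notin used a b -> simple_matching z (upd a ij.1 q) (upd b ij.2 q).
Proof.
move=> [mz sz] ijz qu; have [qa qb] := usedPn qu.
have [i [j [z' [ai bj _ [_ _ _ nz']]]]] := matching_move mz ijz qu.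
have [s1 s2] := sz _ ijz; rewrite (s1 _ ai) (s2 _ bj) in nz'.
have [u1 u2 m _] := mz.
have neq xy : xy \in z -> xy != ij -> xy.1 != ij.1 /\ xy.2 != ij.2.
  move=> xyz ne; split; apply: contraNneq ne => e.
    by rewrite (uniq_map_inj u1 xyz ijz e).
  by rewrite (uniq_map_inj u2 xyz ijz e).
split; first split=> // xy xyz.
  have [->|ne] := eqVneq xy ij; first by rewrite !upd_eq.
  by have [n1 n2] := neq _ xyz ne; rewrite !upd_neq // m.
move=> xy xyz; have [->|ne] := eqVneq xy ij.
  rewrite !upd_eq; split=> x; rewrite ffunE; case: (x =P _) => // _ e.
    by have := qa x; rewrite e eqxx.
  by have := qb x; rewrite e eqxx.
have [n1 n2] := neq _ xyz ne; have [t1 t2] := sz _ xyz.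
rewrite !upd_neq //; split=> x; rewrite ffunE; case: (x =P _) => _ e.
- by have := qa xy.1; rewrite -e eqxx.
- exact: t1.
- by have := qb xy.2; rewrite -e eqxx.
- exact: t2.
Qed.

(* Among the matchings of a given size take one using as many values as
   possible: if a matched value occurred elsewhere, a move would add a value. *)
Lemma exists_simple z a b : matching z a b ->
  exists z' a' b', size z' = size z /\ simple_matching z' a' b'.
Proof.
move=> mz.
pose P m := `[< exists z' a' b', [/\ size z' = size z, matching z' a' b' & #|used a' b'| = m] >].
have exP : exists m, P m by exists #|used a b|; apply/asboolP; exists z, a, b.
have ubP m : P m -> (m <= n)%N.
  by move=> /asboolP[_ [a' [b' [_ _ <-]]]]; rewrite -[X in (_ <= X)%N]card_ord max_card.
case: (ex_maxnP exP ubP) => m /asboolP[z' [a' [b' [sz mz' um]]]] maxm.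
exists z', a', b'; split=> //; split=> // ij ijz.
have [_ _ me _] := mz'.
have absurd x : a' x = a' ij.1 /\ x != ij.1 \/ b' x = b' ij.2 /\ x != ij.2 -> False.
  move=> hx; have [q qu] := exists_fresh mz' ijz.
  have [i [j [z2 [ai bj s2 m2]]]] := matching_move mz' ijz qu.
  have : (m.+1 <= m)%N; last by rewrite ltnn.
  have Pm2 : P #|used (upd a' i q) (upd b' j q)|.
    by apply/asboolP; exists z2, (upd a' i q), (upd b' j q); rewrite s2.
  apply: leq_trans (maxm _ Pm2).
  have -> : m.+1 = #|q |: used a' b'| by rewrite cardsU1 qu um add1n.
  apply/subset_leq_card/fintype.subsetP => v.
  have v0 : a' ij.1 \in used (upd a' i q) (upd b' j q).
    case: hx => -[e ne].
      have [y [ey yi]] : exists y, a' y = a' ij.1 /\ y != i.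
        have [xi|xi] := eqVneq x i; last by exists x.
        by exists ij.1; rewrite -xi eq_sym.
      by have := used_l (upd a' i q) (upd b' j q) y; rewrite upd_neq // ey.
    have [y [ey yj]] : exists y, b' y = b' ij.2 /\ y != j.
      have [xj|xj] := eqVneq x j; last by exists x.
      by exists ij.2; rewrite -xj eq_sym.
    have := used_r (upd a' i q) (upd b' j q) y.
    by rewrite upd_neq // ey -me.
  rewrite in_setU1 => /orP[/eqP->|/mem_used[[y <-]|[y <-]]].
  - by have := used_l (upd a' i q) (upd b' j q) i; rewrite upd_eq.
  - have [yi|yi] := eqVneq y i; first by rewrite yi ai.
    by have := used_l (upd a' i q) (upd b' j q) y; rewrite upd_neq.
  - have [yj|yj] := eqVneq y j; first by rewrite yj bj -me.
    by have := used_r (upd a' i q) (upd b' j q) y; rewrite upd_neq.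
split=> x e; apply/eqP/negPn/negP => ne; apply: (absurd x); first by left.
by right.
Qed.

(** * Unmatched letters when no larger matching exists *)

Section Unmatched.
Variables (z : pairs).
Hypothesis maxz : forall z' a' b', matching z' a' b' -> size z' = (size z).+1 -> False.

(** Otherwise adding (i, j) would give a larger matching. *)
Lemma unmatched_disjoint a b i j : matching z a b ->
  i \notin unzip1 z -> j \notin unzip2 z -> a i != b j.
Proof.
move=> [u1 u2 m nz] iz jz; apply/eqP => e.
apply: (maxz (z' := (i, j) :: z) (a' := a) (b' := b)) => //; split=> //=.
- by rewrite iz.
- by rewrite jz.
by move=> xy; rewrite inE => /orP[/eqP->|/m].
Qed.

(** Apply the exchange rule to a with its letter at i replaced by c. As c is absent from a, one side
    is phi (a, b); the other runs over j with b_j = a_i, and there are none, by simplicity if j is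
    matched and by maximality if it is not. *)
Lemma unmatched_l_absurd a b i (c : 'I_n) : simple_matching z a b ->
  i \notin unzip1 z -> (c < a i)%N -> (forall x, a x != c) -> False.
Proof.
move=> [mz sz] iz lt ca; have [u1 u2 m /eqP nz] := mz; apply: nz.
have := @hw_eq _ _ (upd a i c) b lt; rewrite (sum_fresh _ _ ca) updK upd_id => ->.
apply: big1 => j /eqP bj; exfalso.
have [/mapP[xy xyz e]|jz] := boolP (j \in unzip2 z).
  have [s1 _] := sz _ xyz; case/negP: iz.
  by rewrite (s1 i) ?map_f // m // -e bj.
by have := unmatched_disjoint mz iz jz; rewrite bj eqxx.
Qed.

Lemma unmatched_r_absurd a b j (c : 'I_n) : simple_matching z a b ->
  j \notin unzip2 z -> (b j < c)%N -> (forall x, b x != c) -> False.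
Proof.
move=> [mz sz] jz lt cb; have [u1 u2 m /eqP nz] := mz; apply: nz.
have := @hw_eq _ _ a (upd b j c) lt; rewrite (sum_fresh _ _ cb) updK upd_id => <-.
apply: big1 => i /eqP ai; exfalso.
have [/mapP[xy xyz e]|iz] := boolP (i \in unzip1 z).
  have [_ s2] := sz _ xyz; case/negP: jz.
  by rewrite (s2 j) ?map_f // -m // -e ai.
by have := unmatched_disjoint mz iz jz; rewrite ai eqxx.
Qed.

Lemma unmatched_l_closed a b i (c : 'I_n) : simple_matching z a b ->
  i \notin unzip1 z -> (c < a i)%N -> exists2 x, x \notin unzip1 z & a x = c.
Proof.
move=> sm iz lt; apply: contrapT => h; have [mz sz] := sm.
have [[ij ijz /= /eqP e]|nl] := @hasP _ (fun ij : 'I_k * 'I_k => a ij.1 == c) z.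
  have [q qu] := exists_fresh mz ijz; have [qa qb] := usedPn qu.
  have iij : i != ij.1 by apply: contraNneq iz => ->; rewrite map_f.
  apply: (unmatched_l_absurd (simple_move sm ijz qu) iz (c := c)).
    by rewrite upd_neq.
  move=> x; rewrite ffunE; case: (x =P _) => [_|xij].
    by apply/eqP => qc; have := qa ij.1; rewrite e qc eqxx.
  apply/eqP => ax; apply: xij; have [s1 _] := sz _ ijz; apply: s1.
  by rewrite ax e.
apply: (unmatched_l_absurd sm iz lt) => x; apply/eqP => ax.
have [/mapP[xy xyz xe]|xz] := boolP (x \in unzip1 z); last by case: h; exists x.
by case: nl; exists xy; rewrite // -xe ax.
Qed.

Lemma unmatched_r_closed a b j (c : 'I_n) : simple_matching z a b ->
  j \notin unzip2 z -> (b j < c)%N -> exists2 x, x \notin unzip2 z & b x = c.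
Proof.
move=> sm jz lt; apply: contrapT => h; have [mz sz] := sm.
have [[ij ijz /= /eqP e]|nl] := @hasP _ (fun ij : 'I_k * 'I_k => b ij.2 == c) z.
  have [q qu] := exists_fresh mz ijz; have [qa qb] := usedPn qu.
  have jij : j != ij.2 by apply: contraNneq jz => ->; rewrite map_f.
  apply: (unmatched_r_absurd (simple_move sm ijz qu) jz (c := c)).
    by rewrite upd_neq.
  move=> x; rewrite ffunE; case: (x =P _) => [_|xij].
    by apply/eqP => qc; have := qb ij.2; rewrite e qc eqxx.
  apply/eqP => ax; apply: xij; have [_ s2] := sz _ ijz; apply: s2.
  by rewrite ax e.
apply: (unmatched_r_absurd sm jz lt) => x; apply/eqP => ax.
have [/mapP[xy xyz xe]|xz] := boolP (x \in unzip2 z); last by case: h; exists x.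
by case: nl; exists xy; rewrite // -xe ax.
Qed.

Lemma card_off (u : seq 'I_k) : uniq u -> #|[set x | x \notin u]| = (k - size u)%N.
Proof.
move=> uu; have := cardsC [set x in u]; rewrite card_ord cardsE (card_uniqP uu) => e.
rewrite -[X in (X - _)%N]e addKn; apply: eq_card => x; by rewrite !inE.
Qed.

Lemma card_lt_ord m : (m <= n)%N -> #|[set c : 'I_n | (c < m)%N]| = m.
Proof.
move=> mn; have winj : injective (widen_ord mn).
  by move=> x y /(congr1 val) /= e; exact: val_inj.
rewrite -[RHS]card_ord -(card_imset predT winj).
apply: eq_card => c; rewrite !inE; apply/idP/imsetP => [cm|[x _ ->]]; last exact: (ltn_ord x).
by exists (Ordinal cm) => //; apply: val_inj.
Qed.

(** By closure under smaller letters, the letters at unmatched positions form an initial segment, no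
    longer than the number of these positions. *)
Lemma unmatched_l_lt a b i : simple_matching z a b -> i \notin unzip1 z ->
  (a i < k - size z)%N.
Proof.
move=> sm iz; have [[u1 _ _ _] _] := sm.
rewrite -(size_map fst z) -card_off // -(card_lt_ord (ltn_ord (a i))).
apply: leq_trans (leq_imset_card a _).
apply/subset_leq_card/fintype.subsetP => c; rewrite inE ltnS leq_eqVlt.
case/orP=> [/eqP/val_inj->|ci]; first by rewrite imset_f // inE.
by have [x xz <-] := unmatched_l_closed sm iz ci; rewrite imset_f // inE.
Qed.

Lemma unmatched_r_ge a b j : simple_matching z a b -> j \notin unzip2 z ->
  (n - (k - size z) <= b j)%N.
Proof.
move=> sm jz; have [[_ u2 _ _] _] := sm.
rewrite leq_subCl -(size_map snd z) -card_off //.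
rewrite -(card_lt_ord (leq_subr (b j) n)).
apply: leq_trans (leq_imset_card (fun x => rev_ord (b x)) _).
apply/subset_leq_card/fintype.subsetP => c; rewrite inE => cb.
have rc : (b j <= rev_ord c)%N.
  by move: cb; rewrite ltn_subRL /= leq_subRL // addSn addnC.
move: rc; rewrite leq_eqVlt => /orP[/eqP/val_inj e|bc].
  by apply/imsetP; exists j; rewrite ?inE // e rev_ordK.
have [x xz e] := unmatched_r_closed sm jz bc.
by apply/imsetP; exists x; rewrite ?inE // e rev_ordK.
Qed.

End Unmatched.

End Evaluation.

Lemma index_map_uniq (I J : eqType) (f : I -> J) (l : seq I) x :
  uniq (map f l) -> x \in l -> index (f x) (map f l) = index x l.
Proof.
move=> ul xl; have ix : (index x l < size l)%N by rewrite index_mem.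
by rewrite -{1}(nth_index x xl) -(nth_map x (f x)) // index_uniq ?size_map.
Qed.

(** * Reduction of a nonzero coordinate to some x'_d *)

Section EvaluationMain.
Variables n k : nat.
Hypothesis hnk : (2 * k <= n)%N.
Local Notation M := (M n k).
Local Notation word := {ffun 'I_k -> 'I_n}.
Local Notation pairs := (seq ('I_k * 'I_k)).
Implicit Types (a b : word) (z : pairs).

Variable phi : M.
Hypothesis phiH : phi \in @hwspace n k.
Local Notation matching := (matching phi).
Local Notation simple_matching := (simple_matching phi).

Lemma matching_size z a b : matching z a b -> (size z <= k)%N.
Proof.
move=> [u1 _ _ _]; rewrite -(size_map fst z) -(card_uniqP u1).
by rewrite -[X in (_ <= X)%N]card_ord max_card.
Qed.

Lemma perm_simple z z' a b : perm_eq z z' -> simple_matching z a b ->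
  simple_matching z' a b.
Proof.
move=> p [[u1 u2 m nz] sz]; split; first split=> //.
- by rewrite -(perm_uniq (perm_map fst p)).
- by rewrite -(perm_uniq (perm_map snd p)).
- by move=> ij; rewrite -(perm_mem p); exact: m.
by move=> ij; rewrite -(perm_mem p); exact: sz.
Qed.

Section Step.
Variable z : pairs.
Hypothesis maxz : forall z' a' b', matching z' a' b' -> size z' = (size z).+1 -> False.
Local Notation r := (k - size z)%N.

Definition placed a : nat := count (fun ij => a ij.1 == (r + index ij z)%N :> nat) z.

Lemma placed_move a b ij (q : 'I_n) : simple_matching z a b -> ij \in z ->
  a ij.1 != (r + index ij z)%N :> nat ->
  (placed a + (q == (r + index ij z)%N :> nat) <= placed (upd a ij.1 q))%N.
Proof.
move=> [[u1 _ _ _] _] ijz wrong; have uz := map_uniq u1.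
rewrite /placed !(seq.permP (perm_to_rem ijz)) /= (negbTE wrong) add0n addnC.
rewrite upd_eq leq_add2l -!size_filter uniq_leq_size ?filter_uniq ?rem_uniq // => xy.
rewrite !mem_filter mem_rem_uniq // => /andP[e h]; rewrite h andbT.
move: h; rewrite inE => /andP[ne xyz]; rewrite upd_neq //.
by apply: contraNneq ne => e1; rewrite (uniq_map_inj u1 xyz ijz e1).
Qed.

Lemma place_labels a b : simple_matching z a b -> exists a' b',
  simple_matching z a' b' /\ forall ij, ij \in z -> a' ij.1 = (r + index ij z)%N :> nat.
Proof.
move=> sm.
pose P m := `[< exists a' b', simple_matching z a' b' /\ placed a' = m >].
have exP : exists m, P m by exists (placed a); apply/asboolP; exists a, b.
have ubP m : P m -> (m <= size z)%N.
  by move=> /asboolP[a' [b' [_ <-]]]; exact: count_size.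
case: (ex_maxnP exP ubP) => m /asboolP[a' [b' [sm' pm]]] maxm.
exists a', b'; split=> // ij ijz; apply/eqP/negPn/negP => wrong.
have zk := matching_size sm'.1.
have target_k : (r + index ij z < k)%N.
  by rewrite -ltn_subRL subKn // index_mem.
have kr : (k <= n - r)%N.
  have rk := leq_subr (size z) k.
  rewrite leq_subRL; last exact: leq_trans rk (leq_kn hnk).
  by apply: leq_trans hnk; rewrite mul2n -addnn leq_add2r.
pose q := Ordinal (leq_trans target_k (leq_kn hnk)).
(* A label q absent from a1 is absent from b1 too: matched letters of b1 occur in a1, and unmatched
   ones are at least n - r >= k. *)
have finish a1 b1 : simple_matching z a1 b1 -> (m <= placed a1)%N ->
    a1 ij.1 != (r + index ij z)%N :> nat -> (forall x, a1 x != q) -> False.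
  move=> sm1 m1 wrong1 qa.
  have qu : q \notin used a1 b1.
    rewrite inE negb_or; apply/andP; split; apply/imsetP => -[x _ qx].
      by have := qa x; rewrite qx eqxx.
    have [/mapP[xy xyz e]|xz] := boolP (x \in unzip2 z).
      have [[_ _ me _] _] := sm1.
      by have := qa xy.1; rewrite qx e (me _ xyz) eqxx.
    have := leq_trans kr (unmatched_r_ge hnk phiH maxz sm1 xz).
    by rewrite -qx leqNgt target_k.
  have sm2 := simple_move phiH sm1 ijz qu.
  have := placed_move q sm1 ijz wrong1; rewrite eqxx addn1 => h.
  have : (m.+1 <= m)%N; last by rewrite ltnn.
  apply: leq_trans (maxm (placed (upd a1 ij.1 q)) _); first exact: leq_ltn_trans m1 h.
  by apply/asboolP; exists (upd a1 ij.1 q), (upd b1 ij.2 q).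
have [/existsP[x /eqP ax]|/existsPn nq] := boolP [exists x, a' x == q]; last first.
  by apply: (finish a' b') => //; rewrite pm.
have [/mapP[xy xyz xe]|xz] := boolP (x \in unzip1 z); last first.
  have := unmatched_l_lt hnk phiH maxz sm' xz.
  by rewrite ax /= ltnNge leq_addr.
have xyij : xy != ij.
  apply/eqP => e; case/negP: wrong.
  by have -> : ij.1 = x; [rewrite xe e|rewrite ax].
have [[u1 _ _ _] sz'] := sm'.
have xy1 : ij.1 != xy.1.
  by apply: contraNneq xyij => e; rewrite (uniq_map_inj u1 ijz xyz e).
have wxy : a' xy.1 != (r + index xy z)%N :> nat.
  rewrite -xe ax /= eqn_add2l; apply: contraNneq xyij => e.
  by rewrite -(nth_index ij xyz) -e nth_index.
have [q' qu'] := exists_fresh hnk sm'.1 ijz.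
apply: (finish (upd a' xy.1 q') (upd b' xy.2 q')).
- exact: simple_move.
- rewrite -pm; apply: leq_trans (placed_move q' sm' xyz wxy); exact: leq_addr.
- by rewrite upd_neq.
move=> w; rewrite ffunE; case: (w =P _) => [_|wx].
  by apply: contraNneq qu' => ->; rewrite -ax used_l.
apply/eqP => aw; apply: wx; have [s1 _] := sz' _ xyz; apply: s1.
by rewrite aw -xe ax.
Qed.

End Step.

(* Downward induction on the size of a matching: once larger matchings are
   excluded, a matching of the given size can be brought to the form x'_d. *)
Lemma no_matching (m : nat) z a b :
  (forall d : datum k, preadmissible d -> dot phi (datum_xvec hnk d) = 0) ->
  matching z a b -> (k < size z + m)%N -> False.
Proof.
move=> eval0; elim: m z a b => [|m IH] z a b mz.
  by rewrite addn0 ltnNge (matching_size mz).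
rewrite addnS ltnS leq_eqVlt => /orP[/eqP kz|]; last exact: IH mz.
have [z1 [a1 [b1 [sz1 sm1]]]] := exists_simple hnk phiH mz.
(* Sorting the pairs by first position makes s increasing, as a datum requires. *)
pose le1 := (fun u v : 'I_k * 'I_k => (u.1 <= v.1)%N).
pose z2 := sort le1 z1.
have p2 : perm_eq z1 z2 by rewrite perm_sym perm_sort.
have sm2 := perm_simple p2 sm1.
have sz2 : size z2 = size z by rewrite size_sort.
have max2 z' a' b' : matching z' a' b' -> size z' = (size z2).+1 -> False.
  by move=> mz' e; apply: (IH z' a' b' mz'); rewrite e sz2 addSn -kz.
have [a3 [b3 [sm3 lab]]] := place_labels max2 sm2.
have zk : (size z2 <= k)%N := matching_size sm3.1.
set r := (k - size z2)%N in lab.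
have rk : (r <= k)%N := leq_subr _ _.
have kr : (k - r)%N = size z2 by rewrite subKn.
have krn : (k <= n - r)%N.
  rewrite leq_subRL; last exact: leq_trans rk (leq_kn hnk).
  by apply: leq_trans hnk; rewrite mul2n -addnn leq_add2r.
have [[u1 u2 me nz] _] := sm3.
pose s := unzip1 z2; pose t := unzip2 z2.
have ss : size s = (k - r)%N by rewrite size_map kr.
have st : size t = (k - r)%N by rewrite size_map kr.
have srt : sorted (fun x y : 'I_k => (x < y)%N) s.
  rewrite -(@sorted_map _ _ val ltn) ltn_sorted_uniq_leq map_inj_uniq; last exact: val_inj.
  rewrite u1 /= sorted_map /s /unzip1 sorted_map.
  by apply: sort_sorted => u v; exact: leq_total.
have off1 i : i \notin s -> (a3 i < r)%N by exact: (unmatched_l_lt hnk phiH max2 sm3).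
have off2 j : j \notin t -> (n - r <= b3 j)%N.
  exact: (unmatched_r_ge hnk phiH max2 sm3).
have on1 i : i \in s -> a3 i = (r + index i s)%N :> nat.
  by move=> /mapP[xy xyz ->]; rewrite lab // index_map_uniq.
have on2 j : j \in t -> b3 j = (r + index j t)%N :> nat.
  by move=> /mapP[xy xyz ->]; rewrite -me // lab // index_map_uniq.
have lt_k (u : seq 'I_k) i : size u = (k - r)%N -> i \in u -> (r + index i u < k)%N.
  by move=> su iu; rewrite -ltn_subRL -su index_mem.
have b3r j : (r <= b3 j)%N.
  have [/on2->|/off2] := boolP (j \in t); first exact: leq_addr.
  exact/leq_trans/(leq_trans rk).
pose S := [set p | p \notin s]; pose S' := [set p | p \notin t].
have [a4 [al4 nz4 lat4]] : exists a4 : word,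
    [/\ [forall i, if i \in S then (a4 i < r)%N else a4 i == a3 i],
        phi (a4, b3) != 0 & lattice S (fun i => a4 i)].
  apply: (@lattice_word n k S r (fun a => phi (a, b3)) a3) => //; last first.
    by apply/forallP=> i; case: ifP; rewrite ?eqxx // inE; exact: off1.
  (* All letters of b3 are at least r > q, so the dual side of the exchange equation is empty. *)
  move=> a' p q /forallP al pq qr; have := hw_eq phiH a' b3 pq.
  rewrite [RHS]big1 => [e|j /eqP bj]; last first.
    by move: qr; rewrite -bj ltnNge b3r.
  rewrite -[RHS]e; apply: eq_bigl => i; have := al i; case: ifPn => //= iS /eqP ai.
  rewrite inE negbK in iS; apply/esym/negbTE; rewrite -val_eqE /= ai on1 //.
  by rewrite neq_ltn orbC (leq_trans (ltn_trans pq qr)) ?leq_addr.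
have a4k i : (a4 i < k)%N.
  have := forallP al4 i; case: ifPn => [_ h|iS /eqP->]; first exact: leq_trans h rk.
  by rewrite inE negbK in iS; rewrite on1 // lt_k.
(* Reversing letters turns the equations on the dual factors into raising equations on letters below
   r, to which [lattice_word] applies. *)
pose rev (w : word) : word := [ffun j => rev_ord (w j)].
have revK w : rev (rev w) = w by apply/ffunP=> j; rewrite !ffunE rev_ordK.
have rev_upd w j q : rev (upd w j q) = upd (rev w) j (rev_ord q).
  by apply/ffunP=> x; rewrite !ffunE; case: eqP.
have rev_big i : (i < r)%N -> (k <= n - i.+1)%N.
  by move=> ir; apply: leq_trans krn _; exact: leq_sub2l.
have [b4 [al5 nz5 lat5]] : exists b4 : word,
    [/\ [forall i, if i \in S' then (b4 i < r)%N else b4 i == rev b3 i],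
        phi (a4, rev b4) != 0 & lattice S' (fun i => b4 i)].
  apply: (@lattice_word n k S' r (fun b => phi (a4, rev b)) (rev b3)) => //; last 2 first.
  - apply/forallP=> i; case: ifP; rewrite ?eqxx // inE => /off2 h.
    rewrite ffunE /= ltn_subLR ?ltn_ord //.
    by rewrite addSn ltnS addnC -leq_subLR.
  - by rewrite revK.
  (* The reversals of p and q are at least n - r >= k, beyond every letter of a4, so now the V side
     is empty. *)
  move=> b' p q /forallP al pq qr.
  have rpq : (rev_ord q < rev_ord p)%N by rewrite /= ltn_sub2l // (leq_ltn_trans pq).
  have := hw_eq phiH a4 (rev b') rpq.
  rewrite [LHS]big1 => [e|i /eqP ai]; last first.
    by have := a4k i; rewrite ai ltnNge rev_big.
  rewrite [RHS]e; apply: eq_big => [j|j _]; last by rewrite rev_upd.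
  rewrite ffunE (inj_eq rev_ord_inj).
  have := al j; case: ifPn => //= jS /eqP bj.
  rewrite inE negbK in jS; apply/esym/negbTE; rewrite -val_eqE /= bj ffunE /= on2 //.
  rewrite neq_ltn orbC (leq_trans (ltn_trans pq qr)) //.
  have := lt_k _ _ st jS => h; apply: leq_trans rk _.
  rewrite leq_subRL; last exact: leq_trans h (leq_kn hnk).
  by apply: leq_trans hnk; rewrite mul2n -addnn leq_add2r.
have [la [T [Hla HT rT]]] := lattice_tableau lat4.
have [mu [Ts [Hmu HTs rTs]]] := lattice_tableau lat5.
have cS : #|S| = r by rewrite card_off // ss subKn.
have cS' : #|S'| = r by rewrite card_off // st subKn.
have Hd : preadmissible (r, s, t, la, mu, T, Ts).
  rewrite /preadmissible rk srt ss st !eqxx HT HTs -{1}cS Hla -cS' Hmu.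
  by rewrite /= u2.
have := eval0 _ Hd; rewrite /= dot_dvec => /eqP; apply/negP.
(* The rows of T and [Ts] are the letters of a4 and b4, so the nonzero coordinate found is the one
   at x'_d. *)
suff -> : xidx hnk r s t T Ts = (a4, rev b4) by [].
rewrite [LHS]surjective_pairing; congr pair; apply/ffunP=> p; apply: val_inj.
  apply: etrans (xidx_val1 hnk Hd p) _; rewrite /vlabel.
  have := forallP al4 p; rewrite inE; case: (boolP (p \in s)) => ps /= h.
    by rewrite (eqP h) on1.
  by rewrite rT ?inE.
apply: etrans (xidx_val2 hnk Hd p) _; rewrite /wlabel.
have := forallP al5 p; rewrite inE; case: (boolP (p \in t)) => pt /= h.
  by rewrite ffunE (eqP h) ffunE rev_ordK on2.
by rewrite ffunE /= rTs ?inE // -subn1 -subnDA add1n.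
Qed.

Lemma hwspace_eval :
  (forall d : datum k, preadmissible d -> dot phi (datum_xvec hnk d) = 0) -> phi = 0.
Proof.
move=> eval0; apply: M_ext => -[a b]; rewrite M0E; apply/eqP/negPn/negP => nz.
have mz : matching [::] a b by split.
by apply: (no_matching eval0 (m := k.+1) mz); rewrite add0n.
Qed.

End EvaluationMain.

(** * Bases of highest weight vectors *)

Section Assembly.
Variables n k : nat.
Hypothesis hnk : (2 * k <= n)%N.
Local Notation M := (M n k).
Implicit Types (m w z v : M) (d : datum k) (W : {vspace M}).

Definition datum_derangement d : bool :=
  let: (r, s, t, _, _, _, _) := d in all2 (fun a b => a != b) s t.

Lemma admissibleE d : admissible_datum d = preadmissible d && datum_derangement d.
Proof.
case: d => [[[[[[r s] t] la] mu] T] Ts] /=; rewrite /admissible.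
case: (r <= k)%N => //=; case: (sorted _ s) => //=; case: (size s == _) => //=.
case: (uniq t) => //=; case: (size t == _) => //=.
by rewrite andbC.
Qed.

Lemma datum_hwv_hwspace d : preadmissible d -> datum_hwv hnk d \in @hwspace n k.
Proof. by case: d => [[[[[[r s] t] la] mu] T] Ts] Hd; exact: (yx_hwspace hnk Hd). Qed.

Lemma datum_pairing_neq0 d : preadmissible d ->
  dot (datum_hwv hnk d) (datum_pairing hnk d) != 0.
Proof. by case: d => [[[[[[r s] t] la] mu] T] Ts] Hd; exact: dot_yx_pairing Hd. Qed.

Lemma datum_eproj_pairing d m : admissible_datum d ->
  dot (eproj m) (datum_pairing hnk d) = dot m (datum_pairing hnk d).
Proof.
rewrite admissibleE; case: d => [[[[[[r s] t] la] mu] T] Ts] /andP[Hd dd].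
exact: dot_eproj_pairing Hd _ dd.
Qed.

Lemma datum_eproj_bad d : preadmissible d -> ~~ datum_derangement d ->
  eproj (datum_hwv hnk d) = 0.
Proof.
case: d => [[[[[[r s] t] la] mu] T] Ts] Hd dd; exact: (eproj_yx_bad hnk Hd dd).
Qed.

Lemma datum_weight r s t la mu T Ts (h : 'rV[CC]_n) :
  preadmissible (r, s, t, la, mu, T, Ts) ->
  act (diag_mx h) (eproj (yop s t T Ts (dvec (xidx hnk r s t T Ts)))) =
  (\sum_(q < n) h 0 q * (hw la mu q)%:~R) *:
    eproj (yop s t T Ts (dvec (xidx hnk r s t T Ts))).
Proof.
move=> Hd; rewrite -eproj_act -yop_act (xvec_weight hnk Hd).
rewrite linear_scale; last exact: yop_is_linear.
by rewrite linear_scale //; exact: eproj_seq_is_linear.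
Qed.

Definition datum_eproj d : M := eproj (datum_hwv hnk d).

Lemma datum_eproj_hwspace d : preadmissible d -> datum_eproj d \in @hwspace n k.
Proof.
move=> /datum_hwv_hwspace/hwspaceP h; apply/hwspaceP => p q pq.
rewrite /datum_eproj -eproj_act h //; exact: (linear0 (@eproj n k)).
Qed.

Lemma datum_eproj_weight d : preadmissible d -> weight_vector (datum_eproj d).
Proof.
case: d => [[[[[[r s] t] la] mu] T] Ts] Hd h; rewrite /datum_eproj /datum_hwv.
by eexists; exact: datum_weight Hd.
Qed.

Lemma summandE d : preadmissible d -> summand n d = Ugen (datum_eproj d).
Proof.
case: d => [[[[[[r s] t] la] mu] T] Ts] Hd.
by rewrite /summand (xprimeE hnk Hd).
Qed.

Lemma free_hwv (l : seq (datum k)) : uniq l -> {in l, forall d, preadmissible d} ->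
  free (map (datum_hwv hnk) l).
Proof.
move=> ul pl; pose phi d m : CC := dot m (datum_pairing hnk d).
apply: (@free_triangular _ _ (@datum_lt k) l _ phi) => //.
- exact: datum_lt_irr.
- exact: datum_lt_trans.
- by move=> d; exact: dotr_is_linear.
- by move=> d /pl; exact: datum_pairing_neq0.
by move=> d d' /pl pd /pl pd'; exact: datum_triangular.
Qed.

Lemma free_eproj (l : seq (datum k)) : uniq l ->
  {in l, forall d, admissible_datum d} -> free (map datum_eproj l).
Proof.
move=> ul al; pose phi d m : CC := dot m (datum_pairing hnk d).
have pl : {in l, forall d, preadmissible d}.
  by move=> d /al; rewrite admissibleE => /andP[].
apply: (@free_triangular _ _ (@datum_lt k) l _ phi) => //.
- exact: datum_lt_irr.
- exact: datum_lt_trans.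
- by move=> d; exact: dotr_is_linear.
- move=> d dl; rewrite /phi datum_eproj_pairing ?al //.
  exact/datum_pairing_neq0/pl.
move=> d d' dl dl'; rewrite /phi datum_eproj_pairing ?al //.
exact: datum_triangular (pl _ dl) (pl _ dl').
Qed.

(* A list of linearly independent vectors has length at most dim M, so a
   longest duplicate-free list of data contains them all. *)
Lemma all_data : exists l : seq (datum k), uniq l /\ forall d, (d \in l) = preadmissible d.
Proof.
pose P (j : nat) := `[< exists l, [/\ uniq l, {in l, forall d, preadmissible d} & size l = j] >].
have exP : exists j, P j by exists 0%N; apply/asboolP; exists [::].
have ubP (j : nat) : P j -> (j <= \dim {:M})%N.
  move=> /asboolP[l [ul pl <-]]; have := free_hwv ul pl.
  by rewrite /free size_map => /eqP <-; apply: dimvS; exact: subvf.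
case: (ex_maxnP exP ubP) => m /asboolP[l [ul pl sl]] maxm.
exists l; split=> // d; apply/idP/idP => [/pl//|pd]; apply: contraT => nd.
have : (m.+1 <= m)%N; last by rewrite ltnn.
apply: maxm; apply/asboolP; exists (d :: l); rewrite /= nd ul sl; split=> // d'.
by rewrite inE => /orP[/eqP->|/pl].
Qed.

Lemma dim_le_functionals (I : Type) (l : seq I) (f : I -> M -> CC^o) W :
  (forall i, linear (f i)) ->
  (forall m, m \in W -> (forall i : 'I_(size l), f (tnth (in_tuple l) i) m = 0) -> m = 0) ->
  (\dim W <= size l)%N.
Proof.
move=> lf inj; pose ev m : 'rV[CC]_(size l) := \row_i f (tnth (in_tuple l) i) m.
have evl : linear ev.
  by move=> c m w; apply/rowP => i; rewrite !mxE lf.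
pose L := GRing.isLinear.Build _ _ _ _ ev evl.
pose E : {linear M -> 'rV[CC]_(size l)} := HB.pack ev L.
rewrite -(limg_ker_dim (linfun E) W).
have -> : (W :&: lker (linfun E))%VS = 0%VS.
  apply/eqP; rewrite -subv0; apply/subvP => m; rewrite memv_cap memv_ker lfunE.
  case/andP=> mW /eqP/rowP e0; rewrite memv0; apply/eqP/inj => // i.
  by have := e0 i; rewrite !mxE.
rewrite dimv0 add0n; apply: leq_trans (dimvS (subvf _)) _.
by rewrite dimvf /dim /= mul1n.
Qed.

(** Equality by dimension: the y_d x'_d are independent, and the evaluations at the x'_d, one per
    datum, separate extremal vectors. *)
Lemma hwspace_span (l : seq (datum k)) : uniq l ->
  (forall d, (d \in l) = preadmissible d) ->
  (@hwspace n k = <<map (datum_hwv hnk) l>>)%VS.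
Proof.
move=> ul pl.
have fl : free (map (datum_hwv hnk) l) by apply: free_hwv => // d; rewrite pl.
apply/esym/eqP; rewrite eqEdim; apply/andP; split.
  by apply/span_subvP => _ /mapP[d dl ->]; apply: datum_hwv_hwspace; rewrite -pl.
have /eqP -> := fl; rewrite size_map.
apply: (@dim_le_functionals _ l (fun d m => dot m (datum_xvec hnk d))) => [d|m mH m0].
  exact: dotr_is_linear.
apply: (hwspace_eval (hnk := hnk) mH) => d pd.
have dl : (index d l < size l)%N by rewrite index_mem pl.
have := m0 (Ordinal dl); rewrite (tnth_nth d) /= nth_index //.
by rewrite pl.
Qed.

(** Pairing with a basis of W cuts out a subspace of codimension at most dim W, which meets W
    trivially by positive definiteness. *)
Lemma orthogonal_complement W : exists W' : {vspace M},
  (forall m, m \in W' <-> forall w, w \in W -> dot m w = 0) /\ (W + W' = fullv)%VS.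
Proof.
pose B := vbasis W.
pose ev m : 'rV[CC]_(\dim W) := \row_i dot m (tnth B i).
have evl : linear ev.
  by move=> c m w; apply/rowP => i; rewrite !mxE dotDl dotZl.
pose L := GRing.isLinear.Build _ _ _ _ ev evl.
pose E : {linear M -> 'rV[CC]_(\dim W)} := HB.pack ev L.
have WP m : m \in lker (linfun E) <-> forall w, w \in W -> dot m w = 0.
  rewrite memv_ker lfunE; split=> [/eqP/rowP e0 w wW|h].
    rewrite (coord_vbasis wW) dot_sumr big1 // => i _; rewrite dotZr.
    by have := e0 i; rewrite !mxE (tnth_nth 0) => ->; rewrite mulr0.
  by apply/eqP/rowP => i; rewrite !mxE h // vbasis_mem // mem_tnth.
exists (lker (linfun E)); split=> //; apply/eqP; rewrite eqEdim subvf /=.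
have cap0 : (W :&: lker (linfun E))%VS = 0%VS.
  apply/eqP; rewrite -subv0; apply/subvP => m; rewrite memv_cap => /andP[mW].
  by move=> /WP/(_ m mW)/dot_eq0->; rewrite mem0v.
rewrite dimv_disjoint_sum // -(limg_ker_dim (linfun E) fullv) capfv addnC leq_add2r.
by apply: leq_trans (dimvS (subvf _)) _; rewrite dimvf /dim /= mul1n.
Qed.

Lemma limg_eproj (l : seq (datum k)) :
  (forall d, (d \in l) = admissible_datum d) ->
  limg (linfun (@eproj n k)) = (\sum_(d <- l) Ugen (datum_eproj d))%VS.
Proof.
move=> al; set e := linfun _; set W := (\sum_(d <- l) _)%VS.
have eE : equivariant e by move=> x m; rewrite !lfunE /= eproj_act.
have sW : submodule W by apply: sum_submodule => d; exact: Ugen_submodule.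
have sE : submodule (limg e).
  by apply: limg_submodule => // x m _; exact: memvf.
have memW d : d \in l -> datum_eproj d \in W.
  move=> dl; rewrite /W (big_rem d dl) /=.
  exact: subvP (addvSl _ _) _ (mem_Ugen _).
have idE m : m \in limg e -> eproj m = m.
  by case/memv_imgP=> u _ ->; rewrite lfunE /= eproj_idem.
have WE : (W <= limg e)%VS.
  apply: (big_ind (fun U => U <= limg e)%VS) => [|U U' h h'|d _].
  - exact: sub0v.
  - by rewrite subv_add h.
  apply: Ugen_min => //; rewrite /datum_eproj.
  by have := memv_img e (memvf (datum_hwv hnk d)); rewrite lfunE.
have [W' [W'P full]] := orthogonal_complement W.
have sW' : submodule W'.
  by move=> x m /W'P h; apply/W'P => w wW; rewrite dot_act h // sW.
apply/eqP; rewrite eqEsubv WE andbT.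
have [Z0|Z0] := eqVneq (limg e :&: W')%VS 0%VS.
  apply/subvP => m mE; have : m \in (W + W')%VS by rewrite full memvf.
  case/memv_addP => w wW [p pW' mwp].
  have : p \in (limg e :&: W')%VS.
    rewrite memv_cap pW' andbT; have -> : p = m - w by rewrite mwp addrAC subrr add0r.
    by rewrite memvB // (subvP WE).
  by rewrite Z0 memv0 => /eqP p0; rewrite mwp p0 addr0.
have sZ : submodule (limg e :&: W')%VS.
  by move=> x m; rewrite !memv_cap => /andP[mE mW']; rewrite sE ?sW'.
have [z [zZ z0 zH]] := submodule_hw sZ Z0.
move: zZ; rewrite memv_cap => /andP[zE zW']; case/eqP: z0.
apply: dot_eq0; move/W'P: zW'; apply.
have [all [uall allP]] := all_data; rewrite (hwspace_span uall allP) in zH.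
(* Since z = e z, it lies in the span of the e y_d x'_d. These vectors are in W or zero, so z is in
   W and orthogonal to itself. *)
rewrite -(idE z zE).
have -> : eproj z = e z by rewrite lfunE.
have : e z \in (e @: <<map (datum_hwv hnk) all>>)%VS by exact: memv_img.
rewrite limg_span; apply: subvP; apply/span_subvP => _ /mapP[_ /mapP[d dall ->] ->].
rewrite lfunE /=; have [dd|dd] := boolP (datum_derangement d).
  by apply: memW; rewrite al admissibleE -allP dall.
by rewrite datum_eproj_bad ?mem0v // -allP.
Qed.

End Assembly.

(** In (2), [ds] is any duplicate-free enumeration of the data; filtering the list of [all_data] by
    [datum_derangement] provides one. *)
Theorem theorem1p17 (n k : nat) (hnk : (2 * k <= n)%N) :
  (* (1) *)
  (forall (r : nat) (s t : seq 'I_k) (la mu : seq nat) (T Ts : tableau k),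
     admissible r s t la mu T Ts ->
     let e := linfun (@eproj n k) in
     let y := linfun (@yop n k s t T Ts) in
     let x' := xprime n r s t T Ts in
     ((e \o y \o e)%VF @: Ugen (x') = Ugen (e (y x')))%VS /\
     Ugen (e (y x')) = (e @: Ugen (y x'))%VS /\
     (Ugen (e (y x')) <= limg e)%VS /\
     irreducible_of_highest_weight la mu (Ugen (e (y x')))) /\
  (* (2) *)
  (forall ds : seq (datum k),
     uniq ds -> (forall d, (d \in ds) = admissible_datum d) ->
     limg (linfun (@eproj n k)) = (\sum_(d <- ds) summand n d)%VS /\
     directv (\sum_(d <- ds) summand n d)).
Proof.
split=> [r s t la mu T Ts adm e y x'|ds uds dsP].
  have /andP[Hd dd] : preadmissible (r, s, t, la, mu, T, Ts) &&
      datum_derangement (r, s, t, la, mu, T, Ts) by rewrite -admissibleE.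
  have eE : equivariant e by move=> x m; rewrite !lfunE /= eproj_act.
  have yE : equivariant y by move=> x m; rewrite !lfunE /= yop_act.
  have eyx : e (y x') = datum_eproj hnk (r, s, t, la, mu, T, Ts).
    by rewrite !lfunE /= /x' (xprimeE hnk Hd).
  have ex : e x' = x' by rewrite lfunE /= /x' (xprimeE hnk Hd) (eproj_x hnk Hd dd).
  have wH := datum_eproj_hwspace hnk Hd; have ww := datum_eproj_weight hnk Hd.
  have w0 : datum_eproj hnk (r, s, t, la, mu, T, Ts) != 0.
    have := datum_pairing_neq0 hnk Hd; rewrite -datum_eproj_pairing ?admissibleE ?Hd //.
    by apply: contraNneq; rewrite /datum_eproj => ->; rewrite dot0l.
  split; first by rewrite limg_Ugen ?comp_lfunE ?ex //; do 2?apply: equivariant_comp.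
  split; first by rewrite limg_Ugen.
  split.
    apply: Ugen_min; last exact/memv_img/memvf.
    by apply: limg_submodule => // x m _; exact: memvf.
  rewrite eyx; split; first exact: Ugen_irreducible.
  exists (datum_eproj hnk (r, s, t, la, mu, T, Ts)); first exact: mem_Ugen.
  split=> //; first exact/hwspaceP.
  by move=> h; exact: datum_weight Hd.
have pre d : d \in ds -> preadmissible d by rewrite dsP admissibleE => /andP[].
have sumE : (\sum_(d <- ds) summand n d)%VS = (\sum_(d <- ds) Ugen (datum_eproj hnk d))%VS.
  by apply: eq_big_seq => d /pre; exact: summandE.
split; first by rewrite sumE; exact: limg_eproj.
have [||dimE _] := @Ugen_direct n k _ ds (datum_eproj hnk).
- by move=> d /pre pd; split; [exact: datum_eproj_hwspace|exact: datum_eproj_weight].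
- by apply: free_eproj => // d; rewrite dsP.
rewrite directvE /= sumE dimE; apply/eqP.
by apply: eq_big_seq => d /pre pd; rewrite (summandE hnk pd).
Qed.
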